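(* Let $(\mathcal M^{2n},g,J)$ be a Kähler manifold of arbitrary signature and let $A$ be c-compatible with $(g,J)$. For $t\in\mathbb R$ let $K_t^{ij}=\sqrt{\det(t\,\mathrm{Id}-A)}\,\big((t\,\mathrm{Id}-A)^{-1}\big)^i_l\,g^{lj}$ and let $\hat I_t$ be the second order differential operator acting on functions by $\hat I_t(f)=-\nabla_j\big(K_t^{jk}\nabla_k f\big)$. Then for any pair of real numbers $(v,w)$ the operators $\hat I_v$ and $\hat I_w$ commute: $[\hat I_v,\hat I_w]=0$.
   Context: Kähler manifold (arbitrary signature): a manifold $\mathcal M$ of real dimension $2n$ with a (pseudo-)Riemannian metric $g$ with Levi-Civita connection $\nabla$ and a complex structure $J$ ($J^2=-\mathrm{Id}$) such that $g(JX,Y)=-g(X,JY)$ and $\nabla J=0$. Put $\Omega(X,Y)=g(JX,Y)$. Indices are raised and lowered with $g$, and the Einstein summation convention is used. c-compatible: a $(1,1)$-tensor $A$ is c-compatible with $(g,J)$ if it is Hermitian ($g$-self-adjoint and commuting with $J$) and $$\nabla_kA_{ij}=\lambda_i g_{jk}+\lambda_j g_{ik}+\bar\lambda_i\Omega_{jk}+\bar\lambda_j\Omega_{ik},\qquad \lambda=\tfrac14\operatorname{tr}A,\quad \lambda_i=\nabla_i\lambda,\quad \bar\lambda_i=J^j_i\lambda_j .$$ Square root convention: all eigenvalues of $A$ have even algebraic multiplicity, and $\sqrt{\det(t\,\mathrm{Id}-A)}$ denotes the monic polynomial of degree $n$ in $t$ obtained by halving the powers of the eigenvalue factors of $\det(t\,\mathrm{Id}-A)$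 (it may be negative). With this convention $K_t$ is a polynomial of degree $n-1$ in $t$, hence is defined for all $t\in\mathbb R$, including $t$ in the spectrum of $A$. *)

(* Defs.v *)
(* MathComp-Analysis.  The real numbers are an arbitrary [R : realType]. *)
From mathcomp Require Import all_boot all_order all_algebra.
From mathcomp Require Import complex.
From mathcomp Require Import all_classical all_reals all_analysis.

Set Implicit Arguments.
Unset Strict Implicit.
Unset Printing Implicit Defensive.

Import Order.TTheory GRing.Theory Num.Theory.
Import numFieldNormedType.Exports.
Local Open Scope classical_set_scope.
Local Open Scope ring_scope.

(** * Smooth manifolds *)

Record chart (R : realType) (m : nat) (M : topologicalType) := Chart {
  dom : set M;
  chart_fun : M -> 'rV[R]_m;
  param : 'rV[R]_m -> M;
  dom_open : open dom;
  codom_open : open (chart_fun @` dom);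
  chart_funK : forall p, dom p -> param (chart_fun p) = p;
  chart_fun_continuous : forall p, dom p -> {for p, continuous chart_fun};
  param_continuous : forall x, (chart_fun @` dom) x -> {for x, continuous param}
}.

(* The coordinate field d/dx^k of the chart c, applied to f. The result is only
   meaningful on [dom c], where it depends only on the germ of f. *)
Definition pd (R : realType) (m : nat) (M : topologicalType) (c : chart R m M)
    (k : 'I_m) (f : M -> R) : M -> R :=
  fun p => 'D_(delta_mx 0 k) (f \o param c : 'rV[R]_m -> R^o) (chart_fun c p).

(* C^oo on the open set D `&` dom c: the iterated partial derivatives of all
   orders exist and are (Frechet) differentiable, hence continuous. *)
Definition smooth_in (R : realType) (m : nat) (M : topologicalType)
    (c : chart R m M) (D : set M) (f : M -> R) : Prop :=
  forall (s : seq 'I_m) (p : M), D p -> dom c p ->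
    differentiable (foldr (pd c) f s \o param c : 'rV[R]_m -> R^o) (chart_fun c p).

Record manifold (R : realType) (m : nat) (M : topologicalType) := Manifold {
  chart_index : Type;
  atlas :> chart_index -> chart R m M;
  manifold_hausdorff : hausdorff_space M;
  manifold_second_countable : @second_countable M;
  atlas_cover : forall p, exists a, dom (atlas a) p;
  atlas_smooth : forall (a b : chart_index) (k : 'I_m),
    smooth_in (atlas a) (dom (atlas b)) (fun p => chart_fun (atlas b) p 0 k)
}.

Definition chart_at (R : realType) (m : nat) (M : topologicalType)
    (X : manifold R m M) (p : M) : chart_index X :=
  sval (cid (atlas_cover X p)).

Definition smooth (R : realType) (m : nat) (M : topologicalType)
    (X : manifold R m M) (f : M -> R) : Prop :=
  forall a : chart_index X, smooth_in (X a) setT f.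

(** * Tensor fields

   A field of 2-tensors is given by its matrix of components in every chart a of
   the atlas, as a function on M that is only meaningful on [dom (X a)]. For a
   (0,2)-tensor the (i, j) entry is T_{ij}; for a (1,1)-tensor it is T^i_j, so
   that endomorphisms act on columns of components of vectors. *)
Definition components (R : realType) (m : nat) (M : topologicalType)
  (X : manifold R m M) := chart_index X -> M -> 'M[R]_m.

(* (k, i) entry: derivative of the k-th coordinate of b along d/dx^i of a *)
Definition transition_jac (R : realType) (m : nat) (M : topologicalType)
    (X : manifold R m M) (a b : chart_index X) (p : M) : 'M[R]_m :=
  \matrix_(k, i) pd (X a) i (fun q => chart_fun (X b) q 0 k) p.

Definition smooth_components (R : realType) (m : nat) (M : topologicalType)
    (X : manifold R m M) (T : components X) : Prop :=
  forall (a : chart_index X) (i j : 'I_m), smooth_in (X a) setT (fun p => T a p i j).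

Definition tensor02 (R : realType) (m : nat) (M : topologicalType)
    (X : manifold R m M) (T : components X) : Prop :=
  smooth_components T /\
  forall (a b : chart_index X) (p : M), dom (X a) p -> dom (X b) p ->
    T a p = (transition_jac a b p)^T *m T b p *m transition_jac a b p.

Definition tensor11 (R : realType) (m : nat) (M : topologicalType)
    (X : manifold R m M) (T : components X) : Prop :=
  smooth_components T /\
  forall (a b : chart_index X) (p : M), dom (X a) p -> dom (X b) p ->
    transition_jac a b p *m T a p = T b p *m transition_jac a b p.

(** * The Levi-Civita connection *)

(* A metric of arbitrary signature. *)
Definition pseudo_metric (R : realType) (m : nat) (M : topologicalType)
    (X : manifold R m M) (g : components X) : Prop :=
  tensor02 g /\
  forall (a : chart_index X) (p : M), dom (X a) p ->
    (g a p)^T = g a p /\ g a p \in unitmx.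

(* [christoffel g a p i j k] is Gamma^i_{jk} *)
Definition christoffel (R : realType) (m : nat) (M : topologicalType)
    (X : manifold R m M) (g : components X) (a : chart_index X) (p : M)
    (i j k : 'I_m) : R :=
  2^-1 * \sum_(l < m) invmx (g a p) i l *
    (pd (X a) j (fun q => g a q l k) p + pd (X a) k (fun q => g a q l j) p
     - pd (X a) l (fun q => g a q j k) p).

(* nabla_k T_{ij} *)
Definition nabla02 (R : realType) (m : nat) (M : topologicalType)
    (X : manifold R m M) (g T : components X) (a : chart_index X) (p : M)
    (k i j : 'I_m) : R :=
  pd (X a) k (fun q => T a q i j) p
  - \sum_(l < m) christoffel g a p l k i * T a p l j
  - \sum_(l < m) christoffel g a p l k j * T a p i l.

(* nabla_k T^i_j *)
Definition nabla11 (R : realType) (m : nat) (M : topologicalType)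
    (X : manifold R m M) (g T : components X) (a : chart_index X) (p : M)
    (k i j : 'I_m) : R :=
  pd (X a) k (fun q => T a q i j) p
  + \sum_(l < m) christoffel g a p i k l * T a p l j
  - \sum_(l < m) christoffel g a p l k j * T a p i l.

(* nabla_j V^j, where V i is the i-th component of the vector field in chart a *)
Definition divergence (R : realType) (m : nat) (M : topologicalType)
    (X : manifold R m M) (g : components X) (a : chart_index X) (V : 'I_m -> M -> R)
    (p : M) : R :=
  \sum_(j < m) (pd (X a) j (V j) p
                + \sum_(l < m) christoffel g a p j j l * V l p).

(** * Kahler structures and c-compatible tensors *)

(* The matrix identity is g(JX,Y) = - g(X,JY). Integrability of J is a
   consequence of nabla J = 0. *)
Definition kahler (R : realType) (n : nat) (M : topologicalType)
    (X : manifold R (2 * n) M) (g J : components X) : Prop :=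
  [/\ pseudo_metric g,
      tensor11 J,
      (forall (a : chart_index X) (p : M), dom (X a) p -> J a p *m J a p = - 1%:M),
      (forall (a : chart_index X) (p : M), dom (X a) p ->
         (J a p)^T *m g a p = - (g a p *m J a p))
    & forall (a : chart_index X) (p : M) (k i j : 'I_(2 * n)), dom (X a) p ->
         nabla11 g J a p k i j = 0].

(* Omega(X,Y) = g(JX,Y), i.e. Omega_{ij} = J^l_i g_{lj} *)
Definition Omega (R : realType) (m : nat) (M : topologicalType)
    (X : manifold R m M) (g J : components X) : components X :=
  fun a p => (J a p)^T *m g a p.

(* A_{ij} = g_{il} A^l_j *)
Definition lower (R : realType) (m : nat) (M : topologicalType)
    (X : manifold R m M) (g A : components X) : components X :=
  fun a p => g a p *m A a p.

(* lambda_i = d_i (tr A / 4) *)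
Definition dlambda (R : realType) (m : nat) (M : topologicalType)
    (X : manifold R m M) (A : components X) (a : chart_index X) (p : M)
    (i : 'I_m) : R :=
  pd (X a) i (fun q => 4^-1 * \tr (A a q)) p.

(* J^j_i lambda_j *)
Definition dlambdabar (R : realType) (m : nat) (M : topologicalType)
    (X : manifold R m M) (J A : components X) (a : chart_index X) (p : M)
    (i : 'I_m) : R :=
  \sum_(j < m) J a p j i * dlambda A a p j.

Definition c_compatible (R : realType) (m : nat) (M : topologicalType)
    (X : manifold R m M) (g J A : components X) : Prop :=
  [/\ tensor11 A,
      (* g(AX,Y) = g(X,AY) *)
      (forall (a : chart_index X) (p : M), dom (X a) p ->
         (A a p)^T *m g a p = g a p *m A a p),
      (forall (a : chart_index X) (p : M), dom (X a) p ->
         A a p *m J a p = J a p *m A a p)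
    & forall (a : chart_index X) (p : M) (i j k : 'I_m), dom (X a) p ->
         nabla02 g (lower g A) a p k i j =
           dlambda A a p i * g a p j k + dlambda A a p j * g a p i k
           + dlambdabar J A a p i * Omega g J a p j k
           + dlambdabar J A a p j * Omega g J a p i k].

(** * The operators *)

(* The square root of det(t Id - B): the monic real polynomial in which every
   complex eigenvalue of B has half of its algebraic multiplicity. *)
Definition sqrt_char_poly (R : realType) (m : nat) (B : 'M[R]_m) : {poly R} :=
  xget 0 [set q : {poly R} | q \is monic /\
    forall z : R[i], mup z (map_poly (real_complex R) q) =
                     (mup z (map_poly (real_complex R) (char_poly B)))./2].

(* sqrt(det(t Id - B)) (t Id - B)^{-1} as a polynomial in t with matrix
   coefficients: the one that takes this value at every t outside the spectrum
   of B. It is thereby defined at the eigenvalues of B, too. *)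
Definition K_poly (R : realType) (m : nat) (B : 'M[R]_m) : 'M[{poly R}]_m :=
  xget 0 [set P : 'M[{poly R}]_m |
    forall t : R, t%:M - B \in unitmx ->
      map_mx (horner_eval t) P = (sqrt_char_poly B).[t] *: invmx (t%:M - B)].

(* K_t^{ij} *)
Definition K_tensor (R : realType) (m : nat) (M : topologicalType)
    (X : manifold R m M) (g A : components X) (t : R) (a : chart_index X)
    (p : M) : 'M[R]_m :=
  map_mx (horner_eval t) (K_poly (A a p)) *m invmx (g a p).

(* - nabla_j (K_t^{jk} nabla_k f), computed in the chart a *)
Definition Ihat_in (R : realType) (m : nat) (M : topologicalType)
    (X : manifold R m M) (g A : components X) (t : R) (a : chart_index X)
    (f : M -> R) (p : M) : R :=
  - divergence g a
      (fun j q => \sum_(k < m) K_tensor g A t a q j k * pd (X a) k f q) p.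

(* The value at p is independent of the chart around p by tensoriality. *)
Definition Ihat (R : realType) (m : nat) (M : topologicalType)
    (X : manifold R m M) (g A : components X) (t : R) (f : M -> R) : M -> R :=
  fun p => Ihat_in g A t (chart_at X p) f p.

(* Main.v *)
Require Import Defs.
From HB Require Import structures.
From mathcomp Require Import all_boot all_order all_algebra.
From mathcomp Require Import complex perm ring zify.
From mathcomp Require Import all_classical all_reals all_analysis.

(** In a chart, let [F] be the ring of smooth functions on an open set, [d_k] the
    partial derivatives, [L] the gradient of [lambda], [u] that of [f], [H] the
    Hessian of [f]. If [v] and [w] are off the spectrum of [A] there, put
    [a = (v - A)^-1], [b = (w - A)^-1] and let [q_v], [q_w] be the square roots of
    the determinants, so [K_v = q_v a]. Expanding with
    [nabla_k A = L (.) e_k], [nabla_k a = a (L (.) e_k) a] and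
    [d_k q_v = - 2 q_v <a L, e_k>] gives
      [K_v grad (div (K_w u)) - K_w grad (div (K_v u)) = div (S + T)],
    where [S = K_v H K_w - K_w H K_v] and [T] is a multiple of [a b Z a b] with
    [Z = X + J X J], [X] the bivector of [L] and [u]. Terms with the Hessian of
    [lambda] are cancelled by the Ricci identity, for which [A] must commute with
    that Hessian; this follows from the pair symmetry of the curvature. As [S] and
    [T] are skew, [div div (S + T) = 0], which is the commutation.

    The square root of [det (t - A)] exists since [A] preserves the eigenspaces of
    [J], which are conjugate and dual to each other under [g]. Hence
    [K_t = sum_j t^j K_j] with smooth [K_j], and the commutator at a point is a
    polynomial in [v] and [w] that vanishes off the spectrum of [A], thus
    everywhere. *)

Set Implicit Arguments.
Unset Strict Implicit.
Unset Printing Implicit Defensive.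

Import Order.TTheory GRing.Theory Num.Theory.
Import numFieldNormedType.Exports.
Local Open Scope classical_set_scope.
Local Open Scope ring_scope.

(** * Metric connections over a commutative ring *)

(** The tensor calculus is purely algebraic: tensors are matrices over a commutative ring with
    commuting derivations, and one half is an element [h] with [h + h = 1]. Analysis enters through
    Schwarz's theorem, which gives [derC], and through the construction of the ring. The factor
    [w - v] in [T] comes from the resolvent identity [a - b = (w - v) a b]; it makes [T] vanish for
    [v = w], as the commutator does. Two obstacles shape the rest. A given [v] may lie in the
    spectrum of [A] on a whole open set, for instance at a constant eigenvalue, and the square root
    of the determinant has zeros, where it cannot be treated as an analytic root. Both are avoided
    by passing to coefficients in [t]: those of the square root arise from those of the
    characteristic polynomial by ring operations and halving, so they are smooth on the whole chart.
    Moreover [Ihat] chooses a chart at each point, so that a composition mixes charts even near one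
    point. Chart independence is therefore part of the proof; it rests on the uniqueness of the
    Levi-Civita connection. *)

Record frame (F : comNzRingType) (m : nat) := Frame {
  der :> 'I_m -> F -> F;
  derD : forall k x y, der k (x + y) = der k x + der k y;
  derM : forall k x y, der k (x * y) = der k x * y + x * der k y;
  derC : forall k l x, der k (der l x) = der l (der k x)
}.

Section Derivations.
Variables (F : comNzRingType) (m : nat) (d : frame F m).
Implicit Types (k l : 'I_m) (x y : F).

Lemma der0 k : d k 0 = 0.
Proof. by apply: (addrI (d k 0)); rewrite -derD !addr0. Qed.

Lemma derN k x : d k (- x) = - d k x.
Proof. by apply: (addrI (d k x)); rewrite -derD !subrr der0. Qed.

Lemma derB k x y : d k (x - y) = d k x - d k y.
Proof. by rewrite derD derN. Qed.

Lemma der1 k : d k 1 = 0.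
Proof.
by apply: (addrI (d k 1)); rewrite addr0 -{3}[1]mulr1 derM mulr1 mul1r.
Qed.

Lemma der_sum k (I : Type) (r : seq I) (P : pred I) (E : I -> F) :
  d k (\sum_(i <- r | P i) E i) = \sum_(i <- r | P i) d k (E i).
Proof. exact: (big_morph (d k) (derD d k) (der0 k)). Qed.

Definition dmx k p q (X : 'M[F]_(p, q)) : 'M[F]_(p, q) := map_mx (d k) X.

Section Dmx.
Variable k : 'I_m.

Lemma dmxD p q (X Y : 'M[F]_(p, q)) : dmx k (X + Y) = dmx k X + dmx k Y.
Proof. by apply/matrixP => i j; rewrite !mxE derD. Qed.

Lemma dmxN p q (X : 'M[F]_(p, q)) : dmx k (- X) = - dmx k X.
Proof. by apply/matrixP => i j; rewrite !mxE derN. Qed.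

Lemma dmxB p q (X Y : 'M[F]_(p, q)) : dmx k (X - Y) = dmx k X - dmx k Y.
Proof. by rewrite dmxD dmxN. Qed.

Lemma dmxZ p q x (X : 'M[F]_(p, q)) :
  dmx k (x *: X) = d k x *: X + x *: dmx k X.
Proof. by apply/matrixP => i j; rewrite !mxE derM. Qed.

Lemma dmxM p q r (X : 'M[F]_(p, q)) (Y : 'M[F]_(q, r)) :
  dmx k (X *m Y) = dmx k X *m Y + X *m dmx k Y.
Proof.
apply/matrixP => i j; rewrite !mxE der_sum -big_split.
by apply: eq_bigr => l _; rewrite derM !mxE.
Qed.

Lemma dmx_trmx p q (X : 'M[F]_(p, q)) : dmx k X^T = (dmx k X)^T.
Proof. by apply/matrixP => i j; rewrite !mxE. Qed.

Lemma der_mxtrace p (X : 'M[F]_p) : d k (\tr X) = \tr (dmx k X).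
Proof. by rewrite der_sum; apply: eq_bigr => i _; rewrite mxE. Qed.

Lemma dmx_scalar p x : dmx k (x%:M : 'M[F]_p) = (d k x)%:M.
Proof.
by apply/matrixP => i j; rewrite !mxE; case: (i == j); rewrite ?der0.
Qed.

Lemma dmx_delta p q i j : dmx k (delta_mx i j : 'M[F]_(p, q)) = 0.
Proof.
apply/matrixP => i' j'; rewrite !mxE.
by case: (_ && _); rewrite ?der0 ?der1.
Qed.

End Dmx.

Lemma dmxC k l p q (X : 'M[F]_(p, q)) : dmx k (dmx l X) = dmx l (dmx k X).
Proof. by apply/matrixP => i j; rewrite !mxE derC. Qed.

End Derivations.

(* Linear identities between matrices are settled entrywise by [ring], the
   products of matrices being kept as atoms. *)
Lemma mx_addE (V : nmodType) p q (X Y : 'M[V]_(p, q)) i j :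
  (X + Y) i j = X i j + Y i j.
Proof. by rewrite mxE. Qed.

Lemma mx_oppE (V : zmodType) p q (X : 'M[V]_(p, q)) i j : (- X) i j = - X i j.
Proof. by rewrite mxE. Qed.

Lemma mx_scaleE (F : pzRingType) p q x (X : 'M[F]_(p, q)) i j :
  (x *: X) i j = x * X i j.
Proof. by rewrite mxE. Qed.

Lemma mx_mulnE (V : nmodType) p q (X : 'M[V]_(p, q)) n i j :
  (X *+ n) i j = X i j *+ n.
Proof. by rewrite mulmxnE. Qed.

Lemma mx_zeroE (V : nmodType) p q i j : (0 : 'M[V]_(p, q)) i j = 0.
Proof. by rewrite mxE. Qed.

Ltac mxring :=
  let i := fresh "i" in let j := fresh "j" in
  apply/matrixP => i j;
  rewrite ?(mx_addE, mx_oppE, mx_scaleE, mx_mulnE, mx_zeroE); ring.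

Lemma mx_trD (V : nmodType) p q (X Y : 'M[V]_(p, q)) : (X + Y)^T = X^T + Y^T.
Proof. by apply/matrixP => i j; rewrite !mxE. Qed.

Lemma mx_trN (V : zmodType) p q (X : 'M[V]_(p, q)) : (- X)^T = - X^T.
Proof. by apply/matrixP => i j; rewrite !mxE. Qed.

Lemma mx_mulnl (F : pzRingType) p q r (X : 'M[F]_(p, q)) (Y : 'M[F]_(q, r)) n :
  (X *+ n) *m Y = (X *m Y) *+ n.
Proof. exact: (raddfMn (mulmxr Y)). Qed.

Lemma mx_mulnr (F : pzRingType) p q r (X : 'M[F]_(p, q)) (Y : 'M[F]_(q, r)) n :
  X *m (Y *+ n) = (X *m Y) *+ n.
Proof. exact: (raddfMn (mulmx X)). Qed.

Lemma mxtraceN (F : pzRingType) p (X : 'M[F]_p) : \tr (- X) = - \tr X.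
Proof. exact: (raddfN (@mxtrace F p)). Qed.

Lemma mxtraceMn (F : pzRingType) p (X : 'M[F]_p) n : \tr (X *+ n) = \tr X *+ n.
Proof. exact: (raddfMn (@mxtrace F p)). Qed.

(* Without a lock, rewriting with [mulmxDl] or [mulmxA] unfolds these notions. *)
Fact geometry_key : unit. Proof. by []. Qed.

(** * Linear algebra of a nondegenerate symmetric form with a skew complex structure *)

Section Bilinear.
Variables (F : comNzRingType) (m : nat) (g gi : 'M[F]_m).
Hypotheses (gT : g^T = g) (ggi : g *m gi = 1%:M).
Implicit Types (x y z : 'cV[F]_m) (X Y Z : 'M[F]_m).

Definition ev_of (k : 'I_m) : 'cV[F]_m := delta_mx k 0.
Local Notation ev := ev_of.
(** The basis dual to [ev] under [g]: an index is contracted by summing over [ev k] and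
    [dual_ev k]. *)
Definition dual_ev_of (k : 'I_m) : 'cV[F]_m :=
  locked_with geometry_key (gi *m ev k).
Local Notation dual_ev := dual_ev_of.

Lemma unlock_dual_ev k : dual_ev k = gi *m ev k.
Proof. exact: locked_withE. Qed.

Definition adj_of Y : 'M[F]_m :=
  locked_with geometry_key (gi *m Y^T *m g).
Local Notation adj := adj_of.

Lemma unlock_adj Y : adj Y = gi *m Y^T *m g.
Proof. exact: locked_withE. Qed.

Definition ip_of x y : F := locked_with geometry_key ((x^T *m g *m y) 0 0).
Local Notation ip := ip_of.

Lemma unlock_ip x y : ip x y = (x^T *m g *m y) 0 0.
Proof. exact: locked_withE. Qed.
(** In indices this is [x^i y_j], the endomorphism that sends [z] to [ip y z *: x]. *)
Definition outer_of x y : 'M[F]_m :=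
  locked_with geometry_key (x *m (y^T *m g)).
Local Notation outer := outer_of.

Lemma unlock_outer x y : outer x y = x *m (y^T *m g).
Proof. exact: locked_withE. Qed.

Lemma gig : gi *m g = 1%:M.
Proof. exact: mulmx1C. Qed.

Lemma giT : gi^T = gi.
Proof.
rewrite -[LHS]mul1mx -gig -mulmxA -[X in X *m gi^T]gT -trmx_mul gig trmx1.
by rewrite mulmx1.
Qed.

Lemma adjM X Y : adj (X *m Y) = adj Y *m adj X.
Proof.
rewrite !unlock_adj trmx_mul !mulmxA -[_ *m g *m gi]mulmxA ggi mulmx1.
by rewrite -!mulmxA.
Qed.

Lemma adjD X Y : adj (X + Y) = adj X + adj Y.
Proof. by rewrite !unlock_adj mx_trD mulmxDr mulmxDl. Qed.

Lemma adjN X : adj (- X) = - adj X.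
Proof. by rewrite !unlock_adj mx_trN mulmxN mulNmx. Qed.

Lemma adjB X Y : adj (X - Y) = adj X - adj Y.
Proof. by rewrite adjD adjN. Qed.

Lemma adjZ c X : adj (c *: X) = c *: adj X.
Proof. by rewrite !unlock_adj linearZ /= -scalemxAr -scalemxAl. Qed.

Lemma adj_scalar c : adj c%:M = c%:M.
Proof. by rewrite !unlock_adj tr_scalar_mx mul_mx_scalar -scalemxAl gig scalemx1. Qed.

Lemma adjK X : adj (adj X) = X.
Proof.
rewrite !unlock_adj !trmx_mul trmxK gT giT !mulmxA gig mul1mx.
by rewrite -mulmxA gig mulmx1.
Qed.

Lemma mxtrace_adj X : \tr (adj X) = \tr X.
Proof. by rewrite !unlock_adj mxtrace_mulC mulmxA ggi mul1mx mxtrace_tr. Qed.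

Lemma ipC x y : ip x y = ip y x.
Proof.
rewrite !unlock_ip -[x^T *m g *m y]trmxK mxE !trmx_mul trmxK gT.
by rewrite mulmxA.
Qed.

Lemma ipDl x y z : ip (x + y) z = ip x z + ip y z.
Proof. by rewrite !unlock_ip mx_trD !mulmxDl mxE. Qed.
Lemma ipNl x z : ip (- x) z = - ip x z.
Proof. by rewrite !unlock_ip mx_trN !mulNmx mxE. Qed.
Lemma ipBl x y z : ip (x - y) z = ip x z - ip y z.
Proof. by rewrite ipDl ipNl. Qed.
Lemma ipZl c x z : ip (c *: x) z = c * ip x z.
Proof. by rewrite !unlock_ip linearZ /= -!scalemxAl mxE. Qed.
Lemma ipDr x y z : ip z (x + y) = ip z x + ip z y.
Proof. by rewrite ipC ipDl !(ipC z). Qed.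
Lemma ipNr x z : ip z (- x) = - ip z x.
Proof. by rewrite ipC ipNl !(ipC z). Qed.
Lemma ipZr c x z : ip z (c *: x) = c * ip z x.
Proof. by rewrite ipC ipZl !(ipC z). Qed.
Lemma ip0r x : ip x 0 = 0.
Proof. by rewrite !unlock_ip mulmx0 mxE. Qed.
Lemma ip_suml I (r : seq I) (P : pred I) (E : I -> 'cV_m) z :
  ip (\sum_(i <- r | P i) E i) z = \sum_(i <- r | P i) ip (E i) z.
Proof.
apply: (big_morph (ip^~ z)) => [x y|]; first exact: ipDl.
by rewrite ipC ip0r.
Qed.

Lemma ip_adjr X x y : ip x (X *m y) = ip (adj X *m x) y.
Proof.
rewrite !unlock_ip !unlock_adj !trmx_mul trmxK gT giT !mulmxA -[_ *m gi *m g]mulmxA gig.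
by rewrite mulmx1.
Qed.

Lemma ip_adjl X x y : ip (X *m x) y = ip x (adj X *m y).
Proof. by rewrite ip_adjr adjK. Qed.

Lemma outer_mulv x y z : outer x y *m z = ip y z *: x.
Proof.
rewrite !unlock_outer !unlock_ip -mulmxA [X in x *m X]mx11_scalar.
by rewrite mul_mx_scalar.
Qed.

Lemma mulmx_outer X x y : X *m outer x y = outer (X *m x) y.
Proof. by rewrite !unlock_outer mulmxA. Qed.

Lemma outer_mulmx X x y : outer x y *m X = outer x (adj X *m y).
Proof.
rewrite !unlock_outer !unlock_adj !trmx_mul trmxK gT giT !mulmxA.
by rewrite -[_ *m gi *m g]mulmxA gig mulmx1.
Qed.

Lemma mxtrace_outer x y : \tr (outer x y) = ip y x.
Proof. by rewrite !unlock_outer mxtrace_mulC !unlock_ip -mulmxA /mxtrace big_ord1. Qed.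

Lemma adj_outer x y : adj (outer x y) = outer y x.
Proof.
rewrite !unlock_adj !unlock_outer !trmx_mul trmxK gT !mulmxA.
by rewrite gig mul1mx.
Qed.

Lemma ip_ev x (k : 'I_m) : ip x (dual_ev k) = x k 0.
Proof.
rewrite !unlock_ip !unlock_dual_ev mulmxA -[_ *m g *m gi]mulmxA ggi mulmx1 mxE.
rewrite (bigD1 k) //= big1 ?addr0; first by rewrite !mxE !eqxx mulr1.
by move=> i /negPf ik; rewrite !mxE ik mulr0.
Qed.

Lemma cV_sum_ev x : x = \sum_k x k 0 *: ev k.
Proof.
rewrite [LHS]matrix_sum_delta; apply: eq_bigr => k _.
by rewrite big_ord1.
Qed.

Lemma sum_dual_ev x Y Z :
  \sum_k ip x (Y *m dual_ev k) *: (Z *m ev k) = Z *m (adj Y *m x).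
Proof.
rewrite [X in Z *m X]cV_sum_ev mulmx_sumr; apply: eq_bigr => k _.
by rewrite -scalemxAr ip_adjr ip_ev.
Qed.

Lemma sum_ev x Y Z :
  \sum_k ip x (Y *m ev k) *: (Z *m dual_ev k) = Z *m (adj Y *m x).
Proof.
transitivity (\sum_k ip x ((Y *m g) *m dual_ev k) *: ((Z *m gi) *m ev k)).
  apply: eq_bigr => k _.
  have evE : ev k = g *m dual_ev k by rewrite unlock_dual_ev mulmxA ggi mul1mx.
  by rewrite -!mulmxA -evE -unlock_dual_ev.
rewrite sum_dual_ev adjM [adj g]unlock_adj gT gig mul1mx -!mulmxA.
by rewrite [gi *m (g *m _)]mulmxA gig mul1mx.
Qed.

Lemma sum_ip_ev Y Z : \sum_k ip (Y *m ev k) (Z *m dual_ev k) = \tr (adj Z *m Y).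
Proof.
apply: eq_bigr => k _; rewrite ip_adjr ip_ev mulmxA !mxE.
rewrite (bigD1 k) //= big1 ?addr0; first by rewrite !mxE !eqxx mulr1.
by move=> i /negPf ik; rewrite !mxE ik mulr0.
Qed.

Variable J : 'M[F]_m.
Hypotheses (JJ : J *m J = - 1%:M) (Jskew : adj J = - J).

(* c-compatibility of [A] reads [nabla_k A = sym Lambda e_k]. *)
Definition sym_of x y : 'M[F]_m :=
  locked_with geometry_key
    (outer x y + outer y x + outer (J *m x) (J *m y) + outer (J *m y) (J *m x)).
Local Notation sym := sym_of.

Lemma unlock_sym x y : sym x y =
  outer x y + outer y x + outer (J *m x) (J *m y) + outer (J *m y) (J *m x).
Proof. exact: locked_withE. Qed.

Lemma JJv x : J *m (J *m x) = - x.
Proof. by rewrite mulmxA JJ mulNmx mul1mx. Qed.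

Lemma sym_mulv x y z : sym x y *m z =
  ip y z *: x + ip x z *: y + ip (J *m y) z *: (J *m x)
  + ip (J *m x) z *: (J *m y).
Proof. by rewrite !unlock_sym !mulmxDl !outer_mulv. Qed.

(** For [x] the gradient of [lambda], the summand is [nabla_k A] times [Y], applied to the k-th dual
    vector. Divergences of functions of [A] reduce to this contraction. *)
Lemma sum_sym_mulv x Y : \sum_k sym x (ev k) *m Y *m dual_ev k =
  \tr Y *: x + adj Y *m x - \tr (J *m Y) *: (J *m x)
  + J *m (adj Y *m (J *m x)).
Proof.
under eq_bigr do rewrite -mulmxA sym_mulv.
rewrite !big_split /= -!scaler_suml; congr (_ + _ + _ + _).
- under eq_bigr do rewrite -[ev _]mul1mx.
  by rewrite sum_ip_ev mulmx1 mxtrace_adj.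
- under eq_bigr do rewrite -[ev _]mul1mx.
  by rewrite sum_dual_ev mul1mx.
- rewrite sum_ip_ev -[RHS]scaleNr; congr (_ *: _).
  by rewrite -[LHS]mxtrace_adj adjM adjK Jskew mulNmx raddfN.
- by rewrite sum_dual_ev.
Qed.

(** The companion of [sum_sym_mulv] for gradients: with [x] the gradient of [lambda] it
    differentiates [\tr (A *m Y)] with [Y] held fixed. *)
Lemma sum_tr_sym x Y : \sum_k \tr (sym x (ev k) *m Y) *: dual_ev k =
  Y *m x + adj Y *m x - J *m (Y *m (J *m x)) - J *m (adj Y *m (J *m x)).
Proof.
have E1 z Z : \sum_k ip z (Z *m ev k) *: dual_ev k = adj Z *m z.
  under eq_bigr do rewrite -[dual_ev _]mul1mx.
  by rewrite sum_ev mul1mx.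
have E2 z Z : \sum_k ip (Z *m ev k) z *: dual_ev k = adj Z *m z.
  by under eq_bigr do rewrite ipC; exact: E1.
transitivity (\sum_k (ip (adj Y *m ev k) x + ip (adj Y *m x) (1%:M *m ev k)
    + ip (adj Y *m J *m ev k) (J *m x) + ip (adj Y *m (J *m x)) (J *m ev k))
   *: dual_ev k).
  apply: eq_bigr => k _; congr (_ *: _).
  by rewrite !unlock_sym !mulmxDl !mxtraceD !outer_mulmx !mxtrace_outer mul1mx !mulmxA.
under eq_bigr do rewrite !scalerDl.
rewrite !big_split /=; congr (_ + _ + _ + _).
- by rewrite E2 adjK.
- by rewrite E1 adj_scalar mul1mx.
- by rewrite E2 adjM adjK Jskew !mulNmx -mulmxA.
- by rewrite E1 Jskew mulNmx.
Qed.
End Bilinear.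

(** * Covariant derivatives, gradient and divergence *)

Section Connection.
Variables (F : comNzRingType) (m : nat) (d : frame F m) (g gi : 'M[F]_m).
Variable Gam : 'I_m -> 'M[F]_m.
Hypotheses (gT : g^T = g) (ggi : g *m gi = 1%:M).
Hypothesis metricity : forall k, dmx d k g = (Gam k)^T *m g + g *m Gam k.
Implicit Types (x y : 'cV[F]_m) (X Y : 'M[F]_m) (k l : 'I_m).

Local Notation ev := (@ev_of F m).
Local Notation dual_ev := (dual_ev_of gi).
Local Notation adj := (adj_of g gi).
Local Notation ip := (ip_of g).
Local Notation outer := (outer_of g).

Definition nab_of k x :=
  locked_with geometry_key (dmx d k x + Gam k *m x).
Local Notation nab := nab_of.

Lemma unlock_nab k x : nab k x = dmx d k x + Gam k *m x.
Proof. exact: locked_withE. Qed.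

Definition nabE_of k X :=
  locked_with geometry_key (dmx d k X + Gam k *m X - X *m Gam k).
Local Notation nabE := nabE_of.

Lemma unlock_nabE k X : nabE k X = dmx d k X + Gam k *m X - X *m Gam k.
Proof. exact: locked_withE. Qed.

Lemma nabD k x y : nab k (x + y) = nab k x + nab k y.
Proof. by rewrite !unlock_nab dmxD mulmxDr; mxring. Qed.

Lemma nabN k x : nab k (- x) = - nab k x.
Proof. by rewrite !unlock_nab dmxN mulmxN; mxring. Qed.

Lemma nabZ k c x : nab k (c *: x) = d k c *: x + c *: nab k x.
Proof. by rewrite !unlock_nab dmxZ -scalemxAr; mxring. Qed.

Lemma nabM k X x : nab k (X *m x) = nabE k X *m x + X *m nab k x.
Proof.
by rewrite !unlock_nab !unlock_nabE dmxM !(mulmxDl, mulmxDr, mulNmx, mulmxA); mxring.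
Qed.

Lemma nabED k X Y : nabE k (X + Y) = nabE k X + nabE k Y.
Proof. by rewrite !unlock_nabE dmxD mulmxDr mulmxDl; mxring. Qed.

Lemma nabEN k X : nabE k (- X) = - nabE k X.
Proof. by rewrite !unlock_nabE dmxN mulmxN mulNmx; mxring. Qed.

Lemma nabEB k X Y : nabE k (X - Y) = nabE k X - nabE k Y.
Proof. by rewrite nabED nabEN. Qed.

Lemma nabEZ k c X : nabE k (c *: X) = d k c *: X + c *: nabE k X.
Proof. by rewrite !unlock_nabE dmxZ -scalemxAr -scalemxAl; mxring. Qed.

Lemma nabEM k X Y : nabE k (X *m Y) = nabE k X *m Y + X *m nabE k Y.
Proof.
by rewrite !unlock_nabE dmxM !(mulmxDl, mulmxDr, mulNmx, mulmxN, mulmxA); mxring.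
Qed.

Lemma nabE_scalar k c : nabE k c%:M = (d k c)%:M.
Proof. by rewrite !unlock_nabE dmx_scalar mul_mx_scalar mul_scalar_mx; mxring. Qed.

Lemma der_mxtrace_nabE k X : d k (\tr X) = \tr (nabE k X).
Proof.
by rewrite !unlock_nabE raddfB raddfD /= (mxtrace_mulC X) der_mxtrace addrK.
Qed.

Lemma dmx_gi k : dmx d k gi = - (gi *m (Gam k)^T + Gam k *m gi).
Proof.
have : dmx d k (g *m gi) = 0 by rewrite ggi dmx_scalar der1 raddf0.
rewrite dmxM metricity mulmxDl -mulmxA ggi mulmx1 => /(congr1 (mulmx gi)).
rewrite mulmx0 !mulmxDr !mulmxA (gig ggi) !mul1mx => /eqP.
by rewrite addrC addr_eq0 => /eqP ->.
Qed.

Lemma nabE_adj k X : nabE k (adj X) = adj (nabE k X).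
Proof.
rewrite !unlock_nabE !unlock_adj !dmxM dmx_gi metricity dmx_trmx !(mx_trD, mx_trN).
rewrite !trmx_mul !(mulmxDl, mulmxDr, mulNmx, mulmxN) !mulmxA. mxring.
Qed.

Lemma der_ip k x y : d k (ip x y) = ip (nab k x) y + ip x (nab k y).
Proof.
have -> : d k (ip x y) = dmx d k (x^T *m g *m y) 0 0.
  by rewrite unlock_ip [RHS]mxE.
rewrite !dmxM metricity dmx_trmx !unlock_ip !unlock_nab !mx_trD.
rewrite !trmx_mul !(mulmxDl, mulmxDr) !mulmxA !mx_addE; ring.
Qed.

Lemma nabE_outer k x y : nabE k (outer x y) = outer (nab k x) y + outer x (nab k y).
Proof.
rewrite !unlock_nabE !unlock_outer !dmxM metricity dmx_trmx !unlock_nab.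
by rewrite !mx_trD !trmx_mul !(mulmxDl, mulmxDr) !mulmxA; mxring.
Qed.

(** The covariant differential of a vector field as an endomorphism. For a gradient it is the
    Hessian with one index raised. *)
Definition jac_of x : 'M[F]_m :=
  locked_with geometry_key (\sum_k nab k x *m (ev k)^T).
Local Notation jac := jac_of.

Lemma unlock_jac x : jac x = \sum_k nab k x *m (ev k)^T.
Proof. exact: locked_withE. Qed.

Definition dvg_of X : 'cV[F]_m :=
  locked_with geometry_key (\sum_k nabE k X *m dual_ev k).
Local Notation dvg := dvg_of.

Lemma unlock_dvg X : dvg X = \sum_k nabE k X *m dual_ev k.
Proof. exact: locked_withE. Qed.

Definition dv_of x : F := \tr (jac x).
Local Notation dv := dv_of.
Definition grd_of (s : F) : 'cV[F]_m :=
  locked_with geometry_key (\sum_k d k s *: dual_ev k).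
Local Notation grd := grd_of.

Lemma unlock_grd (s : F) : grd s = \sum_k d k s *: dual_ev k.
Proof. exact: locked_withE. Qed.

Lemma sum_mul_ev (E : 'I_m -> 'cV[F]_m) k :
  (\sum_i E i *m (ev i)^T) *m ev k = E k.
Proof.
rewrite mulmx_suml (bigD1 k) //= big1 ?addr0 => [|i ik].
  rewrite -mulmxA trmx_delta mul_delta_mx -[RHS]mulmx1; congr (_ *m _).
  by apply/matrixP => a b; rewrite !mxE !ord1.
by rewrite -mulmxA trmx_delta mul_delta_mx_0 ?mulmx0.
Qed.

Lemma jac_ev x k : jac x *m ev k = nab k x.
Proof. by rewrite unlock_jac sum_mul_ev. Qed.

Lemma ip_grd s k : ip (grd s) (ev k) = d k s.
Proof.
rewrite !unlock_grd (ip_suml gT) (bigD1 k) //= big1 ?addr0 => [|i ik].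
  by rewrite (ipZl g) ipC // ip_ev // mxE !eqxx mulr1.
by rewrite (ipZl g) ipC // ip_ev // mxE (negPf ik) mulr0.
Qed.

Lemma dvD x y : dv (x + y) = dv x + dv y.
Proof.
rewrite /dv !unlock_jac -raddfD -big_split /=; congr (\tr _).
by apply: eq_bigr => k _; rewrite nabD mulmxDl.
Qed.

Lemma dvN x : dv (- x) = - dv x.
Proof.
rewrite /dv !unlock_jac -raddfN -sumrN /=; congr (\tr _).
by apply: eq_bigr => k _; rewrite nabN mulNmx.
Qed.

Lemma dvgD X Y : dvg (X + Y) = dvg X + dvg Y.
Proof.
rewrite !unlock_dvg -big_split; apply: eq_bigr => k _.
by rewrite nabED mulmxDl.
Qed.

Lemma dvgN X : dvg (- X) = - dvg X.
Proof.
rewrite !unlock_dvg -sumrN; apply: eq_bigr => k _.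
by rewrite nabEN mulNmx.
Qed.

Lemma dvgB X Y : dvg (X - Y) = dvg X - dvg Y.
Proof. by rewrite dvgD dvgN. Qed.

Lemma dvgM X Y :
  dvg (X *m Y) = \sum_k nabE k X *m Y *m dual_ev k + X *m dvg Y.
Proof.
rewrite !unlock_dvg mulmx_sumr -big_split; apply: eq_bigr => k _.
by rewrite nabEM mulmxDl -!mulmxA.
Qed.

(** Leibniz rule. As [nabE k X] inherits self-adjointness from [X], it can be moved off [x] onto the
    dual vector, which produces [dvg X]. *)
Lemma dv_mulmx X x : adj X = X -> dv (X *m x) = \tr (X *m jac x) + ip (dvg X) x.
Proof.
move=> Xs; rewrite /dv.
have -> : jac (X *m x) = \sum_k nabE k X *m x *m (ev k)^T + X *m jac x.
  rewrite !unlock_jac mulmx_sumr -big_split; apply: eq_bigr => k _.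
  by rewrite nabM mulmxDl !mulmxA.
rewrite mxtraceD addrC; congr (_ + _).
rewrite !unlock_dvg raddf_sum (ip_suml gT); apply: eq_bigr => k _ /=.
rewrite (ip_adjl gT ggi) -nabE_adj Xs (ipC gT) (ip_ev ggi) mxtrace_mulC.
by rewrite trmx_delta -rowE trace_mx11 mxE.
Qed.

End Connection.

(** * Curvature of a torsion-free metric connection *)

Section Curvature.
Variables (F : comNzRingType) (m : nat) (d : frame F m) (g gi : 'M[F]_m).
Variables (Gam : 'I_m -> 'M[F]_m) (h : F).
Hypotheses (gT : g^T = g) (ggi : g *m gi = 1%:M).
Hypothesis metricity : forall k, dmx d k g = (Gam k)^T *m g + g *m Gam k.
Hypothesis torsion : forall k l, Gam k *m ev_of F l = Gam l *m ev_of F k.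
Hypothesis hh : h + h = 1.
Implicit Types (x y : 'cV[F]_m) (X Y : 'M[F]_m) (k l : 'I_m).

Local Notation ev := (@ev_of F m).
Local Notation dual_ev := (dual_ev_of gi).
Local Notation adj := (adj_of g gi).
Local Notation ip := (ip_of g).
Local Notation nab := (nab_of d Gam).
Local Notation nabE := (nabE_of d Gam).
Local Notation jac := (jac_of d Gam).
Local Notation dvg := (dvg_of d gi Gam).
Local Notation dv := (dv_of d Gam).
Local Notation grd := (grd_of d gi).

Lemma double_eq0 (x : F) : x + x = 0 -> x = 0.
Proof. by move=> xx; rewrite -[x]mul1r -hh mulrDl -mulrDr xx mulr0. Qed.

Lemma sum_skew (H : 'I_m -> 'I_m -> F) :
  (forall i j, H i j = - H j i) -> \sum_i \sum_j H i j = 0.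
Proof.
move=> Hs; apply: double_eq0; rewrite {1}exchange_big -big_split big1 //= => i _.
by rewrite -big_split big1 //= => j _; rewrite Hs addNr.
Qed.

Lemma mulmx_ev X i j : (X *m ev j) i 0 = X i j.
Proof. by rewrite -colE mxE. Qed.

Lemma self_adjoint_ev X :
  (forall k l, ip (X *m ev k) (ev l) = ip (ev k) (X *m ev l)) -> adj X = X.
Proof.
move=> H; have E : X^T *m g = g *m X.
  apply/matrixP => k l; move: (H k l); rewrite !unlock_ip trmx_mul -!mulmxA.
  by rewrite trmx_delta -!rowE !mulmxA -!colE !mxE.
by rewrite !unlock_adj -mulmxA E mulmxA (gig ggi) mul1mx.
Qed.

Lemma nab_ev k l : nab k (ev l) = Gam k *m ev l.
Proof. by rewrite !unlock_nab dmx_delta add0r. Qed.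

Lemma nab_ev_sym k l : nab k (ev l) = nab l (ev k).
Proof. by rewrite !nab_ev torsion. Qed.

(** Metricity gives the (i, j) entry of the Hessian as [d i (d j s) - ip (grd s) (nab i (ev j))];
    the first term is symmetric by [derC], the second by vanishing torsion. *)
Lemma adj_jac_grd s : adj (jac (grd s)) = jac (grd s).
Proof.
apply: self_adjoint_ev => k l; rewrite !jac_ev (ipC gT _ (nab _ _)).
have E i j : ip (nab i (grd s)) (ev j) = d i (d j s) - ip (grd s) (nab i (ev j)).
  by rewrite -[d j s](ip_grd d gT ggi) (der_ip metricity) addrK.
by rewrite !E derC nab_ev_sym.
Qed.

Definition curv_of k l : 'M[F]_m :=
  locked_with geometry_key
    (dmx d k (Gam l) - dmx d l (Gam k) + Gam k *m Gam l - Gam l *m Gam k).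
Local Notation curv := curv_of.

Lemma unlock_curv k l : curv k l =
  dmx d k (Gam l) - dmx d l (Gam k) + Gam k *m Gam l - Gam l *m Gam k.
Proof. exact: locked_withE. Qed.

Lemma curv_anti k l : curv l k = - curv k l.
Proof. by rewrite !unlock_curv; mxring. Qed.

Lemma nab_comm k l x : nab k (nab l x) - nab l (nab k x) = curv k l *m x.
Proof.
rewrite !unlock_nab !unlock_curv !dmxD !dmxM dmxC !(mulmxDl, mulmxDr, mulNmx) !mulmxA.
mxring.
Qed.

Lemma nabE_comm k l X :
  nabE k (nabE l X) - nabE l (nabE k X) = curv k l *m X - X *m curv k l.
Proof.
rewrite !unlock_nabE !unlock_curv !(dmxD, dmxN) !dmxM dmxC.
rewrite !(mulmxDl, mulmxDr, mulNmx, mulmxN) !mulmxA; mxring.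
Qed.

Lemma curv_skew k l : adj (curv k l) = - curv k l.
Proof.
have : dmx d k (dmx d l g) - dmx d l (dmx d k g) = 0.
  by rewrite dmxC subrr.
rewrite !metricity !dmxD !dmxM !metricity !dmx_trmx => E.
have {}E : (curv k l)^T *m g = - (g *m curv k l).
  apply/eqP; rewrite -addr_eq0 -E !unlock_curv; apply/eqP.
  rewrite !(mx_trD, mx_trN) !trmx_mul.
  rewrite !(mulmxDl, mulmxDr, mulNmx, mulmxN) !mulmxA; mxring.
by rewrite !unlock_adj -mulmxA E mulmxN mulmxA (gig ggi) mul1mx.
Qed.

Lemma bianchi k l p :
  curv k l *m ev p + curv l p *m ev k + curv p k *m ev l = 0.
Proof.
rewrite -!nab_comm (nab_ev_sym p l) (nab_ev_sym p k) (nab_ev_sym k l).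
mxring.
Qed.

Let r k l p j := ip (curv k l *m ev p) (ev j).

Let r_anti1 k l p j : r l k p j = - r k l p j.
Proof. by rewrite /r curv_anti mulNmx ipNl. Qed.

Let r_anti2 k l p j : r k l j p = - r k l p j.
Proof. by rewrite /r (ip_adjl gT ggi) curv_skew mulNmx (ipNr gT) (ipC gT). Qed.

Let r_bianchi k l p j : r k l p j + r l p k j + r p k l j = 0.
Proof. by rewrite /r -!ipDl bianchi (ipC gT) ip0r. Qed.

(** The octahedron argument. Of the four Bianchi sums, the first two minus the last two leave, by
    antisymmetry in either pair, twice the difference of the two sides. *)
Lemma curv_pair k l p j :
  ip (curv k l *m ev p) (ev j) = ip (curv p j *m ev k) (ev l).
Proof.
apply/eqP; rewrite -subr_eq0; apply/eqP/double_eq0.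
have E2 : r l p j k + r p j l k + r j l p k = 0 by exact: r_bianchi.
have E3 : r p j k l + r j k p l + r k p j l = 0 by exact: r_bianchi.
have E4 : r j k l p + r k l j p + r l j k p = 0 by exact: r_bianchi.
rewrite (r_anti2 l p k j) (r_anti1 l j p k) (r_anti2 p j k l) in E2.
rewrite (r_anti1 k j p l) (r_anti2 k j l p) (r_anti1 p k j l)
  (r_anti2 p k l j) in E3.
rewrite (r_anti1 k j l p) (r_anti2 k l p j) (r_anti2 l j p k) in E4.
rewrite -/(r k l p j) -/(r p j k l).
have := congr2 (fun a b : F => a - b)
  (congr2 +%R (r_bianchi k l p j) E2) (congr2 +%R E3 E4).
rewrite !addr0 subrr => <-; ring.
Qed.

Lemma trmx_mulmx_gi X : (X *m gi)^T = adj X *m gi.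
Proof. by rewrite trmx_mul (giT gT ggi) !unlock_adj -mulmxA ggi mulmx1. Qed.

(** The contraction of the curvature with [X] that appears when third derivatives of a function are
    reordered; [curv_op 1%:M] is the Ricci endomorphism. *)
Definition curv_op_of X : 'M[F]_m :=
  locked_with geometry_key (\sum_k (\sum_l curv k l *m X *m dual_ev l) *m (ev k)^T).
Local Notation curv_op := curv_op_of.

Lemma unlock_curv_op X : curv_op X =
  \sum_k (\sum_l curv k l *m X *m dual_ev l) *m (ev k)^T.
Proof. exact: locked_withE. Qed.

Lemma curv_op_ev X k : curv_op X *m ev k = \sum_l curv k l *m X *m dual_ev l.
Proof. by rewrite unlock_curv_op sum_mul_ev. Qed.

(** Pair symmetry followed by both antisymmetries turns [r k l p j] into [r j p l k], and the
    coefficients [S p l] are symmetric. *)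
Lemma adj_curv_op X : adj X = X -> adj (curv_op X) = curv_op X.
Proof.
move=> Xs; apply: self_adjoint_ev => k j; rewrite (ipC gT (ev k)).
pose S := X *m gi.
have Ssym p l : S p l = S l p.
  have ST : S^T = S by rewrite /S trmx_mulmx_gi Xs.
  by rewrite -{1}ST mxE.
have E a b : ip (curv_op X *m ev a) (ev b) = \sum_l \sum_p S p l * r a l p b.
  rewrite curv_op_ev (ip_suml gT); apply: eq_bigr => l _.
  rewrite -mulmxA !unlock_dual_ev (mulmxA X) -/S [S *m _]cV_sum_ev mulmx_sumr.
  rewrite (ip_suml gT); apply: eq_bigr => p _.
  by rewrite -scalemxAr ipZl mulmx_ev.
rewrite !E exchange_big; apply: eq_bigr => p _; apply: eq_bigr => l _.
by rewrite Ssym /r curv_pair -/(r _ _ _ _) r_anti1 r_anti2 opprK.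
Qed.

Lemma dv_coord x : dv x = \sum_k (d k (x k 0) + \sum_l Gam k k l * x l 0).
Proof.
rewrite /dv !unlock_jac raddf_sum; apply: eq_bigr => k _ /=.
by rewrite mxtrace_mulC trmx_delta -rowE trace_mx11 unlock_nab !mxE.
Qed.

Lemma dvE x : dv x = \sum_k (d k (x k 0) + \tr (Gam k) * x k 0).
Proof.
rewrite dv_coord !big_split; congr (_ + _) => /=.
rewrite exchange_big; apply: eq_bigr => l _; rewrite -mulr_suml; congr (_ * _).
by apply: eq_bigr => k _; rewrite -mulmx_ev torsion mulmx_ev.
Qed.

(** Of the two Christoffel terms, one contracts the symmetric lower indices of [Gam] with the skew
    [S] and vanishes; torsion-freeness turns the other one into the trace of [Gam]. *)
Lemma dvg_coord Y (S := Y *m gi) : adj Y = - Y -> forall i,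
  dvg Y i 0 = \sum_k d k (S i k) + \sum_k S i k * \tr (Gam k).
Proof.
move=> Ys i.
have Sskew p q : S p q = - S q p.
  have ST : S^T = - S by rewrite /S trmx_mulmx_gi Ys mulNmx.
  by rewrite -[S p q]opprK -mx_oppE -ST mxE.
transitivity (\sum_k (d k (S i k) + \sum_l Gam k i l * S l k
    + \sum_l S i l * Gam k k l)).
  rewrite !unlock_dvg summxE; apply: eq_bigr => k _.
  have -> : nabE k Y *m dual_ev k =
      (dmx d k S + Gam k *m S + S *m (Gam k)^T) *m ev k.
    rewrite !unlock_dual_ev mulmxA; congr (_ *m _).
    rewrite !unlock_nabE /S dmxM (dmx_gi ggi metricity).
    rewrite !(mulmxDl, mulmxDr, mulNmx, mulmxN) !mulmxA; mxring.
  rewrite mulmx_ev !mxE; congr (_ + _).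
  by apply: eq_bigr => l _; rewrite !mxE.
rewrite !big_split /= (sum_skew (H := fun k l => Gam k i l * S l k)) ?addr0.
  congr (_ + _); rewrite exchange_big; apply: eq_bigr => l _.
  rewrite -mulr_sumr; congr (_ * _).
  by apply: eq_bigr => k _; rewrite -mulmx_ev torsion mulmx_ev.
move=> k l; rewrite Sskew mulrN; congr (- (_ * _)).
by rewrite -mulmx_ev torsion mulmx_ev.
Qed.

(** In coordinates every remaining term is antisymmetric under exchange of [i] and [k], once the
    form [c k = \tr (Gam k)] is closed. It is closed because its exterior derivative is the trace of
    the skew-adjoint [curv]. *)
Lemma dv_dvg_skew Y : adj Y = - Y -> dv (dvg Y) = 0.
Proof.
move=> Ys; rewrite dvE.
pose S := Y *m gi; pose c k := \tr (Gam k).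
have Sskew p q : S p q = - S q p.
  have ST : S^T = - S by rewrite /S trmx_mulmx_gi Ys mulNmx.
  by rewrite -[S p q]opprK -mx_oppE -ST mxE.
have cC k l : d k (c l) = d l (c k).
  have : \tr (curv k l) = 0.
    apply: double_eq0; rewrite -{1}(mxtrace_adj ggi) curv_skew raddfN.
    exact: addNr.
  rewrite !unlock_curv !(raddfB, raddfD) /= (mxtrace_mulC (Gam k)) addrK.
  by rewrite -!der_mxtrace => /eqP; rewrite subr_eq0 => /eqP.
transitivity (\sum_i \sum_k (d i (d k (S i k)) + d i (S i k) * c k
    + S i k * d i (c k) + c i * d k (S i k) + c i * (S i k * c k))).
  apply: eq_bigr => i _; rewrite (dvg_coord Ys) derD !der_sum mulrDr !mulr_sumr.
  rewrite -!big_split; apply: eq_bigr => k _ /=; rewrite derM /c /S; ring.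
apply: sum_skew => i k; rewrite (Sskew i k) !derN (cC i k) derC; ring.
Qed.

End Curvature.

(** * c-compatible endomorphisms *)

Lemma inverse_comm (F : comNzRingType) m (P X Y : 'M[F]_m) :
  X *m P = 1%:M -> P *m Y = Y *m P -> X *m Y = Y *m X.
Proof.
move=> XP PY; have PX := mulmx1C XP.
by rewrite -[X *m Y]mulmx1 -{1}PX mulmxA -(mulmxA X) -PY mulmxA XP mul1mx.
Qed.

Section Compatible.
Variables (F : comNzRingType) (m : nat) (d : frame F m) (g gi : 'M[F]_m).
Variables (Gam : 'I_m -> 'M[F]_m) (h : F) (J A : 'M[F]_m) (lam : F).
Hypotheses (gT : g^T = g) (ggi : g *m gi = 1%:M).
Hypothesis metricity : forall k, dmx d k g = (Gam k)^T *m g + g *m Gam k.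
Hypothesis torsion : forall k l, Gam k *m ev_of F l = Gam l *m ev_of F k.
Hypothesis hh : h + h = 1.

Local Notation ev := (@ev_of F m).
Local Notation dual_ev := (dual_ev_of gi).
Local Notation adj := (adj_of g gi).
Local Notation ip := (ip_of g).
Local Notation sym := (sym_of g J).
Local Notation nab := (nab_of d Gam).
Local Notation nabE := (nabE_of d Gam).
Local Notation jac := (jac_of d Gam).
Local Notation grd := (grd_of d gi).
Local Notation curv := (curv_of d Gam).
Local Notation curv_op := (curv_op_of d gi Gam).
Local Notation Lam := (grd lam).
Local Notation L := (jac Lam).

Hypotheses (JJ : J *m J = - 1%:M) (Jskew : adj J = - J).
Hypothesis nabJ : forall k, nabE k J = 0.
Hypotheses (As : adj A = A) (AJ : A *m J = J *m A).
Hypothesis nabA : forall k, nabE k A = sym Lam (ev k).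
Implicit Types (x y : 'cV[F]_m) (X Y s : 'M[F]_m) (k l : 'I_m).

Let Ls : adj L = L.
Proof. exact: (adj_jac_grd gT ggi metricity torsion). Qed.

Lemma nabE_sym k x y : nabE k (sym x y) = sym (nab k x) y + sym x (nab k y).
Proof.
have nJ z : nab k (J *m z) = J *m nab k z by rewrite nabM nabJ mul0mx add0r.
rewrite !unlock_sym !nabED !(nabE_outer metricity) !nJ; mxring.
Qed.

(** The Ricci identity for [A]. In the second derivative of [A] only the factor [Lam] of [sym]
    contributes to the commutator, through its differential [L], since [J] is parallel and the
    derivatives of [ev] cancel by symmetry. *)
Lemma curv_A k l : curv k l *m A - A *m curv k l =
  sym (L *m ev k) (ev l) - sym (L *m ev l) (ev k).
Proof.
rewrite -nabE_comm !nabA !nabE_sym !jac_ev (nab_ev_sym _ torsion k l).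
mxring.
Qed.

Lemma mxtrace_J_self X : adj X = X -> \tr (J *m X) = 0.
Proof.
move=> Xs; apply: (double_eq0 hh).
by rewrite -{1}(mxtrace_adj ggi) (adjM ggi) Xs Jskew mulmxN raddfN /=
  mxtrace_mulC addNr.
Qed.

(** The contraction of the right hand side of [curv_A] with [s]: the failure of [curv_op] to commute
    with multiplication by [A]. *)
Definition ricci_defect s : 'M[F]_m :=
  \tr s *: L - L *m s - (\tr (s *m L))%:M - J *m L *m J *m s.

Lemma curv_op_mulA s : adj s = s -> s *m J = J *m s ->
  curv_op (A *m s) = A *m curv_op s + ricci_defect s.
Proof.
move=> ss sJ; apply/matrixP => i j; rewrite -!mulmx_ev; congr (fun_of_matrix _ i 0).
rewrite mulmxDl -[A *m _ *m _]mulmxA !curv_op_ev.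
transitivity (\sum_l (A *m (curv j l *m s *m dual_ev l) +
    sym (L *m ev j) (ev l) *m s *m dual_ev l
    - sym (L *m ev l) (ev j) *m (s *m dual_ev l))).
  apply: eq_bigr => l _.
  have -> : curv j l *m (A *m s) =
      (A *m curv j l + (sym (L *m ev j) (ev l) - sym (L *m ev l) (ev j))) *m s.
    by rewrite -curv_A mulmxA; congr (_ *m _); mxring.
  rewrite !(mulmxDl, mulNmx) -!mulmxA. mxring.
rewrite !big_split /= sumrN -mulmx_sumr -addrA; congr (_ + _).
rewrite (sum_sym_mulv gT ggi Jskew) ss (mxtrace_J_self ss) scale0r subr0.
rewrite [s *m (J *m _)]mulmxA sJ -mulmxA (JJv JJ) addrK.
under eq_bigr do rewrite sym_mulv.
rewrite !big_split /= -!scaler_suml.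
have -> : \sum_l ip (ev j) (s *m dual_ev l) *: (L *m ev l) = L *m (s *m ev j).
  by rewrite (sum_dual_ev gT ggi) ss.
have -> : \sum_l ip (L *m ev l) (s *m dual_ev l) = \tr (s *m L).
  by rewrite (sum_ip_ev gT ggi) ss.
have -> : \sum_l ip (J *m ev j) (s *m dual_ev l) *: (J *m (L *m ev l)) =
    J *m (L *m (J *m (s *m ev j))).
  under eq_bigr do rewrite mulmxA.
  by rewrite (sum_dual_ev gT ggi) ss [s *m (J *m _)]mulmxA sJ -!mulmxA.
have -> : \sum_l ip (J *m (L *m ev l)) (s *m dual_ev l) = 0.
  under eq_bigr do rewrite mulmxA.
  rewrite (sum_ip_ev gT ggi) ss; apply: (double_eq0 hh).
  rewrite -{1}(mxtrace_adj ggi) !(adjM ggi) Ls Jskew ss mulmxN mulNmx raddfN /=.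
  by rewrite -mulmxA -sJ mxtrace_mulC mulmxA addNr.
rewrite /ricci_defect !(mulmxDl, mulNmx) -!mulmxA -scalemxAl.
rewrite mul_scalar_mx; mxring.
Qed.

Lemma ricci_defectE s : adj (ricci_defect s) =
  \tr s *: L - adj s *m L - (\tr (s *m L))%:M - adj s *m J *m L *m J.
Proof.
rewrite /ricci_defect !(adjD, adjN, adjZ) !(adjM ggi) adj_scalar // Ls !Jskew.
by rewrite !(mulNmx, mulmxN, opprK) !mulmxA.
Qed.

(** [curv_op (A *m A)] is self-adjoint, so it can be expanded by moving the factors [A] out on the
    left or, after taking adjoints, on the right. Exchanging the order once more makes the Ricci
    endomorphism appear as [A *m curv_op 1%:M *m A] in both expansions. It cancels, and the defects
    add up to the dimension [m] times the commutator of [A] and [L]. *)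
Lemma A_hess_comm (mi : F) : mi * m%:R = 1 -> A *m L = L *m A.
Proof.
move=> mim.
have adj1 : adj 1%:M = 1%:M by rewrite adj_scalar.
have E1 := curv_op_mulA adj1 (etrans (mul1mx J) (esym (mulmx1 J))).
have E2 := curv_op_mulA As AJ.
rewrite mulmx1 in E1.
have AAs : adj (A *m A) = A *m A by rewrite (adjM ggi) As.
have sa X : adj X = X -> adj (curv_op X) = curv_op X.
  exact: (adj_curv_op gT ggi metricity torsion hh).
have E1' := congr1 adj E1; have E2' := congr1 adj E2.
rewrite sa // adjD (adjM ggi) As (sa _ adj1) in E1'.
rewrite sa // adjD (adjM ggi) As (sa _ As) in E2'.
have : curv_op (A *m A) - curv_op (A *m A) = 0 by rewrite subrr.
rewrite {1}E2 E2' {1}E1' E1 !ricci_defectE /ricci_defect As !mxtrace1.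
rewrite adj_scalar // !mul1mx !mulmx1.
rewrite !(mulmxDl, mulmxDr, mulNmx, mulmxN) -!scalemxAl -!scalemxAr !mulmxA.
rewrite mul_mx_scalar mul_scalar_mx -[_ *m J *m A]mulmxA -AJ !mulmxA.
move=> E.
have : m%:R *: (A *m L - L *m A) = 0 by rewrite -[RHS]E; mxring.
move=> /(congr1 ( *:%R mi)); rewrite scalerA mim scale1r scaler0 => /eqP.
by rewrite subr_eq0 => /eqP.
Qed.

Section Resolvent.
Variables (v : F) (a : 'M[F]_m).
Hypotheses (vconst : forall k, d k v = 0) (av : a *m (v%:M - A) = 1%:M).

Lemma resolvent_comm Y : A *m Y = Y *m A -> a *m Y = Y *m a.
Proof.
move=> AY; apply: (inverse_comm av).
by rewrite mulmxBl mulmxBr AY mul_scalar_mx mul_mx_scalar.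
Qed.

Lemma adj_resolvent : adj a = a.
Proof.
have /(congr1 (mulmx a)) := congr1 adj av.
rewrite (adjM ggi) (adjB g gi) As !adj_scalar // mulmxA av mul1mx.
by rewrite mulmx1.
Qed.

Lemma nabE_resolvent k : nabE k a = a *m sym Lam (ev k) *m a.
Proof.
have /(congr1 (mulmx^~ a)) := congr1 (nabE k) av.
rewrite nabEM (nabEB d Gam) !nabE_scalar vconst der1 nabA !raddf0 sub0r mul0mx.
rewrite mulmxDl -mulmxA (mulmx1C av) mulmx1 mulmxN mulNmx => /eqP.
by rewrite subr_eq0 => /eqP.
Qed.

(** Since [A *m a = v *: a - 1%:M], the rule [curv_op_mulA] for [s = a] is a linear equation for
    [curv_op a] with coefficient [v%:M - A]. *)
Lemma curv_op_resolvent : curv_op a = a *m (curv_op 1%:M + ricci_defect a).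
Proof.
have cB X Y : curv_op (X - Y) = curv_op X - curv_op Y.
  rewrite !unlock_curv_op -sumrB; apply: eq_bigr => k _.
  rewrite -mulmxBl -sumrB; congr (_ *m _); apply: eq_bigr => l _.
  by rewrite mulmxBr mulmxBl.
have cZ (c : F) X : curv_op (c *: X) = c *: curv_op X.
  rewrite !unlock_curv_op scaler_sumr; apply: eq_bigr => k _.
  rewrite scalemxAl scaler_sumr; congr (_ *m _); apply: eq_bigr => l _.
  by rewrite -scalemxAr -scalemxAl.
have Aa : A *m a = v *: a - 1%:M.
  by rewrite -(mulmx1C av) mulmxBl mul_scalar_mx; mxring.
have := curv_op_mulA adj_resolvent (resolvent_comm AJ).
rewrite Aa cB cZ => E.
have -> : curv_op 1%:M + ricci_defect a = (v%:M - A) *m curv_op a.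
  have -> : curv_op 1%:M = v *: curv_op a - (v *: curv_op a - curv_op 1%:M).
    mxring.
  by rewrite E mulmxBl mul_scalar_mx; mxring.
by rewrite mulmxA av mul1mx.
Qed.

End Resolvent.

(** The Ricci endomorphism is multiplied by [a *m b] in both terms and drops out. Thus the curvature
    contributes only Hessian terms of [lambda]. *)
Lemma curv_op_resolvent_comm (v w : F) (a b : 'M[F]_m) :
  a *m (v%:M - A) = 1%:M -> b *m (w%:M - A) = 1%:M ->
  a *m curv_op b - b *m curv_op a =
  a *m b *m (ricci_defect b - ricci_defect a).
Proof.
move=> av bw; rewrite (curv_op_resolvent av) (curv_op_resolvent bw) !mulmxA.
have -> : b *m a = a *m b.
  by rewrite (resolvent_comm av) // (resolvent_comm bw).
move: (ricci_defect a) (ricci_defect b) => Ma Mb.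
by rewrite !mulmxDr mulmxN; mxring.
Qed.

End Compatible.

(** * Commutation for two resolvents *)

Section Commutation.
Variables (F : comNzRingType) (m : nat) (d : frame F m) (g gi : 'M[F]_m).
Variables (Gam : 'I_m -> 'M[F]_m) (h : F) (J A : 'M[F]_m) (lam : F).
Hypotheses (gT : g^T = g) (ggi : g *m gi = 1%:M).
Hypothesis metricity : forall k, dmx d k g = (Gam k)^T *m g + g *m Gam k.
Hypothesis torsion : forall k l, Gam k *m ev_of F l = Gam l *m ev_of F k.
Hypothesis hh : h + h = 1.

Local Notation ev := (@ev_of F m).
Local Notation dual_ev := (dual_ev_of gi).
Local Notation adj := (adj_of g gi).
Local Notation ip := (ip_of g).
Local Notation outer := (outer_of g).
Local Notation sym := (sym_of g J).
Local Notation nab := (nab_of d Gam).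
Local Notation nabE := (nabE_of d Gam).
Local Notation jac := (jac_of d Gam).
Local Notation grd := (grd_of d gi).
Local Notation curv := (curv_of d Gam).
Local Notation curv_op := (curv_op_of d gi Gam).
Local Notation Lam := (grd lam).
Local Notation L := (jac Lam).

Hypotheses (JJ : J *m J = - 1%:M) (Jskew : adj J = - J).
Hypothesis nabJ : forall k, nabE k J = 0.
Hypotheses (As : adj A = A) (AJ : A *m J = J *m A).
Hypothesis nabA : forall k, nabE k A = sym Lam (ev k).
Implicit Types (x y : 'cV[F]_m) (X Y s : 'M[F]_m) (k l : 'I_m).

Let Ls : adj L = L.
Proof. exact: (adj_jac_grd gT ggi metricity torsion). Qed.

Local Notation dvg := (dvg_of d gi Gam).
Local Notation dv := (dv_of d Gam).

Let adjM' := adjM ggi.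

Lemma sum_ip_dual_ev x : \sum_k ip x (ev k) *: dual_ev k = x.
Proof.
have E := sum_ev gT ggi x 1%:M 1%:M.
rewrite adj_scalar // !mul1mx in E.
by rewrite -[RHS]E; apply: eq_bigr => k _; rewrite !mul1mx.
Qed.

(** The Ricci identity for [grd f] exchanges the differentiation index [k] with an index of the
    Hessian. Its curvature term, summed against [X], is [curv_op X], moved across the inner product
    by self-adjointness. *)
Lemma sum_tr_hess f X (H := jac (grd f)) : adj X = X ->
  \sum_k \tr (X *m nabE k H) *: dual_ev k =
  \sum_k nabE k H *m X *m dual_ev k - curv_op X *m grd f.
Proof.
move=> Xs.
have Hs : adj H = H by exact: (adj_jac_grd gT ggi metricity torsion).
rewrite -[RHS]sum_ip_dual_ev; apply: eq_bigr => k _; congr (_ *: _).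
have -> : \tr (X *m nabE k H) =
    \sum_l ip (nabE k H *m ev l) (X *m dual_ev l).
  by rewrite (sum_ip_ev gT ggi) Xs.
have Hsym l : nabE k H *m ev l = nabE l H *m ev k + curv k l *m grd f.
  have E i j : nabE i H *m ev j = nab i (nab j (grd f)) - H *m nab i (ev j).
    by rewrite -(jac_ev _ _ _ j) nabM addrK.
  by rewrite -nab_comm !E (nab_ev_sym d torsion k l); mxring.
under eq_bigr do rewrite Hsym ipDl.
rewrite big_split ipBl -(adj_curv_op gT ggi metricity torsion hh Xs).
rewrite -(ip_adjr gT ggi) curv_op_ev !(ipC gT (grd f)) !(ip_suml gT) -sumrN.
congr (_ + _); apply: eq_bigr => l _.
  rewrite (ip_adjl gT ggi) -(nabE_adj ggi metricity) Hs mulmxA.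
  by rewrite (ipC gT).
rewrite (ip_adjl gT ggi) (curv_skew ggi metricity) mulNmx ipNr // mulmxA.
by rewrite (ipC gT).
Qed.

Section OneResolvent.
Variables (v q : F) (a : 'M[F]_m).
Hypotheses (vconst : forall k, d k v = 0) (av : a *m (v%:M - A) = 1%:M).
(** The equation satisfied by a square root of [\det (v%:M - A)], proved in [der_sqrt_det]; it is
    insensitive to the sign of the root. *)
Hypothesis dq : forall k, d k q = - (ip (a *m Lam) (ev k) * q) *+ 2.

Local Notation K := (q *: a).
Local Notation K1 := (\tr a *: a - (a *m a) *+ 2).

Let as_ : adj a = a. Proof. exact: (adj_resolvent ggi As av). Qed.
Let aJ : a *m J = J *m a. Proof. exact: (resolvent_comm av). Qed.

(** The gradient of [\tr (a *m Y)] when [Y] is treated as parallel. *)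
Definition grad_tr Y : 'cV[F]_m :=
  a *m (Y *m (a *m Lam)) + a *m (adj Y *m (a *m Lam))
  - a *m (J *m (Y *m (J *m (a *m Lam))))
  - a *m (J *m (adj Y *m (J *m (a *m Lam)))).

Lemma sum_tr_nabE_resolvent Y :
  \sum_k \tr (nabE k a *m Y) *: dual_ev k = grad_tr Y.
Proof.
transitivity (\sum_k \tr (sym Lam (ev k) *m (a *m Y *m a)) *: dual_ev k).
  apply: eq_bigr => k _; rewrite (nabE_resolvent nabA vconst av).
  by rewrite -!mulmxA mxtrace_mulC !mulmxA.
rewrite (sum_tr_sym gT ggi Jskew) !adjM' as_ /grad_tr -!mulmxA.
rewrite [a *m (J *m Lam)]mulmxA [J *m (a *m _)]mulmxA [J *m (a *m _)]mulmxA.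
by rewrite -!aJ -!mulmxA [a *m (J *m Lam)]mulmxA aJ -!mulmxA.
Qed.

Lemma sum_nabE_resolvent Y :
  \sum_k nabE k a *m Y *m dual_ev k =
  a *m (\tr (a *m Y) *: Lam + adj Y *m (a *m Lam) - \tr (J *m (a *m Y)) *: (J *m Lam)
        + J *m (adj Y *m (J *m (a *m Lam)))).
Proof.
transitivity (a *m \sum_k sym Lam (ev k) *m (a *m Y) *m dual_ev k).
  rewrite mulmx_sumr; apply: eq_bigr => k _.
  by rewrite (nabE_resolvent nabA vconst av) !mulmxA.
rewrite (sum_sym_mulv gT ggi Jskew) adjM' as_ -!mulmxA.
by rewrite [a *m (J *m Lam)]mulmxA aJ -!mulmxA.
Qed.

Lemma nabE_K k : nabE k K = q *: (nabE k a - ip (a *m Lam) (ev k) *: a *+ 2).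
Proof. by rewrite nabEZ dq; mxring. Qed.

Lemma sum_tr_nabE_K Y : \sum_k \tr (nabE k K *m Y) *: dual_ev k =
  q *: (grad_tr Y - \tr (a *m Y) *: (a *m Lam) *+ 2).
Proof.
rewrite -sum_tr_nabE_resolvent -[X in _ *: X *+ 2]sum_ip_dual_ev.
rewrite scaler_sumr -sumrMnl -sumrB scaler_sumr; apply: eq_bigr => k _.
rewrite nabE_K -scalemxAl mxtraceZ mulmxBl raddfB /= mx_mulnl raddfMn /=.
by rewrite -scalemxAl mxtraceZ; mxring.
Qed.

Lemma sum_nabE_K Y : \sum_k nabE k K *m Y *m dual_ev k =
  q *: (\sum_k nabE k a *m Y *m dual_ev k - a *m (Y *m (a *m Lam)) *+ 2).
Proof.
rewrite -[X in _ *m (_ *m X) *+ 2]sum_ip_dual_ev.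
rewrite !mulmx_sumr -sumrMnl -sumrB scaler_sumr; apply: eq_bigr => k _.
rewrite nabE_K -!scalemxAl !mulmxBl !mx_mulnl -!scalemxAl -!scalemxAr -!mulmxA.
by mxring.
Qed.

(** The contraction of [nabE k a] alone gives [\tr a *: (a *m Lam)]: its other terms cancel by
    [J *m J = - 1%:M] or contain the vanishing trace of [J *m a]. The summand with [a *m a] comes
    from the derivative of [q]. *)
Lemma dvg_K : dvg K = q *: (K1 *m Lam).
Proof.
rewrite unlock_dvg.
under eq_bigr do rewrite -[nabE _ K]mulmx1.
rewrite sum_nabE_K sum_nabE_resolvent adj_scalar // !mul1mx mulmx1.
rewrite (mxtrace_J_self ggi hh Jskew as_) (JJv JJ) scale0r.
rewrite !(mulmxDr, mulmxDl, mulmxN, mulNmx, mx_mulnl, linear0).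
rewrite -!scalemxAr -!scalemxAl -!mulmxA; mxring.
Qed.

Lemma sum_tr_nabE_K1 Y : \sum_k \tr (nabE k (q *: K1) *m Y) *: dual_ev k =
  q *: (\tr (a *m Y) *: (a *m (a *m Lam)) *+ 4 + \tr a *: grad_tr Y
    - grad_tr (a *m Y) *+ 2 - grad_tr (Y *m a) *+ 2
    - \tr (K1 *m Y) *: (a *m Lam) *+ 2).
Proof.
(* The factor 4 counts the terms of [sym], each of which contributes [a *m (a *m Lam)]. *)
have Etr : \sum_k d k (\tr a) *: dual_ev k = a *m (a *m Lam) *+ 4.
  under eq_bigr do rewrite (der_mxtrace_nabE d Gam) -[nabE _ _]mulmx1.
  rewrite sum_tr_nabE_resolvent /grad_tr adj_scalar // !mul1mx !(JJv JJ).
  by rewrite !mulmxN; mxring.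
rewrite -!sum_tr_nabE_resolvent.
rewrite -[X in _ - _ *: X *+ 2]sum_ip_dual_ev.
transitivity (\sum_k q *: (\tr (a *m Y) *: (d k (\tr a) *: dual_ev k) +
   \tr a *: (\tr (nabE k a *m Y) *: dual_ev k) -
   \tr (nabE k a *m (a *m Y)) *: dual_ev k *+ 2 -
   \tr (nabE k a *m (Y *m a)) *: dual_ev k *+ 2 -
   \tr (K1 *m Y) *: (ip (a *m Lam) (ev k) *: dual_ev k) *+ 2)).
  apply: eq_bigr => k _.
  rewrite nabEZ dq nabEB nabEZ mulr2n nabED nabEM.
  have -> : \tr (nabE k a *m (Y *m a)) = \tr (a *m (nabE k a *m Y)).
    by rewrite mulmxA mxtrace_mulC.
  rewrite !(mulmxDl, mulmxBl, mulNmx) -!scalemxAl !mulmxDl.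
  rewrite !(mxtraceD, mxtraceN) !mxtraceZ -!mulmxA.
  rewrite !(mulmxDl, mulNmx) -!scalemxAl !(mxtraceD, mxtraceN) !mxtraceZ -!mulmxA.
  mxring.
rewrite -scaler_sumr !sumrB big_split /= !sumrMnl -!scaler_sumr Etr; mxring.
Qed.

(** Here [dv (K *m u)] is [\tr (K *m H)] plus the inner product of [dvg K] with [u]. The three
    groups collect the derivative of [K] in the trace, the derivative of [H] with its curvature
    correction, and the derivative of the inner product. *)
Lemma grd_dv_K f (u := grd f) (H := jac u) : grd (dv (K *m u)) =
  q *: (grad_tr H - \tr (a *m H) *: (a *m Lam) *+ 2)
  + (\sum_k nabE k H *m K *m dual_ev k - q *: (curv_op a *m u))
  + (q *: (\tr (a *m outer Lam u) *: (a *m (a *m Lam)) *+ 4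
      + \tr a *: grad_tr (outer Lam u)
      - grad_tr (a *m outer Lam u) *+ 2 - grad_tr (outer Lam u *m a) *+ 2
      - \tr (K1 *m outer Lam u) *: (a *m Lam) *+ 2)
     + q *: (L *m (K1 *m u)) + q *: (H *m (K1 *m Lam))).
Proof.
have Ks : adj K = K by rewrite adjZ as_.
have K1s : adj K1 = K1 by rewrite mulr2n adjB adjZ adjD adjM' as_.
have Hs : adj H = H by exact: (adj_jac_grd gT ggi metricity torsion).
rewrite (dv_mulmx gT ggi metricity _ Ks) dvg_K -/H.
have -> : q *: (curv_op a *m u) = curv_op K *m u.
  rewrite scalemxAl; congr (_ *m _).
  rewrite !unlock_curv_op scaler_sumr; apply: eq_bigr => k _.
  rewrite scalemxAl scaler_sumr; congr (_ *m _); apply: eq_bigr => l _.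
  by rewrite -scalemxAr -scalemxAl.
rewrite -sum_tr_nabE_K -(sum_tr_hess _ Ks) -sum_tr_nabE_K1.
rewrite -[q *: (L *m _)]sum_ip_dual_ev -[q *: (H *m _)]sum_ip_dual_ev.
rewrite -!big_split unlock_grd; apply: eq_bigr => k _ /=.
rewrite -!scalerDl; congr (_ *: _).
rewrite derD (der_mxtrace_nabE d Gam) nabEM mxtraceD; congr (_ + _).
rewrite scalemxAl (der_ip metricity) nabM mxtrace_mulC.
rewrite ipDl; congr (_ + _ + _).
- by rewrite mxtrace_mulC mulmx_outer mxtrace_outer (ipC gT).
- rewrite -(jac_ev _ _ _ k) (ip_adjl gT ggi) adjZ K1s (ip_adjl gT ggi).
  by rewrite (adj_jac_grd gT ggi metricity torsion) (ipC gT) -scalemxAl -scalemxAr.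
- by rewrite -(jac_ev _ _ _ k) (ip_adjr gT ggi) Hs -scalemxAl -scalemxAr.
Qed.

End OneResolvent.

End Commutation.

(** * The commutator as the double divergence of a skew tensor *)

Section TwoResolvents.
Variables (F : comNzRingType) (m : nat) (d : frame F m) (g gi : 'M[F]_m).
Variables (Gam : 'I_m -> 'M[F]_m) (h : F) (J A : 'M[F]_m) (lam : F).
Hypotheses (gT : g^T = g) (ggi : g *m gi = 1%:M).
Hypothesis metricity : forall k, dmx d k g = (Gam k)^T *m g + g *m Gam k.
Hypothesis torsion : forall k l, Gam k *m ev_of F l = Gam l *m ev_of F k.
Hypothesis hh : h + h = 1.

Local Notation ev := (@ev_of F m).
Local Notation dual_ev := (dual_ev_of gi).
Local Notation adj := (adj_of g gi).
Local Notation ip := (ip_of g).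
Local Notation outer := (outer_of g).
Local Notation sym := (sym_of g J).
Local Notation nab := (nab_of d Gam).
Local Notation nabE := (nabE_of d Gam).
Local Notation jac := (jac_of d Gam).
Local Notation grd := (grd_of d gi).
Local Notation curv_op := (curv_op_of d gi Gam).
Local Notation Lam := (grd lam).
Local Notation L := (jac Lam).

Hypotheses (JJ : J *m J = - 1%:M) (Jskew : adj J = - J).
Hypothesis nabJ : forall k, nabE k J = 0.
Hypotheses (As : adj A = A) (AJ : A *m J = J *m A).
Hypothesis nabA : forall k, nabE k A = sym Lam (ev k).
Implicit Types (x y : 'cV[F]_m) (X Y s : 'M[F]_m) (k l : 'I_m).

Let Ls : adj L = L.
Proof. exact: (adj_jac_grd gT ggi metricity torsion). Qed.

Local Notation dvg := (dvg_of d gi Gam).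
Local Notation dv := (dv_of d Gam).

Let adjM' := adjM ggi.

Lemma sum_outer_l X Y y :
  \sum_k outer (X *m ev k) y *m (Y *m dual_ev k) = X *m (adj Y *m y).
Proof.
under eq_bigr do rewrite outer_mulv.
exact: (sum_dual_ev gT ggi).
Qed.

Lemma sum_outer_r X Y y :
  \sum_k outer y (X *m ev k) *m (Y *m dual_ev k) = \tr (adj Y *m X) *: y.
Proof.
under eq_bigr do rewrite outer_mulv.
by rewrite -scaler_suml (sum_ip_ev gT ggi).
Qed.

Variables (v w qa qb : F) (a b : 'M[F]_m) (f mi : F).
Hypotheses (vconst : forall k, d k v = 0) (wconst : forall k, d k w = 0).
Hypotheses (av : a *m (v%:M - A) = 1%:M) (bw : b *m (w%:M - A) = 1%:M).
Hypothesis dqa : forall k, d k qa = - (ip (a *m Lam) (ev k) * qa) *+ 2.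
Hypothesis dqb : forall k, d k qb = - (ip (b *m Lam) (ev k) * qb) *+ 2.
Hypothesis mim : mi * m%:R = 1.

Local Notation u := (grd f).
Local Notation H := (jac u).
Local Notation c := (a *m b).
Local Notation dl := (w - v).

Let as_ : adj a = a. Proof. exact: (adj_resolvent ggi As av). Qed.
Let bs_ : adj b = b. Proof. exact: (adj_resolvent ggi As bw). Qed.
Let Hs : adj H = H. Proof. exact: (adj_jac_grd gT ggi metricity torsion). Qed.
Let aJ : a *m J = J *m a. Proof. exact: (resolvent_comm av). Qed.
Let bJ : b *m J = J *m b. Proof. exact: (resolvent_comm bw). Qed.
Let ab : a *m b = b *m a.
Proof. exact: (resolvent_comm av (esym (resolvent_comm bw erefl))). Qed.
Let AL : A *m L = L *m A.
Proof.
exact: (A_hess_comm gT ggi metricity torsion hh JJ Jskew nabJ As AJ nabA mim).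
Qed.
Let aL : a *m L = L *m a. Proof. exact: (resolvent_comm av). Qed.
Let bL : b *m L = L *m b. Proof. exact: (resolvent_comm bw). Qed.

(** The resolvent identity: insert [(w%:M - A) - (v%:M - A)], which is the scalar [dl], between [a]
    and [b]. *)
Lemma resolvent_diff : a - b = dl *: c.
Proof.
transitivity (a *m ((w%:M - A) - (v%:M - A)) *m b).
  by rewrite mulmxBr mulmxBl av mul1mx -mulmxA (mulmx1C bw) mulmx1.
have -> : (w%:M - A) - (v%:M - A) = dl%:M.
  by apply/matrixP => i j; rewrite !mxE mulrnBl; ring.
by rewrite mul_mx_scalar -scalemxAl.
Qed.

Let baE x : b *m (a *m x) = a *m (b *m x).
Proof. by rewrite mulmxA -ab mulmxA. Qed.
Let JaE x : J *m (a *m x) = a *m (J *m x).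
Proof. by rewrite mulmxA -aJ mulmxA. Qed.
Let JbE x : J *m (b *m x) = b *m (J *m x).
Proof. by rewrite mulmxA -bJ mulmxA. Qed.
Let LaE x : L *m (a *m x) = a *m (L *m x).
Proof. by rewrite mulmxA -aL mulmxA. Qed.
Let LbE x : L *m (b *m x) = b *m (L *m x).
Proof. by rewrite mulmxA -bL mulmxA. Qed.
Let JJE x : J *m (J *m x) = - x. Proof. exact: JJv. Qed.
(** A normal order for words: [a] to the left of [b], both to the left of [J] and [L]. In this order
    the words of both sides can be compared. *)
Let normE := (baE, JaE, JbE, LaE, LbE, JJE).

Let dlE x : dl *: (a *m (b *m x)) = a *m x - b *m x.
Proof. by rewrite -mulmxBl resolvent_diff -scalemxAl mulmxA. Qed.

Let dltr Y : dl * \tr (a *m (b *m Y)) = \tr (a *m Y) - \tr (b *m Y).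
Proof.
by rewrite -mxtraceZ mulmxA scalemxAl -resolvent_diff mulmxDl mulNmx mxtraceD mxtraceN.
Qed.

Definition sum_tr_part s : 'cV[F]_m :=
  grad_tr d g gi J lam s H - \tr (s *m H) *: (s *m Lam) *+ 2.

Definition sum_nab_part s t : 'cV[F]_m :=
  \sum_k nabE k s *m (H *m t) *m dual_ev k - s *m (H *m t *m (s *m Lam)) *+ 2.

(** The terms containing the Hessian [H] undifferentiated and one factor [Lam]. The divergence of
    the Hessian bracket accounts for them up to the multiple of [dl], which is the Hessian part of
    [dvg_twist]. *)
Lemma second_order_terms :
  a *m sum_tr_part b - b *m sum_tr_part a =
  sum_nab_part a b - sum_nab_part b a
  + dl *: (c *m (\tr (c *m H) *: Lam - H *m (c *m Lam)
                 + J *m (H *m (J *m (c *m Lam))))).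
Proof.
have trJ s t : adj s = s -> adj t = t -> s *m J = J *m s ->
    t *m J = J *m t -> s *m t = t *m s -> \tr (J *m (s *m (H *m t))) = 0.
  move=> ss ts sJ tJ st.
  have E : t *m (J *m s) = s *m J *m t by rewrite mulmxA tJ -mulmxA -st mulmxA sJ.
  have -> : \tr (J *m (s *m (H *m t))) = \tr (t *m (J *m s) *m H).
    by rewrite mulmxA [LHS]mxtrace_mulC [RHS]mxtrace_mulC !mulmxA.
  apply: (double_eq0 hh); rewrite -{1}(mxtrace_adj ggi) !adjM' ss ts Hs Jskew.
  by rewrite mulmxN mulNmx mulmxN mxtraceN mxtrace_mulC -E addNr.
have trs s t : \tr (s *m (H *m t)) = \tr (t *m s *m H).
  by rewrite mulmxA [LHS]mxtrace_mulC mulmxA.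
rewrite /sum_nab_part !(sum_nabE_resolvent gT ggi Jskew As AJ nabA vconst av).
rewrite !(sum_nabE_resolvent gT ggi Jskew As AJ nabA wconst bw).
rewrite !trJ // !trs -ab !adjM' Hs as_ bs_ !scale0r !subr0.
rewrite /sum_tr_part /grad_tr Hs.
rewrite !(mulmxDr, mulmxN, mx_mulnr) -?scalemxAr -!mulmxA !normE.
rewrite !(scalerDr, scalerN) !scalerA dltr.
have R4 X : dl *: (a *m (b *m (X *m (a *m (b *m Lam))))) =
    a *m (b *m (X *m (a *m Lam))) - a *m (b *m (X *m (b *m Lam))).
  by rewrite -!mulmxBr -dlE -!scalemxAr.
have R5 : dl *: (a *m (b *m (J *m (H *m (a *m (b *m (J *m Lam))))))) =
    a *m (b *m (J *m (H *m (a *m (J *m Lam)))))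
    - a *m (b *m (J *m (H *m (b *m (J *m Lam))))).
  by rewrite -!mulmxBr -dlE -!scalemxAr.
(* In a product with two factors [a b], the scalar [dl] can be absorbed into either one. Equating
   the two results gives [R1], where one factor sits in a trace, and [R2], where they are separated
   by [H]. *)
have R1 : \tr (a *m (b *m H)) *: (a *m Lam) = \tr (a *m (b *m H)) *: (b *m Lam)
    + (\tr (a *m H) - \tr (b *m H)) *: (a *m (b *m Lam)).
  by rewrite -dltr mulrC -scalerA dlE; mxring.
have R2 : a *m (H *m (a *m (b *m Lam))) = b *m (H *m (a *m (b *m Lam)))
    + (a *m (b *m (H *m (a *m Lam))) - a *m (b *m (H *m (b *m Lam)))).
  by rewrite -R4 dlE; mxring.
rewrite R5 R4 R2 R1; mxring.
Qed.

Definition hess_part s : 'cV[F]_m := L *m ((\tr s *: s - (s *m s) *+ 2) *m u).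

(** The terms containing the Hessian [L] of [lambda]. The part of the defect quadratic in each
    resolvent cancels [hess_part] because [L] commutes with [a] and [b]; the rest is the [L] part of
    [dvg_twist]. *)
Lemma curvature_terms :
  a *m hess_part b - b *m hess_part a
    - (a *m (curv_op b *m u) - b *m (curv_op a *m u)) =
  dl *: (c *m (L *m (c *m u) - \tr (c *m L) *: u - J *m (L *m (J *m (c *m u))))).
Proof.
have -> : a *m (curv_op b *m u) - b *m (curv_op a *m u) =
    (a *m curv_op b - b *m curv_op a) *m u.
  by rewrite mulmxBl !mulmxA.
rewrite (curv_op_resolvent_comm gT ggi metricity torsion hh JJ Jskew nabJ As AJ
  nabA av bw).
rewrite /ricci_defect /hess_part -!mulmxA.
rewrite !(mulmxDl, mulNmx, mulmxDr, mulmxN, mx_mulnl, mx_mulnr).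
rewrite -?scalemxAl !mul_scalar_mx -?scalemxAr -!mulmxA !normE.
rewrite !(scalerDr, scalerN) !scalerA dltr.
have R x : dl *: (a *m (a *m (b *m (b *m x)))) =
    a *m (a *m (b *m x)) - a *m (b *m (b *m x)).
  by rewrite -(baE (b *m x)) dlE baE.
rewrite !R; mxring.
Qed.

(** Twice the component of the bivector of [Lam] and [u] that anticommutes with [J]. *)
Definition twist : 'M[F]_m :=
  locked_with geometry_key
    (outer Lam u - outer u Lam + J *m (outer Lam u - outer u Lam) *m J).

Lemma unlock_twist :
  twist = outer Lam u - outer u Lam + J *m (outer Lam u - outer u Lam) *m J.
Proof. exact: locked_withE. Qed.

Lemma twist_mulv x : twist *m x =
  ip u x *: Lam - ip Lam x *: u + ip u (J *m x) *: (J *m Lam)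
  - ip Lam (J *m x) *: (J *m u).
Proof.
rewrite unlock_twist !(mulmxDl, mulNmx) -!mulmxA !(mulmxDl, mulNmx) !outer_mulv.
by rewrite mulmxDr mulmxN -!scalemxAr; mxring.
Qed.

Lemma adj_twist : adj twist = - twist.
Proof.
rewrite unlock_twist !(adjD, adjN, adjM', adj_outer) // Jskew.
rewrite !(mulmxDl, mulNmx, mulmxDr, mulmxN) !mulmxA; mxring.
Qed.

Lemma twistJ : twist *m J = - (J *m twist).
Proof.
rewrite unlock_twist; move: (_ - _) => X.
rewrite mulmxDl mulmxDr -!mulmxA JJ [J *m (J *m _)]mulmxA JJ.
by rewrite !(mulmxN, mulmx1, mulNmx, mul1mx); mxring.
Qed.

Definition gradient_part s : 'cV[F]_m :=
  let O := outer Lam u in let gt := grad_tr d g gi J lam s in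
  \tr (s *m O) *: (s *m (s *m Lam)) *+ 4 + \tr s *: gt O
  - gt (s *m O) *+ 2 - gt (O *m s) *+ 2
  - \tr ((\tr s *: s - (s *m s) *+ 2) *m O) *: (s *m Lam) *+ 2.

(** The terms quadratic in [Lam]. The products of [J] with powers of [a] or [b] are skew, so their
    pairings of [Lam] with itself vanish; the other words agree after normal ordering. *)
Lemma gradient_terms :
  a *m gradient_part b - b *m gradient_part a =
  c *m (twist *m (\tr a *: (a *m Lam) - \tr b *: (b *m Lam)
                  - (a *m (a *m Lam) - b *m (b *m Lam)) *+ 2))
  - (a *m (c *m (twist *m (a *m Lam))) - b *m (c *m (twist *m (b *m Lam)))) *+ 2.
Proof.
rewrite /gradient_part /grad_tr !adjM' !(adj_outer gT ggi) as_ bs_.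
rewrite !mulmxDl !mulNmx.
rewrite !mx_mulnl -!scalemxAl -!mulmxA ?mulmx_outer.
rewrite !(mxtraceD, mxtraceN) !mxtraceZ ?(mx_mulnl, mxtraceMn).
rewrite !mxtrace_outer !outer_mulv !twist_mulv.
have ipMn x y n : ip x (y *+ n) = ip x y *+ n.
  by elim: n => [|n IH]; rewrite ?mulr0n ?ip0r // !mulrS (ipDr gT) IH.
have ip0 s : adj s = s -> s *m J = J *m s -> ip Lam (s *m (J *m Lam)) = 0.
  move=> ss sJ; apply: (double_eq0 hh).
  rewrite {1}(ip_adjr gT ggi) ss (ipC gT) (ip_adjl gT ggi) Jskew mulNmx.
  by rewrite (ipNr gT) [J *m (s *m _)]mulmxA -sJ -mulmxA addNr.
have ip1a := ip0 a as_ aJ; have ip1b := ip0 b bs_ bJ.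
have ip2 s : adj s = s -> s *m J = J *m s -> ip Lam (s *m (s *m (J *m Lam))) = 0.
  move=> ss sJ; rewrite [s *m (s *m _)]mulmxA ip0 ?adjM' ?ss //.
  by rewrite -mulmxA sJ mulmxA sJ mulmxA.
have ip2a := ip2 a as_ aJ; have ip2b := ip2 b bs_ bJ.
rewrite !(mx_mulnr, mulmxDr, mulmxN, =^~ scalemxAr) !normE.
rewrite !(ipDr gT, ipNr gT, ipZr gT, ipMn) ip1a ip1b ip2a ip2b.
mxring.
Qed.
(** Leibniz rule with the derivative on the left resolvent, on [H] and on the right resolvent. The
    last two groups are the matching terms of [grd_dv_K], so that no third derivatives of the
    function survive in the comparison. *)
Lemma dvg_hess_bracket :
  dvg ((qa *: a) *m (H *m (qb *: b)) - (qb *: b) *m (H *m (qa *: a))) =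
  (qa * qb) *: (sum_nab_part a b - sum_nab_part b a)
  + ((qa *: a) *m (\sum_k nabE k H *m (qb *: b) *m dual_ev k)
     - (qb *: b) *m (\sum_k nabE k H *m (qa *: a) *m dual_ev k))
  + ((qa * qb) *: (a *m (H *m ((\tr b *: b - (b *m b) *+ 2) *m Lam)))
     - (qa * qb) *: (b *m (H *m ((\tr a *: a - (a *m a) *+ 2) *m Lam)))).
Proof.
rewrite dvgB !dvgM !(sum_nabE_K Gam gT ggi dqa) !(sum_nabE_K Gam gT ggi dqb).
rewrite (dvg_K gT ggi hh JJ Jskew As AJ nabA vconst av dqa).
rewrite (dvg_K gT ggi hh JJ Jskew As AJ nabA wconst bw dqb).
have E q s t : \sum_k nabE k s *m (H *m (q *: t)) *m dual_ev k
    - s *m (H *m (q *: t) *m (s *m Lam)) *+ 2 = q *: sum_nab_part s t.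
  rewrite /sum_nab_part -!scalemxAr -!scalemxAl -!scalemxAr scalerBr -scalerMnr.
  congr (_ - _); rewrite scaler_sumr; apply: eq_bigr => k _.
  by rewrite -scalemxAr -scalemxAl.
rewrite !E !scalerA (mulrC qb qa) !mulmxDr -!scalemxAl -!scalemxAr !scalerA.
rewrite (mulrC qb qa); mxring.
Qed.

(** The first trace vanishes because [twist] is skew, the second because [twist] anticommutes with
    [J]. These traces are the coefficients of [Lam] and [J *m Lam] when [sum_nabE_resolvent] is
    applied to [twist]. *)
Lemma mxtrace_twist s t : adj s = s -> adj t = t -> s *m J = J *m s ->
    t *m J = J *m t -> s *m t = t *m s ->
  \tr (s *m (twist *m t)) = 0 /\ \tr (J *m (s *m (twist *m t))) = 0.
Proof.
move=> ss ts sJ tJ st; split.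
  apply: (double_eq0 hh); rewrite -{1}(mxtrace_adj ggi) !adjM' ts ss adj_twist.
  rewrite mulmxN mulNmx mxtraceN [\tr (t *m _ *m s)]mxtrace_mulC.
  rewrite [s *m (t *m _)]mulmxA [s *m (twist *m t)]mulmxA.
  by rewrite [\tr (_ *m t)]mxtrace_mulC [t *m (s *m _)]mulmxA st addNr.
have -> : \tr (J *m (s *m (twist *m t))) = \tr (twist *m (t *m s *m J)).
  by rewrite -[t *m s *m J]mulmxA sJ [RHS]mxtrace_mulC !mulmxA
    [LHS]mxtrace_mulC !mulmxA.
apply: (double_eq0 hh).
rewrite -[X in X + _]opprK; apply/eqP; rewrite addrC subr_eq0; apply/eqP.
have {1}-> : t *m s *m J = J *m (t *m s) by rewrite -mulmxA sJ !mulmxA tJ.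
rewrite mulmxA twistJ mulNmx mxtraceN; congr (- _).
by rewrite -[J *m twist *m _]mulmxA [LHS]mxtrace_mulC !mulmxA.
Qed.

(** The three groups come from the derivative of [twist] falling on [Lam] or on [u], and from the
    derivatives of all remaining factors. They are, in order, the right hand sides left over in
    [second_order_terms], [curvature_terms] and [gradient_terms]. *)
Lemma dvg_twist (T : 'M[F]_m := (qa * qb * dl) *: (c *m twist *m c)) :
  dvg T = (qa * qb) *: (
    dl *: (c *m (\tr (c *m H) *: Lam - H *m (c *m Lam) + J *m (H *m (J *m (c *m Lam)))))
    + dl *: (c *m (L *m (c *m u) - \tr (c *m L) *: u - J *m (L *m (J *m (c *m u)))))
    + (c *m (twist *m (\tr a *: (a *m Lam) - \tr b *: (b *m Lam)
                  - (a *m (a *m Lam) - b *m (b *m Lam)) *+ 2))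
       - (a *m (c *m (twist *m (a *m Lam)))
          - b *m (c *m (twist *m (b *m Lam)))) *+ 2)).
Proof.
pose T0 : 'M[F]_m := dl *: (c *m twist *m c).
have dldl k : d k dl = 0 by rewrite derB vconst wconst subrr.
(* The resolvent identity differentiated with constant [dl]: derivatives of the product [c] become
   derivatives of single resolvents. *)
have nabdl k : dl *: nabE k c = nabE k a - nabE k b.
  by rewrite -nabEB resolvent_diff nabEZ dldl scale0r add0r.
have nablam k : nab k Lam = L *m ev k by rewrite jac_ev.
have nabu k : nab k u = H *m ev k by rewrite jac_ev.
(* The correction is the logarithmic derivative of [qa * qb]. *)
have -> : dvg T = (qa * qb) *: (dvg T0 - T0 *m (a *m Lam + b *m Lam) *+ 2).
  rewrite !unlock_dvg -[X in T0 *m X](sum_ip_dual_ev gT ggi).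
  rewrite mulmx_sumr -sumrMnl -sumrB scaler_sumr; apply: eq_bigr => k _.
  rewrite /T -scalerA -/T0 nabEZ derM dqa dqb ipDl mulmxDl.
  rewrite -!scalemxAl -scalemxAr; mxring.
congr (_ *: _).
have dvgT0 : dvg T0 =
    (\sum_k nabE k a *m (twist *m c) *m dual_ev k
     - \sum_k nabE k b *m (twist *m c) *m dual_ev k)
    + dl *: (c *m \sum_k nabE k twist *m (c *m dual_ev k))
    + c *m (twist *m (\sum_k nabE k a *m dual_ev k - \sum_k nabE k b *m dual_ev k)).
  rewrite unlock_dvg -!sumrB !mulmx_sumr scaler_sumr -!big_split.
  apply: eq_bigr => k _ /=.
  rewrite nabEZ dldl scale0r add0r (nabEM _ _ k (c *m twist)).
  rewrite (nabEM _ _ k c twist) -!mulmxBl -nabdl.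
  by rewrite !(=^~ scalemxAl, =^~ scalemxAr) !(mulmxDl, scalerDr) !mulmxA; mxring.
have cJ x : c *m (J *m x) = J *m (c *m x) by rewrite -!mulmxA !normE.
have adc : adj (twist *m c) = - (c *m twist).
  by rewrite adjM' adj_twist adjM' as_ bs_ -ab mulmxN.
have cs : adj c = c by rewrite adjM' as_ bs_ -ab.
have cJm : c *m J = J *m c by rewrite -mulmxA bJ !mulmxA aJ.
have sumTw : \sum_k nabE k twist *m (c *m dual_ev k) =
    (\tr (c *m H) *: Lam - H *m (c *m Lam) + J *m (H *m (J *m (c *m Lam))))
    + (L *m (c *m u) - \tr (c *m L) *: u - J *m (L *m (J *m (c *m u)))).
  pose D k := outer (L *m ev k) u + outer Lam (H *m ev k)
    - (outer (H *m ev k) Lam + outer u (L *m ev k)).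
  have nabZ k : nabE k twist = D k + J *m D k *m J.
    have DE : nabE k (outer Lam u - outer u Lam) = D k.
      by rewrite nabEB !(nabE_outer metricity) !nablam !nabu.
    by rewrite unlock_twist nabED !nabEM nabJ mul0mx mulmx0 add0r addr0 DE.
  have sumD Y : \sum_k D k *m (Y *m dual_ev k) =
      L *m (adj Y *m u) + \tr (adj Y *m H) *: Lam
      - (H *m (adj Y *m Lam) + \tr (adj Y *m L) *: u).
    rewrite -!sum_outer_l -!sum_outer_r -!big_split -sumrB.
    by apply: eq_bigr => k _; rewrite /D mulmxBl !mulmxDl.
  transitivity (\sum_k (D k *m (c *m dual_ev k)
      + J *m (D k *m (J *m c *m dual_ev k)))).
    by apply: eq_bigr => k _; rewrite nabZ mulmxDl !mulmxA.
  have trJc X : adj X = X -> \tr (c *m J *m X) = 0.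
    move=> Xs; apply: (double_eq0 hh).
    rewrite -{1}(mxtrace_adj ggi) (adjM' (c *m J)) Xs (adjM' c J) cs Jskew.
    rewrite mulNmx mulmxN mxtraceN.
    by rewrite mxtrace_mulC -cJm addNr.
  have adJc : adj (J *m c) = - (c *m J) by rewrite (adjM' J c) cs Jskew mulmxN.
  rewrite big_split -mulmx_sumr !sumD cs adJc /=.
  rewrite !(mulNmx, mxtraceN) !trJc // oppr0 !scale0r.
  rewrite -![c *m J *m _]mulmxA !cJ !(mulmxN, mulmxDr, scale0r, oppr0).
  by rewrite mulmx0; mxring.
have sum1 s : \sum_k nabE k s *m dual_ev k = \sum_k nabE k s *m 1%:M *m dual_ev k.
  by under [RHS]eq_bigr do rewrite mulmx1.
have [ta1 ta2] : \tr (a *m (twist *m c)) = 0 /\ \tr (J *m (a *m (twist *m c))) = 0.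
  by apply: mxtrace_twist => //; rewrite -mulmxA -ab.
have [tb1 tb2] : \tr (b *m (twist *m c)) = 0 /\ \tr (J *m (b *m (twist *m c))) = 0.
  by apply: mxtrace_twist => //; rewrite mulmxA -ab.
rewrite dvgT0 sumTw !sum1.
rewrite !(sum_nabE_resolvent gT ggi Jskew As AJ nabA vconst av).
rewrite !(sum_nabE_resolvent gT ggi Jskew As AJ nabA wconst bw).
rewrite ta1 ta2 tb1 tb2 adc !adj_scalar // !mulmx1 !mul1mx.
rewrite (mxtrace_J_self ggi hh Jskew as_) (mxtrace_J_self ggi hh Jskew bs_).
rewrite !scale0r.
have JJc x : J *m (- (c *m twist) *m (J *m x)) = - (c *m (twist *m x)).
  rewrite mulNmx mulmxN -[c *m twist *m _]mulmxA [twist *m (J *m x)]mulmxA twistJ.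
  by rewrite mulNmx !mulmxN opprK -[J *m twist *m x]mulmxA cJ JJE.
have T0E x : T0 *m x = c *m (twist *m (a *m x - b *m x)).
  by rewrite /T0 -scalemxAl -!mulmxA -dlE -!scalemxAr !mulmxA.
rewrite !JJc T0E !JJE.
move: (\tr (c *m H) *: Lam - _ + _) (L *m (c *m u) - _ - _) => B1 B2.
rewrite mulNmx -[c *m twist *m _]mulmxA mulNmx -[c *m twist *m (b *m Lam)]mulmxA.
rewrite !(mulmxDr, mulmxN, mx_mulnr, =^~ scalemxAr) baE.
rewrite !mulmx0 -!mulmxA; mxring.
Qed.

Lemma dv_grd_dv_comm :
  dv ((qa *: a) *m grd (dv ((qb *: b) *m u))) =
  dv ((qb *: b) *m grd (dv ((qa *: a) *m u))).
Proof.
pose S := (qa *: a) *m (H *m (qb *: b)) - (qb *: b) *m (H *m (qa *: a)).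
pose T := (qa * qb * dl) *: (c *m twist *m c).
have Ss : adj S = - S.
  rewrite /S adjB !adjM' !adjZ as_ bs_ Hs.
  by rewrite !(=^~ scalemxAl, =^~ scalemxAr) !mulmxA; mxring.
have Ts : adj T = - T.
  have cs : adj c = c by rewrite adjM' as_ bs_ -ab.
  rewrite /T adjZ (adjM' (c *m twist)) (adjM' c) cs adj_twist.
  by rewrite mulNmx mulmxN scalerN !mulmxA.
apply/eqP; rewrite -subr_eq0 -dvN -dvD; apply/eqP.
have STs : adj (S + T) = - (S + T) by rewrite adjD Ss Ts; mxring.
rewrite -(dv_dvg_skew gT ggi metricity torsion hh STs).
congr dv; rewrite dvgD dvg_hess_bracket dvg_twist.
rewrite (grd_dv_K gT ggi metricity torsion hh JJ Jskew As AJ nabA vconst av dqa).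
rewrite (grd_dv_K gT ggi metricity torsion hh JJ Jskew As AJ nabA wconst bw dqb).
rewrite -/(sum_tr_part a) -/(sum_tr_part b) -/(gradient_part a) -/(gradient_part b).
rewrite -/(hess_part a) -/(hess_part b) -gradient_terms -curvature_terms.
have := second_order_terms; set Y1 := dl *: _ => E1.
(* Solved for the contribution of [S], the identity [E1] leaves [- Y1], which cancels the first
   group of the divergence of [T]. *)
have -> : sum_nab_part a b - sum_nab_part b a =
    a *m sum_tr_part b - b *m sum_tr_part a - Y1 by rewrite E1; mxring.
move: (sum_tr_part a) (sum_tr_part b) (gradient_part a) (gradient_part b)
  (hess_part a) (hess_part b) => *.
rewrite !(mulmxDr, mulmxN, =^~ scalemxAl, =^~ scalemxAr); mxring.
Qed.

End TwoResolvents.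

(** * The Levi-Civita connection *)

Section Koszul.
Variables (F : comNzRingType) (m : nat) (h : F).
Variables (g gi : 'M[F]_m) (dg : 'I_m -> 'M[F]_m).
Hypotheses (hh : h + h = 1) (gT : g^T = g) (ggi : g *m gi = 1%:M).
Hypothesis dgT : forall k, (dg k)^T = dg k.

(** Christoffel symbols of the first kind. The derivatives [dg] are free data, so that the formula
    also applies to derivatives along the coordinates of another chart. *)
Definition koszul_low k : 'M[F]_m :=
  \matrix_(l, j) (h * (dg k l j + dg j l k - dg l k j)).

Definition koszul k : 'M[F]_m := gi *m koszul_low k.

Let dgC k i j : dg k i j = dg k j i.
Proof. by rewrite -[in LHS]dgT mxE. Qed.

Let gkoszul k : g *m koszul k = koszul_low k.
Proof. by rewrite mulmxA ggi mul1mx. Qed.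

Lemma koszul_metric k : dg k = (koszul k)^T *m g + g *m koszul k.
Proof.
rewrite -{1}gT -trmx_mul gkoszul; apply/matrixP => i j; rewrite !mxE.
rewrite (dgC k j i) (dgC i j k) (dgC j k i).
transitivity ((h + h) * dg k i j); first by rewrite hh mul1r.
ring.
Qed.

Lemma koszul_torsion k l : koszul k *m ev_of F l = koszul l *m ev_of F k.
Proof.
rewrite /koszul -!mulmxA; congr (_ *m _).
apply/matrixP => i j; rewrite ord1 -!colE !mxE (dgC i k l); ring.
Qed.

(** Substitute the metric equation into the three terms of the Koszul formula: torsion-freeness
    identifies the entries in pairs, and twice the entry of [g *m Gam k] remains. The transformation
    law under a change of chart follows from this uniqueness. *)
Lemma koszul_unique (Gam : 'I_m -> 'M[F]_m) :
  (forall k, dg k = (Gam k)^T *m g + g *m Gam k) ->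
  (forall k l, Gam k *m ev_of F l = Gam l *m ev_of F k) ->
  Gam =1 koszul.
Proof.
move=> met tor k.
have gGam i : gi *m (g *m Gam i) = Gam i by rewrite mulmxA (mulmx1C ggi) mul1mx.
rewrite -gGam /koszul; congr (_ *m _).
have torE a b c : (g *m Gam a) b c = (g *m Gam c) b a.
  by rewrite -!mulmx_ev -!mulmxA tor.
have metE a b c : dg a b c = (g *m Gam a) c b + (g *m Gam a) b c.
  by rewrite {1}met -{1}gT -trmx_mul !mxE.
apply/matrixP => l j; rewrite [RHS]mxE !metE.
rewrite (torE j k l) (torE j l k) (torE k j l) (torE l k j).
rewrite -[LHS]mul1r -hh; ring.
Qed.

End Koszul.

(** * Jacobi's formula and the derivative of the square root of the determinant *)

Section Jacobi.
Variables (F : comNzRingType) (m : nat) (d : frame F m).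

Lemma der_prod k (I : finType) (E : I -> F) :
  d k (\prod_i E i) = \sum_i d k (E i) * \prod_(j | j != i) E j.
Proof.
have key (r : seq I) : uniq r -> d k (\prod_(i <- r) E i) =
    \sum_(i <- r) d k (E i) * \prod_(j <- r | j != i) E j.
  elim: r => [|i r IH]; first by rewrite !big_nil der1.
  rewrite cons_uniq => /andP[ir ur]; rewrite !big_cons derM IH // eqxx.
  congr (d k _ * _ + _).
    rewrite big_seq [RHS]big_seq_cond; apply: eq_bigl => j.
    by case: eqP => [->|_]; rewrite ?(negPf ir) ?andbT ?andbF.
  rewrite mulr_sumr big_seq [RHS]big_seq; apply: eq_bigr => j jr.
  rewrite big_cons; have -> : i != j by apply: contraNneq ir => ->.
  by rewrite mulrCA.
by rewrite key // index_enum_uniq.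
Qed.

Lemma der_det k (X : 'M[F]_m) : d k (\det X) = \tr (\adj X *m dmx d k X).
Proof.
rewrite /determinant der_sum.
transitivity (\sum_(s : 'S_m) \sum_i (-1) ^+ s *
    (d k (X i (s i)) * \prod_(j | j != i) X j (s j))).
  apply: eq_bigr => s _; rewrite derM der_prod mulr_sumr.
  have -> : d k ((-1) ^+ s) = 0.
    by case: (odd_perm s); rewrite ?expr0 ?der1 // expr1 derN der1 oppr0.
  by rewrite mul0r add0r.
rewrite exchange_big mxtrace_mulC; apply: eq_bigr => i _.
(* [Y] is [X] with row [i] differentiated; expanding its determinant along that row brings in the
   cofactors of [X]. *)
pose Y : 'M[F]_m := \matrix_(a, b) (if a == i then d k (X i b) else X a b).
transitivity (\det Y).
  apply: eq_bigr => s _; congr (_ * _).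
  rewrite [RHS](bigD1 i) //= mxE eqxx; congr (_ * _).
  by apply: eq_bigr => j /negPf ji; rewrite mxE ji.
rewrite (expand_det_row _ i) mxE; apply: eq_bigr => j _.
rewrite !mxE eqxx; congr (_ * _); rewrite /cofactor; congr (_ * \det _).
apply/matrixP => a b; rewrite !mxE.
by rewrite eq_sym (negPf (neq_lift _ _)).
Qed.

End Jacobi.

Section SqrtDet.
Variables (F : comNzRingType) (m : nat) (d : frame F m) (g gi : 'M[F]_m).
Variables (Gam : 'I_m -> 'M[F]_m) (h : F) (J A : 'M[F]_m) (lam : F).
Hypotheses (gT : g^T = g) (ggi : g *m gi = 1%:M).
Hypothesis metricity : forall k, dmx d k g = (Gam k)^T *m g + g *m Gam k.
Hypothesis hh : h + h = 1.

Local Notation ev := (@ev_of F m).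
Local Notation adj := (adj_of g gi).
Local Notation ip := (ip_of g).
Local Notation sym := (sym_of g J).
Local Notation nabE := (nabE_of d Gam).
Local Notation grd := (grd_of d gi).
Local Notation Lam := (grd lam).

Hypotheses (JJ : J *m J = - 1%:M) (Jskew : adj J = - J).
Hypotheses (As : adj A = A) (AJ : A *m J = J *m A).
Hypothesis nabA : forall k, nabE k A = sym Lam (ev k).
Implicit Types (x y : 'cV[F]_m) (X Y s : 'M[F]_m) (k l : 'I_m).

Variables (v q qi : F) (a : 'M[F]_m).
Hypotheses (vconst : forall k, d k v = 0) (av : a *m (v%:M - A) = 1%:M).
Hypotheses (qdet : q * q = \det (v%:M - A)) (qqi : qi * q = 1).

(** Jacobi's formula for [q * q] involves the trace of [a *m dmx d k A]. The connection terms drop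
    out of it because [a] commutes with [A], and [sym] contributes four equal inner products.
    Halving 4 gives the factor 2. *)
Lemma der_sqrt_det k : d k q = - (ip (a *m Lam) (ev k) * q) *+ 2.
Proof.
have as_ : adj a = a by exact: (adj_resolvent ggi As av).
have aJ : a *m J = J *m a by exact: (resolvent_comm av).
have aA : a *m A = A *m a by exact: (resolvent_comm av).
have adjE : \adj (v%:M - A) = (q * q) *: a.
  rewrite -[LHS]mulmx1 -{1}(mulmx1C av) mulmxA mul_adj_mx -qdet.
  by rewrite mul_scalar_mx.
have trE : \tr (a *m dmx d k A) = ip (a *m Lam) (ev k) *+ 4.
  have -> : dmx d k A = nabE k A - Gam k *m A + A *m Gam k.
    by rewrite unlock_nabE; mxring.
  rewrite nabA !mulmxDr mulmxN !mxtraceD mxtraceN.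
  have -> : \tr (a *m (Gam k *m A)) = \tr (a *m (A *m Gam k)).
    by rewrite mxtrace_mulC -mulmxA -aA [LHS]mxtrace_mulC -mulmxA.
  rewrite unlock_sym !mulmxDr !mulmx_outer !mxtraceD !mxtrace_outer.
  rewrite [a *m (J *m Lam)]mulmxA [a *m (J *m ev k)]mulmxA aJ -!mulmxA.
  have JJip x y : ip (J *m x) (J *m y) = ip x y.
    by rewrite (ip_adjl gT ggi) Jskew mulNmx (JJv JJ) opprK.
  rewrite !JJip [ip Lam _](ip_adjr gT ggi) as_ [ip (ev k) _](ipC gT); ring.
have : d k (q * q) = - (q * q * ip (a *m Lam) (ev k) *+ 4).
  rewrite qdet der_det adjE -scalemxAl mxtraceZ dmxB dmx_scalar vconst raddf0.
  by rewrite sub0r mulmxN mxtraceN trE qdet; ring.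
rewrite derM => E.
transitivity (qi * (h * (d k q * q + q * d k q))).
  transitivity ((h + h) * (qi * q) * d k q); first by rewrite hh qqi !mul1r.
  ring.
rewrite E.
transitivity ((h + h) * (qi * q) * - (ip (a *m Lam) (ev k) * q) *+ 2); last first.
  by rewrite hh qqi !mul1r.
ring.
Qed.

End SqrtDet.

(** * Square roots of characteristic polynomials *)

(** The two sizes may differ formally: in the application they are [r + r] and [m], whose equality
    is only forced by the inverse matrices. *)
Lemma char_poly_conj (F : fieldType) p m (S : 'M[F]_(p, m)) (T : 'M[F]_(m, p))
    (B : 'M[F]_m) (B' : 'M[F]_p) :
  S *m T = 1%:M -> T *m S = 1%:M -> S *m B = B' *m S ->
  char_poly B = char_poly B'.
Proof.
move=> ST TS.
have pm : p = m.
  apply/eqP; rewrite eqn_leq.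
  have := mulmx_max_rank S T; have := mulmx_max_rank T S.
  by rewrite ST TS !mxrank1 => -> ->.
subst m => SB; rewrite /char_poly.
pose Sp := map_mx polyC S; pose Tp := map_mx polyC T.
have TSp : Tp *m Sp = 1%:M by rewrite /Sp /Tp -map_mxM TS map_mx1.
have E : char_poly_mx B = Tp *m char_poly_mx B' *m Sp.
  rewrite /char_poly_mx mulmxBr mulmxBl mul_mx_scalar -scalemxAl TSp scalemx1.
  by congr (_ - _); rewrite -!map_mxM -mulmxA -SB mulmxA TS mul1mx.
by rewrite E !det_mulmx mulrAC -det_mulmx TSp det1 mul1r.
Qed.

Lemma char_poly_tr (F : fieldType) m (B : 'M[F]_m) : char_poly B^T = char_poly B.
Proof.
rewrite /char_poly -[RHS]det_tr; congr (\det _).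
by apply/matrixP => i j; rewrite !mxE eq_sym.
Qed.

Lemma char_poly_block (F : fieldType) p q (B : 'M[F]_p) (C : 'M[F]_q) :
  char_poly (block_mx B 0 0 C) = char_poly B * char_poly C.
Proof.
rewrite /char_poly /char_poly_mx map_block_mx !map_mx0
  [X in X - _]scalar_mx_block.
rewrite opp_block_mx add_block_mx !oppr0 !addr0.
exact: det_ublock.
Qed.

(* [C] plays the role of [R[i]]: over an abstract field, unification and [ring]
   do not unfold complex arithmetic. *)
Section ComplexStructure.
Variables (R C : fieldType) (toC : {rmorphism R -> C}) (cj : {rmorphism C -> C}).
Variables (re : C -> R) (I : C).
Hypotheses (ii : I * I = -1) (cjI : cj I = - I) (cjK : involutive cj).
Hypothesis cj_toC : forall x, cj (toC x) = toC x.
Hypothesis reD : forall x y, re (x + y) = re x + re y.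
Hypothesis reM : forall x y, re (x * toC y) = re x * y.
Hypothesis toC_re : forall x, cj x = x -> toC (re x) = x.
Hypotheses (C2 : 2%:R != 0 :> C) (C4 : 4%:R != 0 :> C).
Variables (m : nat) (g gi J B : 'M[R]_m).
Hypotheses (gT : g^T = g) (ggi : g *m gi = 1%:M) (JJ : J *m J = - 1%:M).
Hypotheses (Jg : J^T *m g = - (g *m J)) (Bg : B^T *m g = g *m B).
Hypothesis BJ : B *m J = J *m B.
Variables (r : nat) (Y : 'M[C]_(m, r)) (V : 'M[C]_(r, m)).
Hypothesis YV : Y *m V = 1%:M - I *: map_mx toC J.
Hypotheses (Yfull : row_full Y) (Vfree : row_free V).

Local Notation mxC := (map_mx toC).
Local Notation conj := (map_mx cj).

(** [M] and [N] are twice the projectors onto the eigenspaces of [J] for [I] and [- I]. [Y] and [V]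
    are a rank factorization of [M], so the columns of [Y] are a basis of the first eigenspace and
    those of its conjugate [Z] a basis of the second. *)
Let M : 'M[C]_m := 1%:M - I *: mxC J.
Let N : 'M[C]_m := 1%:M + I *: mxC J.

Let JJC : mxC J *m mxC J = - 1%:M.
Proof. by rewrite -map_mxM JJ map_mxN map_mx1. Qed.

Let MM : M *m M = 2%:R *: M.
Proof.
rewrite /M !(mulmxBl, mulmxBr, mulmx1, mul1mx) -!scalemxAl -!scalemxAr JJC.
rewrite scalerA ii; mxring.
Qed.

Let MN : M *m N = 0.
Proof.
rewrite /M /N !(mulmxBl, mulmxDr, mulmx1, mul1mx) -!scalemxAl -!scalemxAr JJC.
by rewrite scalerA ii; mxring.
Qed.

Let conjM : conj M = N.
Proof.
apply/matrixP => i j; rewrite !mxE rmorphB rmorphM /= cj_toC cjI.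
by rewrite mulNr opprK rmorph_nat.
Qed.

Let conjconj p q (X : 'M[C]_(p, q)) : conj (conj X) = X.
Proof. by apply/matrixP => i j; rewrite !mxE cjK. Qed.

Let conjmxC p q (X : 'M[R]_(p, q)) : conj (mxC X) = mxC X.
Proof. by apply/matrixP => i j; rewrite !mxE cj_toC. Qed.

Let YVM : Y *m V = M. Proof. exact: YV. Qed.

Let Ycan p : injective (@mulmx C m r p Y).
Proof. exact: row_full_inj. Qed.

Let Vcan p : injective ((@mulmx C p r m)^~ V).
Proof. exact: row_free_inj. Qed.

Let VY : V *m Y = 2%:R *: 1%:M.
Proof.
apply/Vcan/Ycan; rewrite /= -!mulmxA YVM [Y *m (V *m _)]mulmxA YVM MM.
by rewrite -scalemxAl mul1mx -scalemxAr YVM.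
Qed.

Let W := conj V.
Let Z := conj Y.

Let ZW : Z *m W = N. Proof. by rewrite -map_mxM YVM conjM. Qed.

Let VZ : V *m Z = 0.
Proof.
have Wcan : injective ((@mulmx C r r m)^~ W).
  by apply/row_free_inj; rewrite row_free_map.
apply/Wcan/Ycan; rewrite /= -!mulmxA ZW [Y *m (V *m _)]mulmxA YVM MN.
by rewrite mul0mx mulmx0.
Qed.

Let WZ : W *m Z = 2%:R *: 1%:M.
Proof. by rewrite -map_mxM VY map_mxZ map_mx1 rmorph_nat. Qed.

Let WY : W *m Y = 0.
Proof. by rewrite -[Y]conjconj -map_mxM VZ map_mx0. Qed.

Let half : 2%:R^-1 * 2%:R = 1 :> C.
Proof. exact: mulVf. Qed.

(** The restriction of [B] to the eigenspace for [I] in the basis [Y]; one half compensates for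
    [V *m Y] being twice the identity. *)
Let B' : 'M[C]_r := 2%:R^-1 *: (V *m mxC B *m Y).

Let MB : M *m mxC B = mxC B *m M.
Proof.
rewrite /M mulmxBl mulmxBr mul1mx mulmx1 -scalemxAl -scalemxAr -!map_mxM.
by rewrite BJ.
Qed.

Let VB : V *m mxC B = B' *m V.
Proof.
have VM : V *m M = 2%:R *: V by rewrite -YVM mulmxA VY -scalemxAl mul1mx.
rewrite /B' -scalemxAl -!mulmxA YVM -MB [V *m (M *m _)]mulmxA VM.
by rewrite -scalemxAl scalerA half scale1r.
Qed.

Let WB : W *m mxC B = conj B' *m W.
Proof. by rewrite -(conjmxC B) -map_mxM VB map_mxM. Qed.

Let char_poly_B : char_poly (mxC B) = char_poly B' * char_poly (conj B').
Proof.
rewrite -char_poly_block.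
apply: (@char_poly_conj _ _ _ (col_mx V W)
  (2%:R^-1 *: row_mx Y Z)).
- rewrite -scalemxAr mul_col_row VY VZ WY WZ scale_block_mx !scaler0.
  by rewrite !scalerA half !scale1r -scalar_mx_block.
- rewrite -scalemxAl mul_row_col YVM ZW /M /N addrACA addNr addr0.
  by rewrite -mulr2n -scaler_nat scalerA half scale1r.
- by rewrite mul_col_mx mul_block_col !mul0mx addr0 add0r VB WB.
Qed.

(** Since [J] is skew, [g] pairs the two eigenspaces perfectly: [h] is this pairing and [k] its
    inverse, with a factor one half for each of [V *m Y] and [W *m Z]. Self-adjointness of [B] makes
    [h] intertwine [B'] with the transpose of its conjugate. *)
Let char_poly_B'_conj : char_poly (conj B') = char_poly B'.
Proof.
pose h := V *m mxC gi *m W^T.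
pose k : 'M[C]_r := (4%:R^-1) *: (Z^T *m mxC g *m Y).
have giT : gi^T = gi.
  have gig := mulmx1C ggi.
  rewrite -[LHS]mul1mx -gig -mulmxA -[X in X *m gi^T]gT -trmx_mul gig trmx1.
  by rewrite mulmx1.
have hk : h *m k = 1%:M.
  have NT : mxC gi *m N^T *m mxC g = M.
    rewrite /N linearD linearZ /= trmx1 mulmxDr mulmxDl mulmx1 -map_mxM.
    rewrite (mulmx1C ggi) map_mx1 -scalemxAr -scalemxAl map_trmx -!map_mxM.
    rewrite -mulmxA Jg mulmxN mulmxA (mulmx1C ggi) mul1mx map_mxN.
    by rewrite scalerN.
  rewrite /h /k -scalemxAr !mulmxA -[_ *m W^T *m Z^T]mulmxA -trmx_mul ZW.
  rewrite -[V *m _ *m N^T]mulmxA -[V *m _ *m mxC g]mulmxA NT -YVM.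
  rewrite mulmxA VY -mulmxA VY -scalemxAl -scalemxAr mul1mx !scalerA.
  by rewrite -mulrA -natrM mulVf ?scale1r.
have hB : B' *m h = h *m (conj B')^T.
  rewrite /h 2!mulmxA -VB -[V *m mxC B *m _]mulmxA -!map_mxM.
  have -> : B *m gi = gi *m B^T.
    have gig := mulmx1C ggi.
    transitivity (gi *m (g *m B) *m gi); first by rewrite mulmxA gig mul1mx.
    by rewrite -Bg -!mulmxA ggi mulmx1.
  by rewrite !map_mxM -!mulmxA -map_trmx -!trmx_mul WB.
rewrite -char_poly_tr; apply: (@char_poly_conj _ _ _ h k) => //.
exact: mulmx1C.
Qed.

(** [q] is the characteristic polynomial of the block [B'], real because it equals its conjugate.
    [P] is assembled from the adjugates of the two blocks, each of which inverts its block up to the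
    factor [q], whereas the adjugate of the full matrix would produce [q * q]. *)
Lemma hermitian_sqrt_char_poly : exists q : {poly R}, exists P : 'M[{poly R}]_m,
  [/\ q \is monic, char_poly B = q * q
    & P *m ('X%:M - map_mx polyC B) = q%:M].
Proof.
have re0 : re 0 = 0 by apply: (addrI (re 0)); rewrite -reD !addr0.
have toC_reK x : re (toC x) = x.
  by apply: (fmorph_inj toC); rewrite toC_re ?cj_toC.
pose io := map_poly toC.
pose Rp (p : {poly C}) : {poly R} := map_poly re p.
have coefRp p i : (Rp p)`_i = re p`_i by rewrite coef_map_id0 ?re0.
have Rpio p : Rp (io p) = p by apply/polyP => i; rewrite coefRp coef_map toC_reK.
have RpD p1 p2 : Rp (p1 + p2) = Rp p1 + Rp p2.
  by apply/polyP => i; rewrite !(coefRp, coefD) reD.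
have RpM p1 p2 : Rp (p1 * io p2) = Rp p1 * p2.
  apply/polyP => i; rewrite coefRp !coefM (big_morph re reD re0).
  by apply: eq_bigr => j _; rewrite coef_map coefRp reM.
pose chi := char_poly B'.
have chi_real : io (Rp chi) = chi.
  apply/polyP => i; rewrite coef_map coefRp /= toC_re //.
  rewrite /chi -[in RHS]char_poly_B'_conj.
  by rewrite -[char_poly (conj _)]map_char_poly coef_map.
pose Vp := map_mx polyC V; pose Yp := map_mx polyC Y.
pose Wp := map_mx polyC W; pose Zp := map_mx polyC Z.
pose PC : 'M[{poly C}]_m := (2%:R^-1)%:P *:
  (Yp *m \adj (char_poly_mx B') *m Vp + Zp *m \adj (char_poly_mx (conj B')) *m Wp).
have inter (S : 'M[C]_(r, m)) (D : 'M[C]_r) : S *m mxC B = D *m S ->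
    map_mx polyC S *m char_poly_mx (mxC B) = char_poly_mx D *m map_mx polyC S.
  move=> SD; rewrite /char_poly_mx mulmxBr mulmxBl mul_mx_scalar mul_scalar_mx.
  by rewrite -!map_mxM SD.
have PCE : PC *m char_poly_mx (mxC B) = chi%:M.
  rewrite -scalemxAl mulmxDl -[_ *m Vp *m _]mulmxA -[_ *m Wp *m _]mulmxA.
  rewrite (inter _ _ VB) (inter _ _ WB) !mulmxA -[Yp *m _ *m _]mulmxA.
  rewrite -[Zp *m _ *m _]mulmxA !mul_adj_mx -/(char_poly _) -/(char_poly _).
  rewrite char_poly_B'_conj !mul_mx_scalar -!scalemxAl -scalerDr -!map_mxM YVM conjM.
  have MN2 : M + N = 2%:R%:M.
    by rewrite /M /N addrACA addNr addr0 -raddfD.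
  rewrite -map_mxD MN2 map_scalar_mx !scale_scalar_mx mulrCA -polyCM half.
  by rewrite mulr1.
exists (Rp chi), (map_mx Rp PC); split.
- by rewrite -(map_monic toC) [map_poly _ _]chi_real char_poly_monic.
- apply: (map_poly_inj toC); rewrite rmorphM /= map_char_poly.
  by rewrite char_poly_B char_poly_B'_conj [map_poly _ _]chi_real.
- apply/matrixP => i j; rewrite !mxE.
  have := congr1 (fun X : matrix _ _ _ => Rp (X i j)) PCE.
  rewrite -map_char_poly_mx !mxE => E.
  transitivity (Rp (chi *+ (i == j))); last first.
    by rewrite -[in LHS]chi_real; case: (i == j); rewrite ?mulr1n ?mulr0n ?Rpio //
       -(rmorph0 io) Rpio.
  rewrite -E (big_morph Rp RpD (_ : Rp 0 = 0)); last by rewrite -(rmorph0 io) Rpio.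
  apply: eq_bigr => k _; rewrite [map_mx Rp _ _ _]mxE [map_mx _ _ k j]mxE RpM.
  by rewrite !mxE.
Qed.

End ComplexStructure.

Lemma poly_all_roots (R : numDomainType) (p : {poly R}) :
  (forall t, p.[t] = 0) -> p = 0.
Proof.
move=> p0; apply/eqP; apply/negPn/negP => pN0.
have := max_poly_roots pN0 (rs := [seq i%:R | i <- iota 0 (size p)]).
rewrite size_map size_iota ltnn => H; suff: false by [].
apply: H; first by apply/allP => x _; rewrite /root p0.
by rewrite map_inj_uniq ?iota_uniq // => i j /eqP; rewrite eqr_nat => /eqP.
Qed.

Lemma poly_eq_off_roots (R : numDomainType) (c p q : {poly R}) :
  c != 0 -> (forall t, c.[t] != 0 -> p.[t] = q.[t]) -> p = q.
Proof.
move=> c0 H; apply/eqP; rewrite -subr_eq0; apply/eqP.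
have : (p - q) * c = 0.
  apply: poly_all_roots => t; rewrite hornerM; have [->|ct] := eqVneq c.[t] 0.
    by rewrite mulr0.
  by rewrite hornerD hornerN H // subrr mul0r.
by move=> /eqP; rewrite mulf_eq0 (negPf c0) orbF => /eqP.
Qed.

Lemma horner_char_poly (R : comNzRingType) m (B : 'M[R]_m) t :
  (char_poly B).[t] = \det (t%:M - B).
Proof.
rewrite -[LHS]/(horner_eval t _) -det_map_mx; congr (\det _).
rewrite map_mxB map_scalar_mx /= /horner_eval hornerX; congr (_ - _).
by apply/matrixP => i j; rewrite !mxE /horner_eval hornerC.
Qed.

Lemma monic_mup_inj (C : closedFieldType) (p q : {poly C}) :
  p \is monic -> q \is monic -> (forall z, mup z p = mup z q) -> p = q.
Proof.
have [n] := ubnP (size p); elim: n p q => // n IH p q /ltnSE sp pm qm H.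
have root1 (r : {poly C}) : r \is monic -> (forall z, ~~ root r z) -> r = 1.
  move=> rm rz; have /size_poly1P[c c0 rE] : size r == 1%N.
    by apply/negPn/negP => /closed_rootP[z]; rewrite (negPf (rz z)).
  by move: rm; rewrite rE monicE lead_coefC => /eqP ->.
have rootE (r : {poly C}) z : r \is monic -> root r z = (0 < mup z r)%N.
  by move=> rm; rewrite -XsubC_dvd ?monic_neq0 // dvdp_XsubCl.
have [[z pz]|Np] := pselect (exists z, root p z); last first.
  have np z : ~~ root p z by apply/negP => pz; apply: Np; exists z.
  rewrite (root1 p) // (root1 q) // => z.
  by rewrite rootE // -H -rootE.
have qz : root q z by rewrite rootE // -H -rootE.
have /factor_theorem[p1 pE] := pz; have /factor_theorem[q1 qE] := qz.
have p1m : p1 \is monic by rewrite -(monicMr _ (monicXsubC z)) -pE.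
have q1m : q1 \is monic by rewrite -(monicMr _ (monicXsubC z)) -qE.
rewrite pE qE; congr (_ * _); apply: IH => //.
  by move: sp; rewrite pE size_Mmonic ?monic_neq0 ?monicXsubC // size_XsubC addn2.
move=> y; have := H y; rewrite pE qE !mupM ?monic_neq0 ?monicXsubC //.
exact: addIn.
Qed.

Section SqrtCharPoly.
Variables (R : realType) (m : nat).
Implicit Types (B : 'M[R]_m) (q : {poly R}) (P : 'M[{poly R}]_m).

(** An algebraic certificate that [q] and [P] are the values selected by [xget] in [sqrt_char_poly]
    and [K_poly]. *)
Definition resolvent_poly B q P :=
  [/\ q \is monic, char_poly B = q * q & P *m ('X%:M - map_mx polyC B) = q%:M].

Lemma hermitian_resolvent_poly (g gi J B : 'M[R]_m) :
  g^T = g -> g *m gi = 1%:M -> J *m J = - 1%:M -> J^T *m g = - (g *m J) ->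
  B^T *m g = g *m B -> B *m J = J *m B -> exists q P, resolvent_poly B q P.
Proof.
move=> gT ggi JJ Jg Bg BJ.
pose M : 'M[R[i]]_m := 1%:M - 'i%C *: map_mx (real_complex R) J.
have C0 k : k.+1%:R != 0 :> R[i] by rewrite pnatr_eq0.
apply: (@hermitian_sqrt_char_poly R R[i] (real_complex R) (@conjc R)
  (@complex.Re R) 'i%C _ _ _ _ _ _ _ (C0 1%N) (C0 3%N) m g gi J B gT ggi JJ Jg
  Bg BJ (\rank M) (col_base M) (row_base M)).
- by rewrite -expr2 sqr_i.
- by apply/eqP; rewrite eq_complex /= oppr0 !eqxx.
- exact: conjcK.
- exact: conjc_real.
- by case=> a b [].
- by case=> a b y /=; rewrite mulr0 subr0.
- case=> a b [] /eqP; rewrite eq_sym -subr_eq0 opprK -mulr2n.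
  by rewrite mulrn_eq0 /= => /eqP ->.
- exact: mulmx_base.
- exact: col_base_full.
- exact: row_base_free.
Qed.

Lemma sqrt_char_polyE B q : q \is monic -> char_poly B = q * q ->
  sqrt_char_poly B = q.
Proof.
move=> qm Bq; have qmC : map_poly (real_complex R) q \is monic by rewrite map_monic.
have mupq z : (mup z (map_poly (real_complex R) (char_poly B)))./2 =
    mup z (map_poly (real_complex R) q).
  by rewrite Bq rmorphM mupM ?monic_neq0 // addnn doubleK.
apply: xget_unique; first by split.
move=> q' [q'm H]; apply: (map_poly_inj (real_complex R)).
apply: monic_mup_inj; rewrite ?map_monic // => z.
by rewrite H mupq.
Qed.

Lemma resolvent_polyE B q P t : resolvent_poly B q P -> t%:M - B \in unitmx ->
  map_mx (horner_eval t) P = q.[t] *: invmx (t%:M - B).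
Proof.
move=> [_ _ /(congr1 (map_mx (horner_eval t)))]; rewrite map_mxM map_scalar_mx.
rewrite map_mxB map_scalar_mx /= {2}/horner_eval hornerX.
have -> : map_mx (horner_eval t) (map_mx polyC B) = B.
  by apply/matrixP => i j; rewrite !mxE /horner_eval hornerC.
by move=> E Bt; rewrite -[LHS](mulmxK Bt) E mul_scalar_mx.
Qed.

(** The specification of [K_poly] fixes the values of its entries off the finitely many roots of the
    characteristic polynomial, hence the entries themselves. *)
Lemma K_polyE B q P : resolvent_poly B q P -> K_poly B = P.
Proof.
move=> H; have [qm Bq _] := H.
have unitE t : (t%:M - B \in unitmx) = ((char_poly B).[t] != 0).
  by rewrite unitmxE horner_char_poly unitfE.
apply: xget_unique => [t|P' P'E].
  by rewrite (sqrt_char_polyE qm Bq); exact: resolvent_polyE.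
apply/matrixP => i j; apply: (@poly_eq_off_roots _ (char_poly B)).
  by rewrite monic_neq0 // char_poly_monic.
move=> t; rewrite -unitE => Bt.
have := P'E t Bt; rewrite (sqrt_char_polyE qm Bq) -(resolvent_polyE H) //.
by move=> /matrixP /(_ i j); rewrite !mxE.
Qed.

Lemma resolvent_poly_conj B B' (S T : 'M[R]_m) q P :
  S *m T = 1%:M -> S *m B = B' *m S -> resolvent_poly B q P ->
  resolvent_poly B' q (map_mx polyC S *m P *m map_mx polyC T).
Proof.
move=> ST SB [qm Bq PE]; have TS := mulmx1C ST; split => //.
  by rewrite -(char_poly_conj ST TS SB).
have TB : map_mx polyC T *m ('X%:M - map_mx polyC B') =
    ('X%:M - map_mx polyC B) *m map_mx polyC T.
  rewrite mulmxBr mulmxBl mul_mx_scalar mul_scalar_mx -!map_mxM; congr (_ - map_mx _ _).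
  by rewrite -[B']mulmx1 -ST [B' *m _]mulmxA -SB !mulmxA TS mul1mx.
rewrite -mulmxA TB mulmxA -[_ *m P *m _]mulmxA PE mul_mx_scalar -scalemxAl.
by rewrite -map_mxM ST map_mx1 scalemx1.
Qed.

End SqrtCharPoly.

Fixpoint mx_tail (F : comNzRingType) m (B : 'M[F]_m) (f : nat -> F) k : 'M[F]_m :=
  if k is k'.+1 then (f 0)%:M + mx_tail B (fun i => f i.+1) k' *m B else 0.

Lemma mx_tail0 (F : comNzRingType) m (B : 'M[F]_m) f k :
  (forall i, f i = 0) -> mx_tail B f k = 0.
Proof.
by elim: k f => //= k IH f f0; rewrite f0 IH // mul0mx addr0; exact: raddf0.
Qed.

Lemma map_mx_tail (F F' : comNzRingType) (e : {rmorphism F -> F'}) m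
    (B : 'M[F]_m) f k :
  map_mx e (mx_tail B f k) = mx_tail (map_mx e B) (fun i => e (f i)) k.
Proof.
elim: k f => [|k IH] f /=; first exact: map_mx0.
by rewrite map_mxD map_scalar_mx map_mxM IH.
Qed.

(** Comparing coefficients in the equation for [P] gives a recursion from each coefficient to the
    next lower one. It exhibits the coefficients of [P] as polynomials in [B] and the coefficients
    of [q], hence as smooth when these are. *)
Lemma resolvent_poly_coef (R : realType) m (B : 'M[R]_m) q P N j :
  resolvent_poly B q P -> (size q <= N)%N ->
  map_mx (coefp j) P = mx_tail B (fun i => q`_(j.+1 + i)) N.
Proof.
move=> [_ _ PE] qN.
have step i : map_mx (coefp i) P = (q`_(i.+1))%:M + map_mx (coefp i.+1) P *m B.
  have /matrixP E := congr1 (map_mx (coefp i.+1)) PE.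
  apply/matrixP => a b; have := E a b.
  rewrite mulmxBr mul_mx_scalar !mxE /= !coefB coefXM /= => /eqP.
  rewrite subr_eq => /eqP ->; rewrite coefMn; congr (_ + _).
  rewrite coef_sum; apply: eq_bigr => k _.
  by rewrite !mxE coefMC.
(* [N'] also bounds the degrees of all entries of [P], so that the recursion starts from zero;
   [stab] later shortens the sum to [N] terms. *)
have [N' [PN' NN']] : exists N', (forall i, (N' <= i)%N -> map_mx (coefp i) P = 0)
   /\ (N <= N')%N.
  exists (maxn N (\max_i \max_j size (P i j))); split; last exact: leq_maxl.
  move=> i; rewrite geq_max => /andP[_ /bigmax_leqP Pi].
  apply/matrixP => a b; rewrite !mxE /= nth_default //.
  by have /bigmax_leqP -> := Pi a isT.
have E k i : (N' <= i + k)%N ->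
    map_mx (coefp i) P = mx_tail B (fun l => q`_(i.+1 + l)) k.
  elim: k i => [|k IH] i; first by rewrite addn0 => /PN'.
  rewrite addnS -addSn => /IH E; rewrite step E /= addn0; congr (_ + mx_tail _ _ _ *m _).
  by apply/funext => l; rewrite addnS.
have stab (f : nat -> R) k l : (forall i, (k <= i)%N -> f i = 0) ->
    mx_tail B f (k + l) = mx_tail B f k.
  elim: k f => [|k IH] f f0 /=; first by rewrite mx_tail0 // => i; exact: f0.
  by rewrite IH // => i ki; rewrite f0.
rewrite (E N') ?leq_addl // -(subnKC NN') stab // => i Ni.
by rewrite nth_default // (leq_trans qN) // (leq_trans Ni) // leq_addl.
Qed.

(** Long extraction of a root: each step removes the leading remaining coefficient, and halving is
    the only division. Over smooth functions this yields smooth coefficients without taking a root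
    of any function. *)
Lemma poly_sqrt_exists (F : comNzRingType) (h : F) n (P : {poly F}) :
  h + h = 1 -> P \is monic -> size P = n.*2.+1 ->
  exists Q : {poly F}, [/\ Q \is monic, size Q = n.+1
    & (size (P - Q * Q)%R <= n)%N].
Proof.
move=> hh Pm sP.
suff H k : (k <= n)%N -> exists Q : {poly F}, [/\ Q \is monic, size Q = n.+1
    & (size (P - Q * Q)%R <= n.*2 - k)%N].
  have [Q [Qm sQ sPQ]] := H n (leqnn n); exists Q; split => //.
  by rewrite -[X in (_ <= X)%N](addnK n) addnn.
elim: k => [_|k IH kn].
  exists 'X^n; split; rewrite ?monicXn ?size_polyXn // subn0 -exprD addnn.
  apply/leq_sizeP => j; rewrite leq_eqVlt => /orP[/eqP <-|nj].
    by rewrite coefB coefXn eqxx -[P`__]/(P`_(n.*2.+1.-1)) -sP -lead_coefE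
      (monicP Pm) subrr.
  by rewrite coefB coefXn gtn_eqF // nth_default ?sP // subr0.
have [Q [Qm sQ sPQ]] := IH (ltnW kn).
(* As [Q] is monic of degree [n], adding [h * c] in degree [n - k.+1] changes this coefficient of
   [Q * Q] by [c]. *)
pose c := (P - Q * Q)`_(n.*2 - k.+1).
pose E : {poly F} := (h * c) *: 'X^(n - k.+1).
have sE : (size E <= n)%N.
  rewrite (leq_trans (size_scale_leq _ _)) // size_polyXn ltn_subrL.
  exact: leq_ltn_trans kn.
have sQE : size (Q + E) = n.+1 by rewrite size_polyDl ?sQ // ltnS.
exists (Q + E); split => //.
  by rewrite monicE lead_coefDl ?sQ ?ltnS // (monicP Qm).
apply/leq_sizeP => j jn.
have -> : P - (Q + E) * (Q + E) = (P - Q * Q) - (c *: (Q * 'X^(n - k.+1)) + E * E).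
  have cE : c%:P = (h * c)%:P + (h * c)%:P by rewrite -polyCD -mulrDl hh mul1r.
  rewrite /E -!mul_polyC cE; move: (h * c)%:P => x; ring.
have sEE : (size (E * E)%R <= n.*2 - k.+1)%N.
  have sE' : (size E <= (n - k.+1).+1)%N.
    by rewrite (leq_trans (size_scale_leq _ _)) // size_polyXn.
  rewrite (leq_trans (size_polyMleq _ _)) //.
  rewrite (@leq_trans ((n - k.+1).+1 + (n - k.+1).+1).-1) //.
    by rewrite -!subn1 leq_sub2r // leq_add.
  by lia.
rewrite !coefB coefD coefZ coefMXn (nth_default 0 (leq_trans sEE jn)) addr0.
have -> : (j < n - k.+1)%N = false by lia.
move: jn; rewrite leq_eqVlt => /orP[/eqP <-|jn]; last first.
  rewrite -coefB (leq_sizeP _ _ sPQ); last by lia.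
  by rewrite [Q`__]nth_default ?mulr0 ?subr0 // sQ; lia.
rewrite -coefB -/c.
have -> : (n.*2 - k.+1 - (n - k.+1) = n)%N by lia.
have -> : Q`_n = 1 by rewrite -(monicP Qm) lead_coefE sQ.
by rewrite mulr1 subrr.
Qed.

(** The product of [q1 - q2] with [q1 + q2] has size at most [n], but the second factor has leading
    coefficient 2 in degree [n]. An exact root is thus found by the approximate extraction. *)
Lemma poly_sqrt_unique (F : idomainType) n (P q1 q2 : {poly F}) :
  2%:R != 0 :> F -> q1 \is monic -> q2 \is monic ->
  size q1 = n.+1 -> size q2 = n.+1 ->
  (size (P - q1 * q1)%R <= n)%N -> (size (P - q2 * q2)%R <= n)%N -> q1 = q2.
Proof.
move=> two q1m q2m s1 s2 P1 P2; apply/eqP; rewrite -subr_eq0.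
apply/negPn/negP => q12.
have sD : size (q1 + q2) = n.+1.
  apply/eqP; rewrite eqn_leq (leq_trans (size_polyD _ _)) ?s1 ?s2 ?maxnn //=.
  rewrite ltnNge; apply/negP => /leq_sizeP /(_ n (leqnn n)) /eqP.
  rewrite coefD.
  have -> : q1`_n = 1 by rewrite -(monicP q1m) lead_coefE s1.
  have -> : q2`_n = 1 by rewrite -(monicP q2m) lead_coefE s2.
  by rewrite -mulr2n (negPf two).
have : (size ((q1 - q2) * (q1 + q2))%R <= n)%N.
  have -> : (q1 - q2) * (q1 + q2) = (P - q2 * q2) - (P - q1 * q1) by ring.
  by rewrite (leq_trans (size_polyD _ _)) // size_polyN geq_max P1 P2.
have q0 : q1 + q2 != 0 by rewrite -size_poly_eq0 sD.
rewrite size_mul // sD addnS /= leqNgt => /negP; apply.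
by rewrite -[X in (X < _)%N]add0n ltn_add2r lt0n size_poly_eq0.
Qed.

(** * Smooth functions in a chart *)

Lemma near_eq_differentiable (R : numFieldType) (V W : normedModType R)
    (f g : V -> W) (a : V) :
  (\forall x \near a, f x = g x) -> differentiable f a -> differentiable g a.
Proof.
move=> fg /diffP[dfc dfE].
apply/diffP; apply: (@getPex _ (fun (df : {linear V -> W}) => continuous df /\
  forall y, g y = g (lim (nbhs a)) + df (y - lim (nbhs a))
                  +o_(y \near a) (y - lim (nbhs a)))).
exists ('d f a); split => //.
have ga : g (lim (nbhs a)) = f (lim (nbhs a)).
  by rewrite lim_id // (nbhs_singleton fg).
have E : g = (fun y => g (lim (nbhs a)) + 'd f a (y - lim (nbhs a)))
    +o_ (nbhs a) (fun y => y - lim (nbhs a)).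
  apply/eqaddoP => e e0.
  have /eqaddoP/(_ e e0) : f = (fun y => f (lim (nbhs a)) + 'd f a (y - lim (nbhs a)))
     +o_ (nbhs a) (fun y => y - lim (nbhs a)) by apply/funext.
  move: fg; apply: filterS2 => y /= fgy.
  by rewrite ![(_ - _ : V -> W) _]/(_ - _) /= fgy ga.
by move=> y; rewrite {1}E.
Qed.

(** * Symmetry of second derivatives *)

Section Schwarz.
Variables (R : realType) (V : normedModType R).
Implicit Types (f : V -> R^o) (x v w : V).

Lemma is_derive_line f x v (t : R) : differentiable f (t *: v + x) ->
  is_derive t 1 (fun s : R => f (s *: v + x)) ('D_v f (t *: v + x)).
Proof.
move=> df; have dv : derivable f (t *: v + x) v by exact: diff_derivable.
have E : (fun h : R => h^-1 *: ((f (((h *: (1 : R^o)) + t) *: v + x)) - f (t *: v + x)))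
   = (fun h : R => h^-1 *: (f (h *: v + (t *: v + x)) - f (t *: v + x))).
  by apply/funext => h /=; rewrite [_ *: 1]mulr1 scalerDl addrA.
by apply: DeriveDef; rewrite /derivable /derive /= E.
Qed.

Lemma MVT_line f x v (t : R) : 0 < t ->
  (forall s, 0 <= s <= t -> differentiable f (s *: v + x)) ->
  exists2 s, 0 <= s <= t & f (t *: v + x) - f x = t * 'D_v f (s *: v + x).
Proof.
move=> t0 df.
have D s : 0 <= s <= t ->
    is_derive s 1 (fun s : R => f (s *: v + x)) ('D_v f (s *: v + x)).
  by move=> /df; exact: is_derive_line.
have [|s|s|s] := @MVT_segment R (fun s => f (s *: v + x))
    (fun s => 'D_v f (s *: v + x)) 0 t.
- exact: ltW.
- by rewrite in_itv /= => /andP[s0 st]; apply: D; rewrite !ltW.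
- apply: derivable_within_continuous => {}s; rewrite in_itv /= => st.
  by have [] := D s st.
rewrite in_itv /= => st; rewrite scale0r add0r subr0 mulrC => E.
by exists s.
Qed.

(* The second difference of [f] along [v] and [w] is expressed by the mean value
   theorem both through [D_w D_v f] and, exchanging the roles, [D_v D_w f]. *)
Lemma double_increment f x v w (t : R) : 0 < t ->
  (forall a b, 0 <= a <= t -> 0 <= b <= t ->
     differentiable f (a *: v + (b *: w + x)) /\
     differentiable ('D_v f : V -> R^o) (a *: v + (b *: w + x))) ->
  exists a b, [/\ 0 <= a <= t, 0 <= b <= t &
    f (t *: v + (t *: w + x)) - f (t *: v + x) - f (t *: w + x) + f x =
    t * (t * 'D_w ('D_v f : V -> R^o) (a *: v + (b *: w + x)))].
Proof.
move=> t0 H.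
have tt : 0 <= t <= t by rewrite lexx ltW.
have z0 : 0 <= (0 : R) <= t by rewrite lexx ltW.
pose F y : R^o := f (y + t *: w) - f y.
have Dsh y : differentiable f (y + t *: w) ->
    differentiable (fun z => f (z + t *: w) : R^o) y.
  move=> df; have dsh : differentiable (fun z : V => z + t *: w) y.
    have -> : (fun z : V => z + t *: w) = (id : V -> V) + cst (t *: w) by [].
    exact: differentiableD.
  exact: (differentiable_comp dsh df).
have DF y : differentiable f (y + t *: w) -> differentiable f y ->
    differentiable F y.
  by move=> d1 d2; apply: differentiableB => //; exact: Dsh.
have DvF y : differentiable f (y + t *: w) -> differentiable f y ->
    'D_v F y = 'D_v f (y + t *: w) - 'D_v f y.
  move=> d1 d2.
  have a1 : derivable (fun z => f (z + t *: w) : R^o) y v.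
    exact/diff_derivable/Dsh.
  have a2 : derivable f y v by exact: diff_derivable.
  have -> : 'D_v F y = 'D_v (fun z => f (z + t *: w) : R^o) y - 'D_v f y.
    exact: (deriveB a1 a2).
  congr (_ - _); rewrite /derive.
  have -> // : (fun s : R => s^-1 *: (f (s *: v + y + t *: w) - f (y + t *: w))) =
    (fun s : R => s^-1 *: (f (s *: v + (y + t *: w)) - f (y + t *: w))).
  by apply/funext => s; rewrite addrA.
have onF s : 0 <= s <= t -> differentiable f (s *: v + x + t *: w) /\
    differentiable f (s *: v + x).
  move=> st; split.
    by have [] := H s t st tt; rewrite addrAC addrA.
  by have [] := H s 0 st z0; rewrite scale0r add0r.
have [a at_ Ea] : exists2 s, 0 <= s <= t &
    F (t *: v + x) - F x = t * 'D_v F (s *: v + x).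
  by apply: MVT_line => // s /onF[]; exact: DF.
have [d1 d2] := onF a at_.
rewrite DvF // in Ea.
have [b bt Eb] : exists2 s, 0 <= s <= t & 'D_v f (t *: w + (a *: v + x)) -
   'D_v f (a *: v + x) = t * 'D_w ('D_v f : V -> R^o) (s *: w + (a *: v + x)).
  apply: (@MVT_line ('D_v f)) => // s st.
  by have [_] := H a s at_ st; rewrite addrCA.
exists a, b; split => //.
rewrite [a *: v + _]addrCA -Eb [t *: w + (a *: v + x)]addrC -Ea /F.
rewrite [t *: v + (t *: w + x)]addrCA [t *: w + (_ + x)]addrC [t *: w + x]addrC.
by rewrite opprB addrA addrAC.
Qed.

Lemma schwarz f x v w :
  (\forall y \near x, [/\ differentiable f y, differentiable ('D_v f : V -> R^o) y
     & differentiable ('D_w f : V -> R^o) y]) ->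
  {for x, continuous ('D_w ('D_v f : V -> R^o) : V -> R^o)} ->
  {for x, continuous ('D_v ('D_w f : V -> R^o) : V -> R^o)} ->
  'D_w ('D_v f : V -> R^o) x = 'D_v ('D_w f : V -> R^o) x.
Proof.
move=> /nbhs_ballP[r /= r0 Hr] c1 c2; apply/eqP/negPn/negP => neq.
(* Half of the supposed gap: a number within [e] of both mixed derivatives is a contradiction. *)
pose e := `|'D_w ('D_v f : V -> R^o) x - 'D_v ('D_w f : V -> R^o) x| / 2.
have e0 : 0 < e by rewrite divr_gt0 // normr_gt0 subr_eq0.
have /cvgrPdist_lt/(_ e e0)/nbhs_ballP[r1 /= r10 H1] := c1.
have /cvgrPdist_lt/(_ e e0)/nbhs_ballP[r2 /= r20 H2] := c2.
pose rho := Num.min r (Num.min r1 r2).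
have rho0 : 0 < rho by rewrite !lt_min r0 r10 r20.
(* The parallelogram with sides [t *: v] and [t *: w] fits in the ball of radius [rho]; the summand
   1 keeps the denominator positive when both vectors vanish. *)
pose t := rho / (2 * (`|v| + `|w| + 1)).
have d0 : 0 < `|v| + `|w| + 1 by rewrite ltr_pwDr // addr_ge0.
have t0 : 0 < t by rewrite divr_gt0 // mulr_gt0.
have small a b : 0 <= a <= t -> 0 <= b <= t -> ball x rho (a *: v + (b *: w + x)).
  move=> /andP[a0 at_] /andP[b0 bt]; rewrite -ball_normE /= addrA opprD addrCA.
  rewrite subrr addr0 normrN (le_lt_trans (ler_normD _ _)) // !normrZ.
  rewrite !ger0_norm // (@le_lt_trans _ _ (t * (`|v| + `|w| + 1))) //.
    rewrite !mulrDr mulr1 -addrA lerD ?ler_wpM2r // ler_wpDr ?ler_wpM2r //.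
    exact: ltW.
  rewrite /t -mulrA invfM -mulrA mulVf ?gt_eqF // mulr1.
  by rewrite ltr_pdivrMr // ltr_pMr // ltr1n.
have sub s y : rho <= s -> ball x rho y -> ball x s y by move=> ?; exact: le_ball.
have [rr rr1 rr2] : [/\ rho <= r, rho <= r1 & rho <= r2].
  by rewrite /rho; split; rewrite !ge_min lexx ?orbT.
have [a [b [at_ bt E]]] : exists a b, [/\ 0 <= a <= t, 0 <= b <= t &
    f (t *: v + (t *: w + x)) - f (t *: v + x) - f (t *: w + x) + f x =
    t * (t * 'D_w ('D_v f : V -> R^o) (a *: v + (b *: w + x)))].
  apply: double_increment => // a b at_ bt.
  by have [] := Hr _ (sub _ _ rr (small _ _ at_ bt)).
have [a' [b' [at' bt' E']]] : exists a b, [/\ 0 <= a <= t, 0 <= b <= t &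
    f (t *: w + (t *: v + x)) - f (t *: w + x) - f (t *: v + x) + f x =
    t * (t * 'D_v ('D_w f : V -> R^o) (a *: w + (b *: v + x)))].
  apply: double_increment => // a' b' at' bt'; rewrite addrCA.
  by have [] := Hr _ (sub _ _ rr (small _ _ bt' at')).
(* Both values equal the same second difference divided by [t] squared. *)
have EE : 'D_w ('D_v f : V -> R^o) (a *: v + (b *: w + x)) =
    'D_v ('D_w f : V -> R^o) (b' *: v + (a' *: w + x)).
  apply: (mulfI (lt0r_neq0 t0)); apply: (mulfI (lt0r_neq0 t0)).
  rewrite (addrCA (a' *: w)) (addrCA (t *: w)) in E'.
  apply: (etrans (esym E)); apply: (etrans _ E').
  by congr (_ + f x); exact: addrAC.
have := H1 _ (sub _ _ rr1 (small _ _ at_ bt)).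
have := H2 _ (sub _ _ rr2 (small _ _ bt' at')).
rewrite /= -EE => h2 h1.
have : `|'D_w ('D_v f : V -> R^o) x - 'D_v ('D_w f : V -> R^o) x| < e + e.
  apply: le_lt_trans (ltrD h1 h2); rewrite [X in _ <= _ + X]distrC.
  exact: ler_distD.
by rewrite -splitr ltxx.
Qed.

End Schwarz.

(** * Closure of smoothness under ring operations, inverses and derivatives *)

Section SmoothIn.
Variables (R : realType) (m : nat) (M : topologicalType) (c : chart R m M).
Variables (D : set M) (Dopen : open D).
Implicit Types (f g : M -> R) (p q : M) (k l : 'I_m).

Local Notation U := (D `&` dom c).
Local Notation loc f := (f \o param c : 'rV[R]_m -> R^o).

Lemma near_param p : U p -> \forall x \near chart_fun c p,
  U (param c x) /\ chart_fun c (param c x) = x.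
Proof.
move=> [Dp cp]; have cx : (chart_fun c @` dom c) (chart_fun c p) by exists p.
have nU : nbhs (param c (chart_fun c p)) U.
  rewrite chart_funK //; apply: open_nbhs_nbhs; split => //.
  by apply: openI => //; exact: dom_open.
have cont : {for chart_fun c p, continuous (param c)} by exact: param_continuous.
have ncod : nbhs (chart_fun c p) (chart_fun c @` dom c).
  by apply: open_nbhs_nbhs; split => //; exact: codom_open.
have := cont _ nU; rewrite nbhs_filterE /= => nU'.
apply: filterS2 nU' ncod => x Ux [q cq xE]; rewrite -xE in Ux *.
by split; [exact: Ux|rewrite chart_funK].
Qed.

Definition differentiable_on f :=
  forall p, U p -> differentiable (loc f) (chart_fun c p).

Lemma near_eq_loc f g p : (forall q, U q -> f q = g q) -> U p ->
  \forall x \near chart_fun c p, loc f x = loc g x.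
Proof.
move=> fg Up; have := near_param Up.
by apply: filterS => x [Ux _] /=; exact: fg.
Qed.

Lemma pd_ext f g k p : (forall q, U q -> f q = g q) -> U p ->
  pd c k f p = pd c k g p.
Proof. by move=> fg Up; apply: near_eq_derive; exact: near_eq_loc. Qed.

Lemma differentiable_on_ext f g :
  (forall q, U q -> f q = g q) -> differentiable_on f -> differentiable_on g.
Proof.
move=> fg df p Up; apply: (near_eq_differentiable _ (df p Up)).
exact: near_eq_loc.
Qed.

(** The derivative closest to [f] is peeled off, unlike the outermost one in [foldr]. The Leibniz
    rule then reduces a product to products of lower order, and the rules follow by induction on
    [n]. *)
Fixpoint differentiable_upto n f : Prop :=
  differentiable_on f /\
  if n is n'.+1 then forall k, differentiable_upto n' (pd c k f) else True.

Lemma differentiable_upto_on n f : differentiable_upto n f -> differentiable_on f.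
Proof. by case: n => [|n] []. Qed.

Lemma differentiable_uptoW n f : differentiable_upto n.+1 f -> differentiable_upto n f.
Proof. by elim: n f => [|n IH] f [df H]; split => // k; apply: IH; exact: H. Qed.

Lemma smooth_inP f : smooth_in c D f <-> forall n, differentiable_upto n f.
Proof.
split=> [sf n|H s].
  have {}sf s : differentiable_on (foldr (pd c) f s).
    by move=> p [Dp cp]; exact: sf.
  elim: n f sf => [|n IH] f sf; split => //; try exact: (sf [::]).
  by move=> k; apply: IH => s; rewrite -foldr_rcons; exact: sf.
move: {2}(size s) (leqnn (size s)) => n; elim: n s f H => [|n IH] s f H.
  rewrite leqn0 size_eq0 => /eqP -> p Dp cp.
  by apply: (differentiable_upto_on (H 0)).
case/lastP: s => [_|s k]; first by move=> p Dp cp; apply: (differentiable_upto_on (H 0)).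
rewrite size_rcons ltnS foldr_rcons => sn; apply: IH => // l.
by have [_ /(_ k)] := H l.+1.
Qed.

Lemma differentiable_upto_ext n f g : (forall q, U q -> f q = g q) ->
  differentiable_upto n f -> differentiable_upto n g.
Proof.
elim: n f g => [|n IH] f g fg [df H]; split => //.
- exact: differentiable_on_ext df.
- exact: differentiable_on_ext df.
- by move=> k; apply: (IH _ _ _ (H k)) => q; exact: pd_ext.
Qed.

Section Rules.
Variables (f g : M -> R).
Hypotheses (df : differentiable_on f) (dg : differentiable_on g).

Lemma differentiable_onD : differentiable_on (fun p => f p + g p).
Proof. by move=> p Up; exact: differentiableD (df Up) (dg Up). Qed.

Lemma differentiable_onN : differentiable_on (fun p => - f p).
Proof. by move=> p Up; exact: differentiableN (df Up). Qed.

Lemma differentiable_onM : differentiable_on (fun p => f p * g p).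
Proof. by move=> p Up; exact: differentiableM (df Up) (dg Up). Qed.

Lemma differentiable_onV : (forall p, U p -> f p != 0) ->
  differentiable_on (fun p => (f p)^-1).
Proof.
move=> f0 p Up; apply: differentiableV (df Up) _.
by case: Up => Dp cp; rewrite /= chart_funK // f0.
Qed.

Lemma differentiable_on_cst (a : R) : differentiable_on (fun=> a).
Proof. by move=> p Up; exact: differentiable_cst. Qed.

Variables (p : M) (k : 'I_m).
Hypothesis Up : U p.

Let locK (e : M -> R) : loc e (chart_fun c p) = e p.
Proof. by case: Up => Dp cp; rewrite /= chart_funK. Qed.

Lemma pdD : pd c k (fun q => f q + g q) p = pd c k f p + pd c k g p.
Proof. exact: deriveD (diff_derivable (df Up)) (diff_derivable (dg Up)). Qed.

Lemma pdN : pd c k (fun q => - f q) p = - pd c k f p.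
Proof. exact: deriveN (diff_derivable (df Up)). Qed.

Lemma pdM : pd c k (fun q => f q * g q) p = pd c k f p * g p + f p * pd c k g p.
Proof.
rewrite -(locK f) -(locK g) [RHS]addrC [X in _ = _ + X]mulrC.
exact: deriveM (diff_derivable (df Up)) (diff_derivable (dg Up)).
Qed.

Lemma pd_cst (a : R) : pd c k (fun=> a) p = 0.
Proof. exact: derive_cst. Qed.

Lemma pdV : (forall q, U q -> f q != 0) ->
  pd c k (fun q => (f q)^-1) p = - (((f p)^-1 * (f p)^-1) * pd c k f p).
Proof.
move=> f0; have fp : loc f (chart_fun c p) != 0 by rewrite locK f0.
have E := deriveV fp (diff_derivable (df Up) : derivable _ _ (delta_mx 0 k)).
apply: (etrans E); rewrite locK -/(pd c k f p).
by rewrite [LHS]mulNr; congr (- (_ * _)); rewrite -exprVn expr2.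
Qed.

End Rules.

Lemma differentiable_uptoD n f g : differentiable_upto n f ->
  differentiable_upto n g -> differentiable_upto n (fun p => f p + g p).
Proof.
elim: n f g => [|n IH] f g [df Hf] [dg Hg]; split => //;
  try exact: differentiable_onD.
move=> k; apply: differentiable_upto_ext (IH _ _ (Hf k) (Hg k)) => q Uq.
by rewrite pdD.
Qed.

Lemma differentiable_uptoN n f : differentiable_upto n f ->
  differentiable_upto n (fun p => - f p).
Proof.
elim: n f => [|n IH] f [df Hf]; split => //; try exact: differentiable_onN.
move=> k; apply: differentiable_upto_ext (IH _ (Hf k)) => q Uq.
by rewrite pdN.
Qed.

Lemma differentiable_uptoM n f g : differentiable_upto n f ->
  differentiable_upto n g -> differentiable_upto n (fun p => f p * g p).
Proof.
elim: n f g => [|n IH] f g Hf Hg; have [df Hf'] := Hf; have [dg Hg'] := Hg;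
  split => //; try exact: differentiable_onM.
move=> k; have := differentiable_uptoD
  (IH _ _ (Hf' k) (differentiable_uptoW Hg)) (IH _ _ (differentiable_uptoW Hf) (Hg' k)).
by apply: differentiable_upto_ext => q Uq; rewrite pdM.
Qed.

Lemma differentiable_upto_cst n (a : R) : differentiable_upto n (fun=> a).
Proof.
elim: n a => [|n IH] a; split => //; try exact: differentiable_on_cst.
by move=> k; apply: differentiable_upto_ext (IH 0) => q Uq; rewrite pd_cst.
Qed.

Lemma differentiable_uptoV n f : (forall p, U p -> f p != 0) ->
  differentiable_upto n f -> differentiable_upto n (fun p => (f p)^-1).
Proof.
move=> f0; elim: n => [|n IH] Hf; have [df Hf'] := Hf; split => //;
  try exact: differentiable_onV.
have H := IH (differentiable_uptoW Hf) => k.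
have := differentiable_uptoN (differentiable_uptoM (differentiable_uptoM H H) (Hf' k)).
by apply: differentiable_upto_ext => q Uq; rewrite pdV.
Qed.

Lemma smooth_in_ext f g : (forall q, U q -> f q = g q) ->
  smooth_in c D f -> smooth_in c D g.
Proof.
by move=> fg /smooth_inP H; apply/smooth_inP => n; exact: differentiable_upto_ext (H n).
Qed.

Lemma smooth_inD f g : smooth_in c D f -> smooth_in c D g ->
  smooth_in c D (fun p => f p + g p).
Proof.
move=> /smooth_inP Hf /smooth_inP Hg; apply/smooth_inP => n.
exact: differentiable_uptoD.
Qed.

Lemma smooth_inN f : smooth_in c D f -> smooth_in c D (fun p => - f p).
Proof.
by move=> /smooth_inP Hf; apply/smooth_inP => n; exact: differentiable_uptoN.
Qed.

Lemma smooth_inM f g : smooth_in c D f -> smooth_in c D g ->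
  smooth_in c D (fun p => f p * g p).
Proof.
move=> /smooth_inP Hf /smooth_inP Hg; apply/smooth_inP => n.
exact: differentiable_uptoM.
Qed.

Lemma smooth_inV f : (forall p, U p -> f p != 0) -> smooth_in c D f ->
  smooth_in c D (fun p => (f p)^-1).
Proof.
move=> f0 /smooth_inP Hf; apply/smooth_inP => n.
exact: differentiable_uptoV.
Qed.

Lemma smooth_in_cst (a : R) : smooth_in c D (fun=> a).
Proof. by apply/smooth_inP => n; exact: differentiable_upto_cst. Qed.

Lemma smooth_in_pd k f : smooth_in c D f -> smooth_in c D (pd c k f).
Proof. by move=> /smooth_inP H; apply/smooth_inP => n; have [_ /(_ k)] := H n.+1. Qed.

Lemma smooth_in_on f : smooth_in c D f -> differentiable_on f.
Proof. by move=> /smooth_inP /(_ 0); exact: differentiable_upto_on. Qed.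

Lemma pdC f k l p : smooth_in c D f -> U p ->
  pd c k (pd c l f) p = pd c l (pd c k f) p.
Proof.
move=> sf Up.
(* [pd] returns a function on the manifold, so an iterated [pd] passes through the chart twice. It
   agrees with the iterated directional derivative only near the point, where [param] and
   [chart_fun] are inverse. *)
have near_pd i (e : M -> R) q : U q ->
    \forall x \near chart_fun c q, loc (pd c i e) x = 'D_(delta_mx 0 i) (loc e) x.
  move=> Uq; have := near_param Uq; apply: filterS => x [_ E].
  by rewrite /= /pd E.
have DD i j : pd c i (pd c j f) p =
    'D_(delta_mx 0 i) ('D_(delta_mx 0 j) (loc f) : _ -> R^o) (chart_fun c p).
  by apply: near_eq_derive; exact: near_pd.
have dD i e : smooth_in c D e -> forall q, U q ->
    differentiable ('D_(delta_mx 0 i) (loc e) : 'rV[R]_m -> R^o) (chart_fun c q).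
  move=> se q Uq.
  apply: (near_eq_differentiable (near_pd i e q Uq)).
  exact: (smooth_in_on (smooth_in_pd i se)).
have cD i j : {for chart_fun c p, continuous
    ('D_(delta_mx 0 i) ('D_(delta_mx 0 j) (loc f) : _ -> R^o) : 'rV[R]_m -> R^o)}.
  apply: differentiable_continuous.
  apply: (near_eq_differentiable _ (dD i _ (smooth_in_pd j sf) p Up)).
  have := near_param Up; apply: filterS => x [Ux E].
  by apply: near_eq_derive; rewrite -E; exact: near_pd.
rewrite !DD; apply: schwarz => //.
have := near_param Up; apply: filterS => x [Ux E]; rewrite -E.
by split; [exact: smooth_in_on|exact: dD|exact: dD].
Qed.

End SmoothIn.

Lemma smooth_in_sub (R : realType) m (M : topologicalType) (c : chart R m M)
    (D D' : set M) (f : M -> R) :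
  D' `<=` D -> smooth_in c D f -> smooth_in c D' f.
Proof. by move=> DD sf s p /DD; exact: sf. Qed.

(** * The ring of smooth functions on an open part of a chart *)

Section SmoothRing.
Variables (R : realType) (m : nat) (M : topologicalType) (c : chart R m M).
Variables (D : set M) (Dopen : open D) (p0 : M).
Hypothesis U0 : (D `&` dom c) p0.

(* Functions are cut off to [0] outside of the domain, so that [=] is equality on
   the domain; [p0] guarantees [1 != 0]. *)
Record smfun (Dop : open D) (U0' : (D `&` dom c) p0) := SmFun {
  smval :> M -> R;
  smooth_smval : smooth_in c D smval;
  smval_out : forall p, ~ (D `&` dom c) p -> smval p = 0
}.

Local Notation F := (smfun Dopen U0).
Local Notation U := (D `&` dom c).

Lemma smfun_ext (x y : F) : (forall p, U p -> x p = y p) -> x = y.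
Proof.
move=> xy; have : smval x = smval y.
  apply/funext => p; have [Up|Up] := pselect (U p); first exact: xy.
  by rewrite !smval_out.
case: x y {xy} => [x sx ox] [y sy oy] /= xy; rewrite xy in sx ox *.
by rewrite (Prop_irrelevance sx sy) (Prop_irrelevance ox oy).
Qed.

Definition cut (f : M -> R) (p : M) : R := if asbool (U p) then f p else 0.

Lemma cutE f p : U p -> cut f p = f p.
Proof. by rewrite /cut => /asboolP ->. Qed.

Lemma smooth_in_cut f : smooth_in c D f -> smooth_in c D (cut f).
Proof. by apply: smooth_in_ext => // q Uq; rewrite cutE. Qed.

Lemma cut_out f p : ~ U p -> cut f p = 0.
Proof. by rewrite /cut; case: asboolP. Qed.

Definition mk_smfun f (sf : smooth_in c D f) : F :=
  SmFun Dopen U0 (smooth_in_cut sf) (cut_out f).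

Lemma mk_smfunE f (sf : smooth_in c D f) p : U p -> mk_smfun sf p = f p.
Proof. exact: cutE. Qed.

HB.instance Definition _ := gen_eqMixin (smfun Dopen U0).
HB.instance Definition _ := gen_choiceMixin (smfun Dopen U0).

Definition smcst (a : R) : F := mk_smfun (smooth_in_cst Dopen a).
Definition smadd (x y : F) : F :=
  mk_smfun (smooth_inD Dopen (smooth_smval x) (smooth_smval y)).
Definition smopp (x : F) : F := mk_smfun (smooth_inN Dopen (smooth_smval x)).
Definition smmul (x y : F) : F :=
  mk_smfun (smooth_inM Dopen (smooth_smval x) (smooth_smval y)).

Local Ltac smring := repeat move=> ?; apply: smfun_ext => ? ?;
  rewrite ?mk_smfunE //; ring.

Fact smaddA : associative smadd. Proof. smring. Qed.
Fact smaddC : commutative smadd. Proof. smring. Qed.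
Fact smadd0 : left_id (smcst 0) smadd. Proof. smring. Qed.
Fact smaddN : left_inverse (smcst 0) smopp smadd. Proof. smring. Qed.

HB.instance Definition _ := GRing.isZmodule.Build (smfun Dopen U0)
  smaddA smaddC smadd0 smaddN.

Fact smmulA : associative smmul. Proof. smring. Qed.
Fact smmulC : commutative smmul. Proof. smring. Qed.
Fact smmul1 : left_id (smcst 1) smmul. Proof. smring. Qed.
Fact smmulDl : left_distributive smmul smadd. Proof. smring. Qed.
Fact smcst1_neq0 : smcst 1 != 0.
Proof.
apply/eqP => /(congr1 (fun x : F => x p0)); rewrite [LHS]cutE // [RHS]cutE //.
by move=> /eqP; rewrite oner_eq0.
Qed.

HB.instance Definition _ := GRing.Zmodule_isComNzRing.Build (smfun Dopen U0)
  smmulA smmulC smmul1 smmulDl smcst1_neq0.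

Arguments mk_smfun : simpl never.

Section Eval.
Variables (p : M) (Up : U p).

(** The argument [V] lets the morphism instances depend on a proof of membership: outside of the
    domain the unit evaluates to 0. *)
Definition smev (V : U p) (x : F) : R := x p.

Fact smev_zmod : zmod_morphism (smev Up).
Proof. by move=> x y; rewrite /smev [LHS]mk_smfunE // mk_smfunE. Qed.

Fact smev_monoid : monoid_morphism (smev Up).
Proof. by split=> [|x y]; rewrite /smev [LHS]mk_smfunE. Qed.

HB.instance Definition _ := GRing.isZmodMorphism.Build F R (smev Up) smev_zmod.
HB.instance Definition _ := GRing.isMonoidMorphism.Build F R (smev Up) smev_monoid.
End Eval.

Lemma smev_ext (x y : F) : (forall p (Up : U p), smev Up x = smev Up y) -> x = y.
Proof. by move=> xy; apply: smfun_ext => p Up; exact: (xy p Up). Qed.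

Definition smder (k : 'I_m) (x : F) : F :=
  mk_smfun (smooth_in_pd k (smooth_smval x)).

Arguments smder : simpl never.
Arguments smev : simpl never.

Lemma smev_der k x p (Up : U p) : smev Up (smder k x) = pd c k x p.
Proof. exact: mk_smfunE. Qed.

Fact smderD k x y : smder k (x + y) = smder k x + smder k y.
Proof.
apply: smev_ext => p Up; apply: (etrans (smev_der k _ Up)).
apply: (@etrans _ _ (pd c k (fun q => x q + y q) p)).
  by apply: (pd_ext Dopen) => // q Uq; exact: mk_smfunE.
have dx := smooth_in_on (smooth_smval x); have dy := smooth_in_on (smooth_smval y).
apply: (etrans (pdD dx dy k Up)).
apply: (etrans _ (esym (rmorphD (smev Up) (smder k x) (smder k y)))).
by congr (_ + _); exact/esym/smev_der.
Qed.

Fact smderM k x y : smder k (x * y) = smder k x * y + x * smder k y.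
Proof.
apply: smev_ext => p Up; apply: (etrans (smev_der k _ Up)).
apply: (@etrans _ _ (pd c k (fun q => x q * y q) p)).
  by apply: (pd_ext Dopen) => // q Uq; exact: mk_smfunE.
have dx := smooth_in_on (smooth_smval x); have dy := smooth_in_on (smooth_smval y).
apply: (etrans (pdM dx dy k Up)).
apply: (etrans _ (esym (rmorphD (smev Up) (smder k x * y) (x * smder k y)))).
apply: (etrans _ (congr2 +%R (esym (rmorphM (smev Up) (smder k x) y))
  (esym (rmorphM (smev Up) x (smder k y))))).
by congr (_ * _ + _ * _); exact/esym/smev_der.
Qed.

Fact smderC k l x : smder k (smder l x) = smder l (smder k x).
Proof.
have E i j p (Up : U p) : smev Up (smder i (smder j x)) = pd c i (pd c j x) p.
  apply: (etrans (smev_der i _ Up)).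
  by apply: (pd_ext Dopen) => // q Uq; exact: mk_smfunE.
apply: smev_ext => p Up; apply: (etrans (E k l p Up)).
apply: (etrans _ (esym (E l k p Up))).
by apply: (pdC Dopen) => //; exact: smooth_smval.
Qed.

Definition smframe : frame F m := Frame smderD smderM smderC.

End SmoothRing.

(** An interface hiding the construction. Pointwise hypotheses become ring identities by [sr_lift]
    and [sr_ext], and consequences return to points through the morphisms [sr_ev]. *)
Record smooth_ring (R : realType) m (M : topologicalType) (c : chart R m M)
    (D : set M) := SmoothRing {
  sr_ring :> comNzRingType;
  sr_frame : frame sr_ring m;
  sr_ev : forall p, (D `&` dom c) p -> {rmorphism sr_ring -> R};
  sr_fun : sr_ring -> M -> R;
  sr_evE : forall p (Up : (D `&` dom c) p) x, sr_ev Up x = sr_fun x p;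
  sr_smooth : forall x, smooth_in c D (sr_fun x);
  sr_ext : forall x y,
    (forall p (Up : (D `&` dom c) p), sr_ev Up x = sr_ev Up y) -> x = y;
  sr_lift : forall f, smooth_in c D f ->
    exists x, forall p (Up : (D `&` dom c) p), sr_ev Up x = f p;
  sr_der : forall k x p (Up : (D `&` dom c) p),
    sr_ev Up (sr_frame k x) = pd c k (sr_fun x) p
}.

Lemma smooth_ring_exists (R : realType) m (M : topologicalType)
    (c : chart R m M) (D : set M) p0 :
  open D -> (D `&` dom c) p0 -> inhabited (smooth_ring c D).
Proof.
move=> Dopen U0; constructor.
refine (@SmoothRing R m M c D (smfun Dopen U0) (smframe Dopen U0)
  (fun p Up => smev Up : {rmorphism smfun Dopen U0 -> R})
  (fun x => smval x) _ _ _ _ _).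
- by [].
- exact: smooth_smval.
- exact: smev_ext.
- by move=> f sf; exists (mk_smfun Dopen U0 sf) => p Up; exact: mk_smfunE.
- by move=> k x p Up; exact: smev_der.
Qed.

Section SmoothRingTheory.
Variables (R : realType) (m : nat) (M : topologicalType) (c : chart R m M).
Variables (D : set M) (Dopen : open D) (S : smooth_ring c D).
Local Notation U := (D `&` dom c).
Local Notation ev := (@sr_ev _ _ _ _ _ S _).
Local Notation d := (sr_frame S).

Lemma sr_der_lift k (x : S) f p (Up : U p) :
  (forall q (Uq : U q), ev Uq x = f q) -> ev Up (d k x) = pd c k f p.
Proof.
move=> xf; rewrite sr_der; apply: (pd_ext Dopen) => // q Uq.
by rewrite -(xf q Uq) sr_evE.
Qed.

Lemma sr_cst (a : R) : exists x : S,
  (forall p (Up : U p), ev Up x = a) /\ forall k, d k x = 0.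
Proof.
have [x xE] := sr_lift S (smooth_in_cst Dopen a); exists x; split => // k.
apply: sr_ext => p Up; rewrite rmorph0 (sr_der_lift k Up (f := fun=> a)) //.
exact: pd_cst.
Qed.

Lemma sr_lift_mx a b (T : M -> 'M[R]_(a, b)) :
  (forall i j, smooth_in c D (fun p => T p i j)) ->
  exists X : 'M[S]_(a, b), forall p (Up : U p), map_mx (ev Up) X = T p.
Proof.
move=> sT; pose X i j := sval (cid (sr_lift S (sT i j))).
exists (\matrix_(i, j) X i j) => p Up; apply/matrixP => i j; rewrite !mxE.
by rewrite (svalP (cid (sr_lift S (sT i j)))).
Qed.

Lemma sr_mx_ext a b (X Y : 'M[S]_(a, b)) :
  (forall p (Up : U p), map_mx (ev Up) X = map_mx (ev Up) Y) -> X = Y.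
Proof.
move=> XY; apply/matrixP => i j; apply: sr_ext => p Up.
by have /matrixP/(_ i j) := XY p Up; rewrite !mxE.
Qed.

Lemma sr_inv (x : S) : (forall p (Up : U p), ev Up x != 0) ->
  exists y : S, y * x = 1.
Proof.
move=> x0; have f0 p : U p -> sr_fun x p != 0.
  by move=> Up; rewrite -(sr_evE Up) x0.
have [y yE] := sr_lift S (smooth_inV Dopen f0 (sr_smooth x)); exists y.
apply: sr_ext => p Up; rewrite rmorphM rmorph1 yE sr_evE mulVf //.
exact: f0.
Qed.

Lemma sr_mx_inv n (X : 'M[S]_n) : (forall p (Up : U p), map_mx (ev Up) X \in unitmx) ->
  exists2 Y : 'M[S]_n, Y *m X = 1%:M & exists e, e * \det X = 1.
Proof.
move=> Xu; have [|e eE] := @sr_inv (\det X).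
  by move=> p Up; have := Xu p Up; rewrite unitmxE det_map_mx unitfE.
exists (e *: \adj X); last by exists e.
by rewrite -scalemxAl mul_adj_mx scale_scalar_mx eE.
Qed.

Lemma map_mx_invmx n (X Y : 'M[S]_n) p (Up : U p) : Y *m X = 1%:M ->
  map_mx (ev Up) Y = invmx (map_mx (ev Up) X).
Proof.
move=> YX; have E : map_mx (ev Up) Y *m map_mx (ev Up) X = 1%:M.
  by rewrite -map_mxM YX map_mx1.
have [_ Xu] := mulmx1_unit E.
by rewrite -[LHS](mulmxK Xu) E mul1mx.
Qed.

End SmoothRingTheory.

Lemma smooth_in_continuous (R : realType) m (M : topologicalType)
    (c : chart R m M) (D : set M) f p :
  open D -> smooth_in c D f -> (D `&` dom c) p -> {for p, continuous f}.
Proof.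
move=> Dopen sf Up; have [Dp cp] := Up.
have cc := chart_fun_continuous cp.
have cf : {for chart_fun c p, continuous (f \o param c)}.
  exact: (differentiable_continuous (smooth_in_on sf Up)).
have cfc : (f \o param c \o chart_fun c) @ p --> f p.
  rewrite -[in X in _ --> X](chart_funK cp); exact: continuous_comp cc cf.
apply: cvg_trans cfc; apply: near_eq_cvg.
have : nbhs p (dom c) by apply: open_nbhs_nbhs; split => //; exact: dom_open.
by apply: filterS => q cq /=; rewrite chart_funK.
Qed.

Lemma open_neq0 (R : realType) m (M : topologicalType) (c : chart R m M) f :
  smooth_in c setT f -> open (dom c `&` [set p | f p != 0]).
Proof.
move=> sf; rewrite openE => p [cp fp] /=.
have cf : {for p, continuous f}.
  by apply: (smooth_in_continuous openT sf); split.
have nd : nbhs p (dom c) by apply: open_nbhs_nbhs; split => //; exact: dom_open.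
have n0 : nbhs (f p) [set x : R | x != 0].
  apply: open_nbhs_nbhs; split => //; exact: open_neq.
have := cf _ n0; rewrite nbhs_filterE /= => nf.
by apply: filterI.
Qed.

(** * Commutation in one chart *)

Section LocalGeometry.
Variables (R : realType) (n : nat) (M : topologicalType).
Variables (X : manifold R (2 * n) M) (g J A : components X).
Hypotheses (hgJ : kahler g J) (hA : c_compatible g J A).
Variables (a : chart_index X) (D : set M) (Dopen : open D).
Variable S : smooth_ring (X a) D.

Local Notation m := (2 * n)%N.
Local Notation U := (D `&` dom (X a)).
Local Notation ev := (@sr_ev _ _ _ _ _ S _).
Local Notation d := (sr_frame S).

Variables (gF giF JF AF : 'M[S]_m) (h qtr : S).
Hypothesis gE : forall p (Up : U p), map_mx (ev Up) gF = g a p.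
Hypothesis JE : forall p (Up : U p), map_mx (ev Up) JF = J a p.
Hypothesis AE : forall p (Up : U p), map_mx (ev Up) AF = A a p.
Hypothesis gig : giF *m gF = 1%:M.
Hypothesis hE : forall p (Up : U p), ev Up h = 2^-1.
Hypothesis qtrE : forall p (Up : U p), ev Up qtr = 4^-1.
Hypothesis qtr_const : forall k, d k qtr = 0.

Local Notation dg := (fun k => dmx d k gF).

Definition local_gamma := koszul h giF dg.
Local Notation Gam := local_gamma.
Local Notation Lam := (grd_of d giF (qtr * \tr AF)).
Local Notation nabE := (nabE_of d Gam).
Local Notation adj := (adj_of gF giF).

Lemma local_metric_sym : gF^T = gF.
Proof.
apply: sr_mx_ext => p Up; rewrite -map_trmx gE.
by case: hgJ => [[_ /(_ a p (proj2 Up)) []]].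
Qed.
Let gT := local_metric_sym.

Let ggi : gF *m giF = 1%:M. Proof. exact: mulmx1C. Qed.

Lemma local_half : h + h = 1.
Proof.
apply: sr_ext => p Up; rewrite rmorphD rmorph1 !hE.
by rewrite [RHS]splitr mul1r.
Qed.
Let hh := local_half.

Let dgT k : (dg k)^T = dg k.
Proof. by rewrite -dmx_trmx gT. Qed.

Lemma local_metricity k : dmx d k gF = (Gam k)^T *m gF + gF *m Gam k.
Proof. exact: koszul_metric. Qed.

Lemma local_torsion k l : Gam k *m ev_of S l = Gam l *m ev_of S k.
Proof. exact: koszul_torsion. Qed.

Lemma local_J2 : JF *m JF = - 1%:M.
Proof.
apply: sr_mx_ext => p Up; rewrite map_mxM map_mxN map_mx1 JE.
by case: hgJ => [_ _ /(_ a p (proj2 Up))].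
Qed.

Lemma local_Jskew : adj JF = - JF.
Proof.
have Jg : JF^T *m gF = - (gF *m JF).
  apply: sr_mx_ext => p Up; rewrite map_mxN !map_mxM -map_trmx JE gE.
  by case: hgJ => [_ _ _ /(_ a p (proj2 Up))].
by rewrite unlock_adj -mulmxA Jg mulmxN mulmxA gig mul1mx.
Qed.

Lemma local_Aself : adj AF = AF.
Proof.
have Ag : AF^T *m gF = gF *m AF.
  apply: sr_mx_ext => p Up; rewrite !map_mxM -map_trmx AE gE.
  by case: hA => [_ /(_ a p (proj2 Up))].
by rewrite unlock_adj -mulmxA Ag mulmxA gig mul1mx.
Qed.

Lemma local_AJ : AF *m JF = JF *m AF.
Proof.
apply: sr_mx_ext => p Up; rewrite !map_mxM AE JE.
by case: hA => [_ _ /(_ a p (proj2 Up))].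
Qed.

Lemma local_gi p (Up : U p) : map_mx (ev Up) giF = invmx (g a p).
Proof. by rewrite (map_mx_invmx Up gig) gE. Qed.

Lemma ev_entry b e (Y : 'M[S]_(b, e)) (T : M -> 'M[R]_(b, e)) i j :
  (forall p (Up : U p), map_mx (ev Up) Y = T p) ->
  forall p (Up : U p), ev Up (Y i j) = T p i j.
Proof. by move=> YE p Up; rewrite -(YE p Up) mxE. Qed.

Lemma local_gammaE k i j p (Up : U p) :
  ev Up (Gam k i j) = christoffel g a p i k j.
Proof.
rewrite /local_gamma /koszul /christoffel mxE rmorph_sum mulr_sumr.
apply: eq_bigr => l _; rewrite !mxE !rmorphM /= hE rmorphB rmorphD /=.
rewrite -(local_gi Up) mxE mulrCA; congr (_ * (_ * (_ + _ - _)));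
  by apply: (sr_der_lift Dopen) => q Uq; exact: ev_entry.
Qed.

Lemma local_nabJ k : nabE k JF = 0.
Proof.
apply: sr_mx_ext => p Up; apply/matrixP => i j; rewrite map_mx0 [RHS]mxE.
case: hgJ => _ _ _ _ /(_ a p k i j (proj2 Up)) <-.
rewrite unlock_nabE !mxE rmorphB rmorphD !rmorph_sum /nabla11.
congr (_ + _ - _).
- by apply: (sr_der_lift Dopen) => q Uq; exact: ev_entry.
- apply: eq_bigr => l _; rewrite rmorphM /= local_gammaE.
  by rewrite (ev_entry _ _ JE).
- apply: eq_bigr => l _; rewrite rmorphM /= local_gammaE mulrC.
  by rewrite (ev_entry _ _ JE).
Qed.

Lemma ev_grd_low s f p (Up : U p) i : (forall q (Uq : U q), ev Uq s = f q) ->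
  ev Up ((gF *m grd_of d giF s) i 0) = pd (X a) i f p.
Proof.
move=> sE; rewrite -(sr_der_lift Dopen i Up sE); congr (ev Up _).
rewrite -(ip_grd d gT ggi) (ipC gT) unlock_ip -mulmxA.
by rewrite trmx_delta -rowE [RHS]mxE.
Qed.

Lemma local_nabA k : nabE k AF = sym_of gF JF Lam (ev_of S k).
Proof.
rewrite -[LHS]mul1mx -[RHS]mul1mx -gig -!mulmxA; congr (_ *m _).
(* Lowering the index commutes with [nabE] by metricity; this brings the derivative into the form of
   [nabla02]. *)
have -> : gF *m nabE k AF = dmx d k (gF *m AF) - (Gam k)^T *m (gF *m AF)
    - gF *m AF *m Gam k.
  rewrite unlock_nabE dmxM local_metricity !(mulmxDr, mulmxDl, mulmxN) !mulmxA.
  by mxring.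
apply: sr_mx_ext => p Up; apply/matrixP => i j; rewrite [LHS]mxE.
have gAE : forall q (Uq : U q), map_mx (ev Uq) (gF *m AF) = lower g A a q.
  by move=> q Uq; rewrite map_mxM gE AE.
transitivity (nabla02 g (lower g A) a p k i j).
  rewrite !(mx_addE, mx_oppE) !rmorphB /= /nabla02; congr (_ - _ - _).
  - by rewrite mxE; apply: (sr_der_lift Dopen) => q Uq; exact: ev_entry.
  - rewrite mxE rmorph_sum; apply: eq_bigr => l _ /=.
    by rewrite rmorphM /= mxE local_gammaE (ev_entry _ _ gAE).
  - rewrite mxE rmorph_sum; apply: eq_bigr => l _ /=.
    by rewrite rmorphM /= local_gammaE (ev_entry _ _ gAE) mulrC.
case: hA => _ _ _ /(_ a p i j k (proj2 Up)) ->.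
have lamE : forall q (Uq : U q), ev Uq (qtr * \tr AF) = 4^-1 * \tr (A a q).
  by move=> q Uq; rewrite rmorphM /= qtrE -(AE Uq) trace_map_mx.
have dlE b : ev Up ((gF *m Lam) b 0) = dlambda A a p b.
  exact: (ev_grd_low Up b lamE).
(* [dlambdabar] and [Omega] contract with the transpose of [J], so each acquires a minus sign; in
   their products the signs cancel. *)
have Jg : gF *m JF = - (JF^T *m gF).
  have := congr1 (mulmx gF) local_Jskew.
  rewrite unlock_adj !mulmxA ggi mul1mx mulmxN => ->.
  by rewrite opprK.
have dlbE b : ev Up ((gF *m (JF *m Lam)) b 0) = - dlambdabar J A a p b.
  rewrite mulmxA Jg mulNmx mxE rmorphN; congr (- _).
  rewrite -mulmxA mxE rmorph_sum; apply: eq_bigr => l _ /=.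
  by rewrite rmorphM /= dlE mxE (ev_entry _ _ JE).
have gevE b : ev Up ((gF *m ev_of S k) b 0) = g a p b k.
  by rewrite mulmx_ev (ev_entry _ _ gE).
have gJevE b : ev Up ((gF *m (JF *m ev_of S k)) b 0) = - Omega g J a p b k.
  rewrite mulmxA Jg mulNmx mxE rmorphN mulmx_ev; congr (- _).
  by rewrite (ev_entry b k (T := fun q => Omega g J a q)) // => q Uq;
     rewrite map_mxM -map_trmx JE gE.
have outE (x y : 'cV[S]_m) : ev Up ((gF *m outer_of gF x y) i j) =
    ev Up ((gF *m x) i 0) * ev Up ((gF *m y) j 0).
  rewrite unlock_outer mulmxA -[y^T *m gF]trmxK trmx_mul trmxK gT.
  by rewrite mxE big_ord1 rmorphM /= [(_^T) _ _]mxE.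
rewrite [RHS]mxE unlock_sym !mulmxDr !mx_addE !rmorphD /= !outE.
rewrite !dlE !dlbE !gevE !gJevE; ring.
Qed.

Lemma ev_dv V (x : 'cV[S]_m) p (Up : U p) :
  (forall i q (Uq : U q), ev Uq (x i 0) = V i q) ->
  divergence g a V p = ev Up (dv_of d Gam x).
Proof.
move=> xE; rewrite dv_coord rmorph_sum; apply: eq_bigr => j _ /=.
rewrite rmorphD rmorph_sum /=; congr (_ + _).
  by apply/esym/(sr_der_lift Dopen) => q Uq; exact: xE.
by apply: eq_bigr => l _; rewrite rmorphM /= local_gammaE xE.
Qed.

End LocalGeometry.

Lemma resolvent_poly_size (R : realType) m (B : 'M[R]_m) q P i j :
  resolvent_poly B q P -> (size (P i j) <= size q)%N.
Proof.
move=> H; apply/leq_sizeP => l ql.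
have /matrixP/(_ i j) := resolvent_poly_coef l H (leqnn _).
rewrite mx_tail0; first by rewrite !mxE.
by move=> k; apply: nth_default; rewrite (leq_trans ql) // addSn leqW // leq_addr.
Qed.

Lemma resolvent_poly_horner (R : realType) m (B : 'M[R]_m) q P N t :
  resolvent_poly B q P -> (size q <= N)%N ->
  map_mx (horner_eval t) P = \sum_(j < N) t ^+ j *: map_mx (coefp j) P.
Proof.
move=> H qN; apply/matrixP => i l; rewrite summxE !mxE /horner_eval.
rewrite (horner_coef_wide _ (leq_trans (resolvent_poly_size i l H) qN)).
by apply: eq_bigr => j _; rewrite !mxE mulrC.
Qed.

(** * The operators over the ring of smooth functions, as polynomials in the parameter *)

Section KaehlerOperators.
Variables (R : realType) (n : nat) (M : topologicalType).
Variables (X : manifold R (2 * n) M) (g J A : components X).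
Hypotheses (hgJ : kahler g J) (hA : c_compatible g J A).
Variable a : chart_index X.
Local Notation m := (2 * n)%N.

Lemma K_poly_resolvent p : dom (X a) p ->
  resolvent_poly (A a p) (sqrt_char_poly (A a p)) (K_poly (A a p)).
Proof.
move=> ap; have [[_ /(_ a p ap) [gT gu]] _ /(_ a p ap) JJ /(_ a p ap) Jg _] := hgJ.
have [_ /(_ a p ap) Ag /(_ a p ap) AJ _] := hA.
have [q [P H]] := hermitian_resolvent_poly gT (mulmxV gu) JJ Jg Ag AJ.
by rewrite (K_polyE H); case: H => qm Aq H; rewrite (sqrt_char_polyE qm Aq).
Qed.

Lemma size_sqrt_char_poly p : dom (X a) p -> size (sqrt_char_poly (A a p)) = n.+1.
Proof.
move=> /K_poly_resolvent [qm Aq _].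
have := size_char_poly (A a p); rewrite Aq size_mul ?monic_neq0 // => sq.
by move: sq; case: (size _) => [|k]; rewrite ?addn0 //; lia.
Qed.

Variables (D : set M) (Dopen : open D).
Hypotheses (sg : forall i j, smooth_in (X a) D (fun p => g a p i j)).
Hypotheses (sJ : forall i j, smooth_in (X a) D (fun p => J a p i j)).
Hypotheses (sA : forall i j, smooth_in (X a) D (fun p => A a p i j)).
Variable S : smooth_ring (X a) D.
Local Notation U := (D `&` dom (X a)).
Local Notation ev := (@sr_ev _ _ _ _ _ S _).
Local Notation d := (sr_frame S).

Record kaehler_lift := KaehlerLift {
  kl_g : 'M[S]_m; kl_gi : 'M[S]_m; kl_J : 'M[S]_m; kl_A : 'M[S]_m;
  kl_half : S; kl_quarter : S; kl_sqrt : {poly S};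
  kl_gE : forall p (Up : U p), map_mx (ev Up) kl_g = g a p;
  kl_JE : forall p (Up : U p), map_mx (ev Up) kl_J = J a p;
  kl_AE : forall p (Up : U p), map_mx (ev Up) kl_A = A a p;
  kl_gig : kl_gi *m kl_g = 1%:M;
  kl_halfE : forall p (Up : U p), ev Up kl_half = 2^-1;
  kl_quarterE : forall p (Up : U p), ev Up kl_quarter = 4^-1;
  kl_sqrtE : forall p (Up : U p), map_poly (ev Up) kl_sqrt = sqrt_char_poly (A a p)
}.

Lemma kaehler_lift_exists : inhabited kaehler_lift.
Proof.
have [gF gE] := sr_lift_mx S sg; have [JF JE] := sr_lift_mx S sJ.
have [AF AE] := sr_lift_mx S sA.
have [h [hE _]] := sr_cst Dopen S 2^-1; have [r [rE _]] := sr_cst Dopen S 4^-1.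
have [|giF gig _] := @sr_mx_inv _ _ _ _ _ Dopen S _ gF.
  by move=> p Up; rewrite gE; case: hgJ => [[_ /(_ a p (proj2 Up)) []]].
have hh := local_half hE.
(* The root is extracted over the ring of smooth functions; uniqueness identifies it at every point
   with the exact root [sqrt_char_poly]. *)
have [|Q [Qm sQ sPQ]] := poly_sqrt_exists (n := n) hh (char_poly_monic AF).
  by rewrite size_char_poly mul2n.
constructor; apply: (@KaehlerLift gF giF JF AF h r Q) => // p Up.
have [qm Aq _] := K_poly_resolvent (proj2 Up).
have sq := size_sqrt_char_poly (proj2 Up).
have eQm : map_poly (ev Up) Q \is monic by exact: monic_map.
have seQ : size (map_poly (ev Up) Q) = n.+1.
  by rewrite size_map_poly_id0 ?(monicP Qm) //= rmorph1 oner_eq0.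
have two : 2%:R != 0 :> R by rewrite pnatr_eq0.
have PQ : (size (char_poly (A a p) - map_poly (ev Up) Q * map_poly (ev Up) Q)%R <= n)%N.
  rewrite -(AE p Up) -map_char_poly -rmorphM -rmorphB /=.
  exact: leq_trans (size_poly _ _) sPQ.
have PA : (size (char_poly (A a p)
    - sqrt_char_poly (A a p) * sqrt_char_poly (A a p))%R <= n)%N.
  by rewrite Aq subrr size_poly0.
exact: (poly_sqrt_unique two eQm qm seQ sq PQ PA).
Qed.

Section Operator.
Variable L : kaehler_lift.
Local Notation gF := (kl_g L).
Local Notation giF := (kl_gi L).
Local Notation AF := (kl_A L).
Local Notation Gam := (local_gamma gF giF (kl_half L)).
Local Notation grd := (grd_of d giF).
Local Notation dv := (dv_of d Gam).

(** The coefficient of degree [j] of [K_t], a polynomial in [A] and therefore defined across the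
    spectrum. [n.+1] is the size of the square root; the coefficient for [j = n] vanishes, since
    [K_t] has degree [n - 1]. *)
Definition lift_K_coef j : 'M[S]_m :=
  mx_tail AF (fun i => (kl_sqrt L)`_(j.+1 + i)) n.+1.

Definition lift_K (t : S) : 'M[S]_m := \sum_(j < n.+1) t ^+ j *: lift_K_coef j.

Definition lift_op (t s : S) : S := - dv (lift_K t *m grd s).

Lemma ev_lift_K t tF p (Up : U p) : ev Up tF = t ->
  map_mx (ev Up) (lift_K tF) = map_mx (horner_eval t) (K_poly (A a p)).
Proof.
move=> tE; have H := K_poly_resolvent (proj2 Up).
have sq := size_sqrt_char_poly (proj2 Up).
rewrite (resolvent_poly_horner t H (N := n.+1)) ?sq // raddf_sum.
apply: eq_bigr => j _; rewrite /= map_mxZ rmorphXn /= tE map_mx_tail kl_AE.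
rewrite (resolvent_poly_coef j H (N := n.+1)) ?sq //; congr (_ *: mx_tail _ _ _).
by apply/funext => i; rewrite -(kl_sqrtE L Up) coef_map.
Qed.

Lemma ev_lift_flux t tF f s p (Up : U p) i : ev Up tF = t ->
  (forall q (Uq : U q), ev Uq s = f q) ->
  ev Up ((lift_K tF *m grd s) i 0) =
  \sum_(k < m) K_tensor g A t a p i k * pd (X a) k f p.
Proof.
move=> tE sE.
have -> : lift_K tF *m grd s = lift_K tF *m giF *m (gF *m grd s).
  by rewrite -!mulmxA [giF *m (_ *m _)]mulmxA kl_gig mul1mx.
rewrite [(_ *m (gF *m _)) i 0]mxE rmorph_sum; apply: eq_bigr => k _.
rewrite rmorphM /= (ev_grd_low hgJ Dopen (kl_gE L) (kl_gig L) Up k sE).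
congr (_ * _); rewrite /K_tensor -(local_gi (kl_gE L) (kl_gig L) Up).
by rewrite -(ev_lift_K tE) -map_mxM [RHS]mxE.
Qed.

Lemma ev_lift_op t tF f s p (Up : U p) : (forall q (Uq : U q), ev Uq tF = t) ->
  (forall q (Uq : U q), ev Uq s = f q) ->
  ev Up (lift_op tF s) = Ihat_in g A t a f p.
Proof.
move=> tE sE; rewrite rmorphN; congr (- _); apply/esym.
apply: (ev_dv Dopen (kl_gE L) (kl_gig L) (kl_halfE L)) => i q Uq.
exact: (ev_lift_flux i (tE q Uq) sE).
Qed.

(** The two-resolvent computation applies because [v] and [w] avoid the spectrum on all of the
    domain; [0 < n] makes the dimension invertible, as [A_hess_comm] requires. *)
Lemma lift_op_comm v w vF wF s :
  (forall q (Uq : U q), ev Uq vF = v) -> (forall q (Uq : U q), ev Uq wF = w) ->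
  (forall k, d k vF = 0) -> (forall k, d k wF = 0) ->
  (forall q, U q -> v%:M - A a q \in unitmx) ->
  (forall q, U q -> w%:M - A a q \in unitmx) ->
  (0 < n)%N -> lift_op vF (lift_op wF s) = lift_op wF (lift_op vF s).
Proof.
move=> vE wE dv0 dw0 vU wU n0.
have gT := local_metric_sym hgJ (kl_gE L).
have ggi : gF *m giF = 1%:M by apply: mulmx1C; exact: kl_gig.
have hh := local_half (kl_halfE L).
have JJ := local_J2 hgJ (kl_JE L).
have Jskew := local_Jskew hgJ (kl_gE L) (kl_JE L) (kl_gig L).
have As := local_Aself hA (kl_gE L) (kl_AE L) (kl_gig L).
have AJ := local_AJ hA (kl_JE L) (kl_AE L).
have metricity := local_metricity hgJ (kl_gE L) (kl_gig L) (kl_halfE L).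
have torsion := local_torsion hgJ giF (kl_half L) (kl_gE L).
have nabJ := local_nabJ hgJ Dopen (kl_gE L) (kl_JE L) (kl_gig L) (kl_halfE L).
have nabA := local_nabA hgJ hA Dopen (kl_gE L) (kl_JE L) (kl_AE L) (kl_gig L)
  (kl_halfE L) (kl_quarterE L).
(* The polynomial [lift_K] factors there as square root times resolvent, with the differential
   equation assumed for [qa] and [qb]. *)
have K t tF : (forall q (Uq : U q), ev Uq tF = t) -> (forall k, d k tF = 0) ->
    (forall q, U q -> t%:M - A a q \in unitmx) -> exists q b,
    [/\ lift_K tF = q *: b, b *m (tF%:M - AF) = 1%:M & forall k, d k q =
      - (ip_of gF (b *m grd (kl_quarter L * \tr AF)) (ev_of S k) * q) *+ 2].
  move=> tE dt tU.
  have evt q (Uq : U q) : map_mx (ev Uq) (tF%:M - AF) = t%:M - A a q.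
    by rewrite map_mxB map_scalar_mx tE kl_AE.
  have [|b bE [e eE]] := @sr_mx_inv _ _ _ _ _ Dopen S _ (tF%:M - AF).
    by move=> q Uq; rewrite evt; exact: tU.
  have evq q (Uq : U q) : ev Uq (kl_sqrt L).[tF] = (sqrt_char_poly (A a q)).[t].
    by rewrite -horner_map kl_sqrtE tE.
  have qq : (kl_sqrt L).[tF] * (kl_sqrt L).[tF] = \det (tF%:M - AF).
    apply: sr_ext => q Uq; rewrite rmorphM !evq -det_map_mx evt -hornerM.
    by have [_ <- _] := K_poly_resolvent (proj2 Uq); rewrite horner_char_poly.
  exists (kl_sqrt L).[tF], b; split => //.
    apply: sr_mx_ext => q Uq; rewrite (ev_lift_K (tE q Uq)) map_mxZ evq.
    rewrite (map_mx_invmx Uq bE) evt.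
    exact: (resolvent_polyE (K_poly_resolvent (proj2 Uq)) (tU q Uq)).
  (* With [e] the inverse of the determinant, which is the square of the root, [e] times the root
     inverts the root. *)
  move=> k; apply: (der_sqrt_det gT ggi hh JJ Jskew As AJ nabA dt bE qq
    (qi := e * (kl_sqrt L).[tF])).
  by rewrite -mulrA qq.
have [qv [bv [Kv bvE dqv]]] := K v vF vE dv0 vU.
have [qw [bw [Kw bwE dqw]]] := K w wF wE dw0 wU.
have [|mi mim] := @sr_inv _ _ _ _ _ Dopen S (m%:R).
  by move=> q Uq; rewrite rmorph_nat pnatr_eq0 muln_eq0 /= -lt0n.
have comm := dv_grd_dv_comm gT ggi metricity torsion hh JJ Jskew nabJ As AJ nabA s
  dv0 dw0 bvE bwE dqv dqw mim.
have grdN x : grd (- x) = - grd x.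
  by rewrite !unlock_grd -sumrN; apply: eq_bigr => k _; rewrite derN scaleNr.
have opE Y Z : - dv (Y *m grd (- dv (Z *m grd s))) = dv (Y *m grd (dv (Z *m grd s))).
  rewrite grdN mulmxN.
  exact: (etrans (congr1 -%R (dvN d Gam (Y *m grd (dv (Z *m grd s))))) (opprK _)).
rewrite /lift_op Kv Kw; exact: etrans (opE _ _) (etrans comm (esym (opE _ _))).
Qed.

Definition lift_coef_op j (s : S) : S := - dv (lift_K_coef j *m grd s).

Lemma dv_linear (I : finType) (c : I -> S) (x : I -> 'cV[S]_m) :
  (forall i k, d k (c i) = 0) ->
  dv (\sum_i c i *: x i) = \sum_i c i * dv (x i).
Proof.
move=> dc.
have dv0 : dv 0 = 0 by apply: (addrI (dv 0)); rewrite -dvD !addr0.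
rewrite (big_morph dv (@dvD _ _ d Gam) dv0); apply: eq_bigr => i _.
rewrite !dv_coord mulr_sumr; apply: eq_bigr => k _.
rewrite mulrDr [(c i *: x i) _ _]mxE derM dc mul0r add0r; congr (_ + _).
by rewrite mulr_sumr; apply: eq_bigr => l _; rewrite [(c i *: x i) _ _]mxE mulrCA.
Qed.

Lemma der_exp_const t j k : d k t = 0 -> d k (t ^+ j) = 0.
Proof.
move=> dt; elim: j => [|j IH]; first by rewrite expr0 der1.
by rewrite exprS derM IH dt mul0r mulr0 addr0.
Qed.

Lemma lift_opE t s : (forall k, d k t = 0) ->
  lift_op t s = \sum_(j < n.+1) t ^+ j * lift_coef_op j s.
Proof.
move=> dt; rewrite /lift_op /lift_K mulmx_suml.
under eq_bigr do rewrite -scalemxAl.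
rewrite dv_linear => [|i k]; last exact: der_exp_const.
by rewrite -sumrN; apply: eq_bigr => i _; rewrite mulrN.
Qed.

Lemma lift_coef_op_linear (I : finType) (c s : I -> S) j :
  (forall i k, d k (c i) = 0) ->
  lift_coef_op j (\sum_i c i * s i) = \sum_i c i * lift_coef_op j (s i).
Proof.
move=> dc; rewrite /lift_coef_op.
have -> : grd (\sum_i c i * s i) = \sum_i c i *: grd (s i).
  rewrite unlock_grd; under [RHS]eq_bigr do rewrite unlock_grd scaler_sumr.
  rewrite exchange_big; apply: eq_bigr => k _; rewrite der_sum scaler_suml.
  by apply: eq_bigr => i _; rewrite derM dc mul0r add0r scalerA.
rewrite mulmx_sumr; under eq_bigr do rewrite -scalemxAr.
by rewrite dv_linear // -sumrN; apply: eq_bigr => i _; rewrite mulrN.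
Qed.

End Operator.
End KaehlerOperators.

(** For [v] off the roots of [r], both sides are polynomials in [w] agreeing off those roots, hence
    for all [w]. As the identity exchanges [v] and [w], the same argument frees the other
    variable. *)
Lemma bipoly_antisym (R : numDomainType) N (c : 'I_N -> 'I_N -> R) (r : {poly R}) :
  r != 0 ->
  (forall v w, r.[v] != 0 -> r.[w] != 0 ->
     \sum_(i < N) \sum_(j < N) v ^+ i * w ^+ j * c i j =
     \sum_(i < N) \sum_(j < N) w ^+ i * v ^+ j * c i j) ->
  forall v w,
     \sum_(i < N) \sum_(j < N) v ^+ i * w ^+ j * c i j =
     \sum_(i < N) \sum_(j < N) w ^+ i * v ^+ j * c i j.
Proof.
move=> r0 H.
pose p1 v : {poly R} := \sum_(i < N) \sum_(j < N) (v ^+ i * c i j) *: 'X^j.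
pose p2 v : {poly R} := \sum_(i < N) \sum_(j < N) (v ^+ j * c i j) *: 'X^i.
have p1E v w : (p1 v).[w] = \sum_(i < N) \sum_(j < N) v ^+ i * w ^+ j * c i j.
  rewrite horner_sum; apply: eq_bigr => i _; rewrite horner_sum.
  by apply: eq_bigr => j _; rewrite hornerZ hornerXn mulrAC.
have p2E v w : (p2 v).[w] = \sum_(i < N) \sum_(j < N) w ^+ i * v ^+ j * c i j.
  rewrite horner_sum; apply: eq_bigr => i _; rewrite horner_sum.
  by apply: eq_bigr => j _; rewrite hornerZ hornerXn mulrC mulrA.
have p12 v : r.[v] != 0 -> p1 v = p2 v.
  by move=> rv; apply: (poly_eq_off_roots r0) => w rw; rewrite p1E p2E H.
move=> v w; rewrite -p1E -p2E.
have -> : (p1 v).[w] = (p2 w).[v] by rewrite p1E p2E.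
have -> : (p2 v).[w] = (p1 w).[v] by rewrite p1E p2E.
congr (_.[_]); apply: (poly_eq_off_roots r0) => u ru.
by rewrite p2E -(p1E u w) p12 // p2E -p1E.
Qed.

Section OneChart.
Variables (R : realType) (n : nat) (M : topologicalType).
Variables (X : manifold R (2 * n) M) (g J A : components X).
Hypotheses (hgJ : kahler g J) (hA : c_compatible g J A).
Variable a : chart_index X.

Let sg : smooth_components g. Proof. by case: hgJ => [[[]]]. Qed.
Let sJ : smooth_components J. Proof. by case: hgJ => _ []. Qed.
Let sA : smooth_components A. Proof. by case: hA => [[]]. Qed.

Lemma Ihat_in_comm_generic v w f p : (0 < n)%N -> smooth_in (X a) setT f ->
  dom (X a) p -> v%:M - A a p \in unitmx -> w%:M - A a p \in unitmx ->
  Ihat_in g A v a (Ihat_in g A w a f) p = Ihat_in g A w a (Ihat_in g A v a f) p.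
Proof.
move=> n0 sf ap vp wp.
have detE t q : (t%:M - A a q \in unitmx) = (\det (t%:M - A a q) != 0).
  by rewrite unitmxE unitfE.
have open_det t :
    open (dom (X a) `&` [set q | \det (t%:M - A a q) != 0]).
  have [S] := smooth_ring_exists openT (conj I ap : (setT `&` dom (X a)) p).
  have [AF AE] := sr_lift_mx S (@sA a).
  have [tF [tE _]] := sr_cst openT S t.
  apply: open_neq0; apply: (smooth_in_ext openT _ (sr_smooth (\det (tF%:M - AF)))).
  move=> q Uq; rewrite -(sr_evE Uq) -det_map_mx map_mxB map_scalar_mx.
  by rewrite tE AE.
(* Invertibility at [p] persists on this open set, which suffices because the operators are
   local. *)
pose D := (dom (X a) `&` [set q | \det (v%:M - A a q) != 0]) `&`
          (dom (X a) `&` [set q | \det (w%:M - A a q) != 0]).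
have Dopen : open D by exact: openI.
have Up : (D `&` dom (X a)) p.
  by split => //; split; split => //=; rewrite -detE.
have sub e : smooth_in (X a) setT e -> smooth_in (X a) D e by exact: smooth_in_sub.
have [S] := smooth_ring_exists Dopen Up.
have [L] := kaehler_lift_exists hgJ hA Dopen (fun i j => sub _ (@sg a i j))
  (fun i j => sub _ (@sJ a i j)) (fun i j => sub _ (@sA a i j)) S.
have [vF [vE dv]] := sr_cst Dopen S v; have [wF [wE dw]] := sr_cst Dopen S w.
have [s sE] := sr_lift S (sub _ sf).
have opE := ev_lift_op hgJ hA Dopen L.
have E x xF y yF : (forall q (Uq : (D `&` dom (X a)) q), sr_ev S Uq xF = x) ->
    (forall q (Uq : (D `&` dom (X a)) q), sr_ev S Uq yF = y) ->
    sr_ev S Up (lift_op L xF (lift_op L yF s)) =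
    Ihat_in g A x a (Ihat_in g A y a f) p.
  by move=> xE yE; apply: (opE) => // q Uq; exact: opE.
apply: etrans (esym (E v vF w wF vE wE)) (etrans _ (E w wF v vF wE vE)).
apply: (congr1 (sr_ev S Up)).
apply: (lift_op_comm hgJ hA Dopen L s vE wE dv dw) => //.
  by move=> q [[[_ ?] _] _]; rewrite detE.
by move=> q [[_ [_ ?]] _]; rewrite detE.
Qed.

Theorem Ihat_in_comm v w f p : smooth_in (X a) setT f -> dom (X a) p ->
  Ihat_in g A v a (Ihat_in g A w a f) p = Ihat_in g A w a (Ihat_in g A v a f) p.
Proof.
move=> sf ap; case: (posnP n) => [n0|n0].
  (* In dimension 0 the dimension is not invertible, but all sums are empty. *)
  have I0 t e : Ihat_in g A t a e p = 0.
    rewrite /Ihat_in /divergence big1 ?oppr0 // => j _.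
    by case: j => j jm; exfalso; move: jm; rewrite n0.
  by rewrite !I0.
have [S] := smooth_ring_exists openT (conj I ap : (setT `&` dom (X a)) p).
have [L] := kaehler_lift_exists hgJ hA openT (@sg a) (@sJ a) (@sA a) S.
have [s sE] := sr_lift S sf.
have Up : (setT `&` dom (X a)) p by [].
(* These numbers do not depend on the parameters, so the composition at [p] is polynomial in both.
   Off the spectrum of [A] at this single point, [Ihat_in_comm_generic] applies on a smaller
   neighbourhood. *)
pose c (i j : 'I_n.+1) := sr_ev S Up (lift_coef_op L i (lift_coef_op L j s)).
have opE := ev_lift_op hgJ hA openT L.
have E x y : Ihat_in g A x a (Ihat_in g A y a f) p =
    \sum_(i < n.+1) \sum_(j < n.+1) x ^+ i * y ^+ j * c i j.
  have [xF [xE dx]] := sr_cst openT S x; have [yF [yE dy]] := sr_cst openT S y.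
  apply: (@etrans _ _ (sr_ev S Up (lift_op L xF (lift_op L yF s)))).
    by apply/esym/opE => // q Uq; exact: opE.
  rewrite lift_opE // rmorph_sum; apply: eq_bigr => i _.
  rewrite lift_opE // lift_coef_op_linear => [|j k]; last exact: der_exp_const.
  rewrite mulr_sumr rmorph_sum; apply: eq_bigr => j _.
  by rewrite !rmorphM !rmorphXn /= xE yE mulrA.
rewrite !E; apply: (bipoly_antisym (r := char_poly (A a p))).
  exact/monic_neq0/char_poly_monic.
move=> x y; rewrite !horner_char_poly => xp yp; rewrite -!E.
by apply: Ihat_in_comm_generic; rewrite // unitmxE unitfE.
Qed.
End OneChart.

(** * Change of chart *)

Lemma differentiable_rV (R : realType) (V : normedModType R) m
    (G : V -> 'rV[R]_m) x :
  (forall k, differentiable (fun z => G z 0 k : R^o) x) -> differentiable G x.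
Proof.
move=> dG.
have -> : G = \sum_(k < m) (fun z => G z 0 k *: (delta_mx 0 k : 'rV[R]_m)).
  by apply/funext => z; rewrite fct_sumE {1}(row_sum_delta (G z)).
by apply: differentiable_sum => k; exact: differentiableZl.
Qed.

Lemma derive_chain_rV (R : realType) m m' (G : 'rV[R]_m -> 'rV[R]_m')
    (F : 'rV[R]_m' -> R^o) x v :
  (forall k, differentiable (fun z => G z 0 k : R^o) x) ->
  differentiable F (G x) ->
  'D_v (F \o G) x = \sum_k 'D_v (fun z => G z 0 k : R^o) x * 'D_(delta_mx 0 k) F (G x).
Proof.
move=> dG dF; have dGx := differentiable_rV dG.
have dGv : 'd G x v = \row_k 'D_v (fun z => G z 0 k : R^o) x.
  rewrite -deriveE // derive_mx; last exact: diff_derivable.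
  by apply/rowP => k; rewrite !mxE.
rewrite deriveE; last exact: differentiable_comp.
rewrite diff_comp //= dGv [X in 'd F _ X]row_sum_delta raddf_sum.
apply: eq_bigr => k _ /=; rewrite linearZ /= mxE.
by congr (_ * _); exact/esym/deriveE.
Qed.

Section ChangeOfChart.
Variables (R : realType) (m : nat) (M : topologicalType) (X : manifold R m M).
Variables a b : chart_index X.
Local Notation W := (dom (X a) `&` dom (X b)).

Lemma pd_chain (e : M -> R) j q : W q ->
  differentiable (e \o param (X a) : _ -> R^o) (chart_fun (X a) q) ->
  pd (X b) j e q = \sum_i transition_jac b a q i j * pd (X a) i e q.
Proof.
move=> [aq bq] de.
pose G z := chart_fun (X a) (param (X b) z).
have Gq : G (chart_fun (X b) q) = chart_fun (X a) q by rewrite /G chart_funK.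
have dG i : differentiable (fun z => G z 0 i : R^o) (chart_fun (X b) q).
  exact: (@atlas_smooth _ _ _ X b a i [::] q aq bq).
have -> : pd (X b) j e q =
    'D_(delta_mx 0 j) ((e \o param (X a)) \o G : _ -> R^o) (chart_fun (X b) q).
  apply: near_eq_derive.
  have := near_param (dom_open (X a)) (conj aq bq : (dom (X a) `&` dom (X b)) q).
  by apply: filterS => z [[az _] _] /=; rewrite /G chart_funK.
rewrite derive_chain_rV //; last by rewrite Gq.
by apply: eq_bigr => i _; rewrite Gq mxE.
Qed.

Lemma pd_coord k i q : dom (X a) q ->
  pd (X a) i (fun p => chart_fun (X a) p 0 k) q = (k == i)%:R.
Proof.
move=> aq.
have -> : pd (X a) i (fun p => chart_fun (X a) p 0 k) q =
   'D_(delta_mx 0 i) (fun z : 'rV[R]_m => z 0 k : R^o) (chart_fun (X a) q).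
  apply: near_eq_derive.
  have := near_param openT (conj I aq : (setT `&` dom (X a)) q).
  by apply: filterS => z [_ E] /=; rewrite E.
have := derive_id (chart_fun (X a) q) (delta_mx 0 i : 'rV[R]_m).
rewrite derive_mx => [/rowP/(_ k)|]; last exact: derivable_id.
by rewrite !mxE eqxx.
Qed.

End ChangeOfChart.

(** * Transformation of the Christoffel symbols and of the divergence *)

Section ChangeOfFrame.
Variables (F : comNzRingType) (m : nat) (d : frame F m) (h : F).
Variables (g gi P Q : 'M[F]_m).
Hypotheses (hh : h + h = 1) (gT : g^T = g) (ggi : g *m gi = 1%:M).
Hypotheses (PQ : P *m Q = 1%:M) (dPsym : forall i l k, d i (P k l) = d l (P k i)).

Definition moved_metric : 'M[F]_m := Q^T *m g *m Q.
Definition moved_metric_inv : 'M[F]_m := P *m gi *m P^T.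
(** The j-th coordinate derivative of the second chart by the chain rule: [P] is the Jacobian of the
    second coordinates and [Q] its inverse. The symmetry [dPsym] expresses that [P] is a
    Jacobian. *)
Definition moved_der (j : 'I_m) p q (Y : 'M[F]_(p, q)) : 'M[F]_(p, q) :=
  \sum_i Q i j *: dmx d i Y.

Local Notation gb := moved_metric.
Local Notation gbi := moved_metric_inv.
Local Notation Ga := (koszul h gi (fun k => dmx d k g)).
Local Notation Gb := (koszul h gbi (fun j => moved_der j gb)).

Let QP : Q *m P = 1%:M. Proof. exact: mulmx1C. Qed.

Let gbT : gb^T = gb.
Proof. by rewrite !trmx_mul gT trmxK mulmxA. Qed.

Lemma moved_metricK : gb *m gbi = 1%:M.
Proof.
rewrite /moved_metric /moved_metric_inv !mulmxA -[_ *m Q *m P]mulmxA QP mulmx1.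
by rewrite -[_ *m g *m gi]mulmxA ggi mulmx1 -trmx_mul PQ trmx1.
Qed.

Let dgbT j : (moved_der j gb)^T = moved_der j gb.
Proof.
rewrite raddf_sum; apply: eq_bigr => i _ /=.
by rewrite linearZ /= -dmx_trmx gbT.
Qed.

Lemma der_moved_der i p q (Y : 'M[F]_(p, q)) :
  dmx d i Y = \sum_k P k i *: moved_der k Y.
Proof.
under eq_bigr do rewrite /moved_der scaler_sumr.
rewrite exchange_big (bigD1 i) //= [X in _ + X]big1 ?addr0 => [|l li].
  under eq_bigr do rewrite scalerA mulrC.
  rewrite -scaler_suml; have /matrixP/(_ i i) := QP; rewrite !mxE eqxx => ->.
  by rewrite scale1r.
under eq_bigr do rewrite scalerA mulrC.
rewrite -scaler_suml; have /matrixP/(_ l i) := QP; rewrite !mxE (negPf li) => ->.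
by rewrite scale0r.
Qed.

Lemma mulmx_ev_sum (Y : 'M[F]_m) l : Y *m ev_of F l = \sum_r Y r l *: ev_of F r.
Proof.
apply/matrixP => i j; rewrite ord1 -colE mxE summxE (bigD1 i) //= big1 => [|k ki].
  by rewrite !mxE !eqxx mulr1 addr0.
by rewrite !mxE [i == k]eq_sym (negPf ki) mulr0.
Qed.

(** The second connection, pulled back by [P], is metric for [g]; it is torsion-free by [dPsym] and
    the symmetry of its own symbols. Uniqueness identifies it with the first one. *)
Lemma koszul_change i :
  Q *m (dmx d i P + (\sum_k P k i *: Gb k) *m P) = Ga i.
Proof.
pose N i := \sum_k P k i *: Gb k.
pose G i := Q *m (dmx d i P + N i *m P).
have gE : g = P^T *m gb *m P.
  rewrite /moved_metric !mulmxA -trmx_mul QP trmx1 mul1mx -mulmxA QP.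
  by rewrite mulmx1.
have gQ : g *m Q = P^T *m gb by rewrite [in LHS]gE -mulmxA PQ mulmx1.
have dgb l : dmx d l gb = (N l)^T *m gb + gb *m N l.
  rewrite der_moved_der raddf_sum mulmx_suml mulmx_sumr -big_split.
  apply: eq_bigr => k _ /=; rewrite linearZ /= -scalemxAl -scalemxAr -scalerDr.
  by congr (_ *: _); exact: koszul_metric hh gbT moved_metricK dgbT k.
(* [B] hides that [gb] is itself a product containing [g], so that the rewriting below treats it as
   an atom. *)
have [B [BT gB gQB dB]] : exists B : 'M[F]_m, [/\ B^T = B, g = P^T *m B *m P,
    g *m Q = P^T *m B & forall l, dmx d l B = (N l)^T *m B + B *m N l].
  by exists gb; split.
apply: (koszul_unique hh gT ggi (dg := fun k => dmx d k g) (Gam := G)).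
- move=> k; have -> : (G k)^T *m g = (g *m G k)^T by rewrite [RHS]trmx_mul gT.
  rewrite [g *m G k]mulmxA gQB [in LHS]gB !dmxM dB dmx_trmx.
  rewrite !(trmx_mul, mulmxDr, mulmxDl, linearD) /= trmxK BT !mulmxA.
  by rewrite [(N k *m P)^T]trmx_mul; mxring.
- move=> k l; rewrite /G -!mulmxA; congr (Q *m _); rewrite !mulmxDl.
  congr (_ + _).
    by apply/matrixP => r s; rewrite ord1 -!colE !mxE dPsym.
  rewrite -!mulmxA !mulmx_ev_sum /N !mulmx_suml.
  under eq_bigr => r _.
    rewrite -scalemxAl mulmx_sumr scaler_sumr.
    under eq_bigr => s _ do
      rewrite -scalemxAr (koszul_torsion h gbi dgbT r s) scalerA mulrC.
    over.
  rewrite exchange_big; apply: eq_bigr => r _ /=.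
  rewrite -scalemxAl mulmx_sumr scaler_sumr; apply: eq_bigr => s _.
  by rewrite -scalemxAr scalerA.
Qed.

(** A divergence is the trace of a covariant differential. In [koszul_change] the term with
    [dmx d i P] accounts for differentiating the transition matrix in [y]. *)
Lemma divergence_change (x : 'cV[F]_m) (y := P *m x) :
  \sum_j (moved_der j y j 0 + \sum_l Gb j j l * y l 0) =
  \sum_i (d i (x i 0) + \sum_l Ga i i l * x l 0).
Proof.
have E (Y : 'I_m -> 'M[F]_m) (z : 'cV[F]_m) :
    \sum_j \sum_l Y j j l * z l 0 = \sum_j (Y j *m z) j 0.
  by apply: eq_bigr => j _; rewrite mxE.
rewrite !big_split /= !E.
have -> : \sum_j moved_der j y j 0 = \sum_i (Q *m dmx d i y) i 0.
  under eq_bigr do rewrite summxE.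
  rewrite exchange_big; apply: eq_bigr => i _; rewrite mxE.
  by apply: eq_bigr => j _; rewrite mxE.
under [X in _ = _ + X]eq_bigr => i _ do
  rewrite -koszul_change -mulmxA mulmxDl mulmxDr -mulmxA -/y mx_addE.
rewrite big_split addrA; congr (_ + _) => /=.
  rewrite -big_split; apply: eq_bigr => i _ /=.
  by rewrite /y dmxM mulmxDr [Q *m (P *m _)]mulmxA QP mul1mx mxE addrC
    [dmx _ _ _ _ _]mxE addrC.
transitivity (\sum_j (P *m (Q *m (Gb j *m y))) j 0).
  by apply: eq_bigr => j _; rewrite mulmxA PQ mul1mx.
under [LHS]eq_bigr do rewrite mxE.
rewrite [LHS]exchange_big; apply: eq_bigr => i _ /=.
rewrite mulmx_suml mulmx_sumr summxE; apply: eq_bigr => k _.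
by rewrite -scalemxAl -scalemxAr [RHS]mxE.
Qed.

End ChangeOfFrame.

Section ChartIndependence.
Variables (R : realType) (n : nat) (M : topologicalType).
Variables (X : manifold R (2 * n) M) (g J A : components X).
Hypotheses (hgJ : kahler g J) (hA : c_compatible g J A).
Variables (a b : chart_index X).
Local Notation m := (2 * n)%N.
Local Notation U := (dom (X b) `&` dom (X a)).

Lemma transition_jacK q : dom (X a) q -> dom (X b) q ->
  transition_jac a b q *m transition_jac b a q = 1%:M.
Proof.
move=> aq bq; apply/matrixP => k j; rewrite !mxE -(pd_coord k j bq).
rewrite (pd_chain j (conj aq bq)); last exact: (@atlas_smooth _ _ _ X a b k [::] q bq aq).
by apply: eq_bigr => i _; rewrite mulrC !mxE.
Qed.

(** Conjugation by the Jacobian carries a certificate [resolvent_poly] for [A] in one chart to one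
    in the other. Thus the chosen [K_poly] transforms as a tensor, and the remaining Jacobians
    cancel against those of [g] and of the derivatives of [f]. *)
Lemma flux_change t f q j : dom (X a) q -> dom (X b) q -> smooth_in (X a) setT f ->
  \sum_(k < m) K_tensor g A t b q j k * pd (X b) k f q =
  \sum_(i < m) transition_jac a b q j i *
     \sum_(k < m) K_tensor g A t a q i k * pd (X a) k f q.
Proof.
move=> aq bq sf; set P := transition_jac a b q; set Q := transition_jac b a q.
have PQ : P *m Q = 1%:M by exact: transition_jacK.
have QP := mulmx1C PQ.
have [[[_ tg] gu] _ _ _ _] := hgJ; have [[_ tA] _ _ _] := hA.
have [gT gau] := gu a q aq; have [_ gbu] := gu b q bq.
have gbi : invmx (g b q) = P *m invmx (g a q) *m P^T.
  rewrite -[RHS](mulmxK gbu) -[_ *m P^T *m _]mulmxA.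
  have -> : P^T *m g b q = g a q *m Q.
    by rewrite (tg a b q aq bq) -/P -!mulmxA PQ mulmx1.
  by rewrite -mulmxA [invmx _ *m (_ *m Q)]mulmxA mulVmx // mul1mx PQ mul1mx.
have hC (Y : 'M[R]_m) : map_mx (horner_eval t) (map_mx polyC Y) = Y.
  by apply/matrixP => k l; rewrite !mxE /horner_eval hornerC.
have KE : K_tensor g A t b q = P *m K_tensor g A t a q *m P^T.
  have H := resolvent_poly_conj PQ (tA a b q aq bq) (K_poly_resolvent hgJ hA aq).
  rewrite /K_tensor (K_polyE H) gbi !map_mxM /= !hC !mulmxA.
  by rewrite -[_ *m Q *m P]mulmxA QP mulmx1.
pose u c : 'cV[R]_m := \col_k pd (X c) k f q.
have uE : u b = Q^T *m u a.
  apply/matrixP => k l; rewrite !mxE (pd_chain k (conj aq bq)); last first.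
    exact: (sf [::]).
  by apply: eq_bigr => i _; rewrite !mxE.
transitivity ((K_tensor g A t b q *m u b) j 0).
  by rewrite mxE; apply: eq_bigr => k _; rewrite !mxE.
rewrite KE uE mulmxA -[_ *m P^T *m _]mulmxA -trmx_mul QP trmx1 mulmx1 -mulmxA mxE.
apply: eq_bigr => i _; rewrite [X in _ * X]mxE; congr (_ * _).
by apply: eq_bigr => k _; rewrite [u a _ _]mxE.
Qed.

(** On the overlap both computations take place in one ring, that of chart [a] restricted to the
    domain of [b], where the derivatives of [b] are combinations of those of [a]. The claim is then
    [divergence_change] for the flux. *)
Theorem Ihat_in_change t f p : dom (X a) p -> dom (X b) p ->
  smooth_in (X a) setT f -> Ihat_in g A t a f p = Ihat_in g A t b f p.
Proof.
move=> ap bp sf; have bopen : open (dom (X b)) by exact: dom_open.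
have aopen : open (dom (X a)) by exact: dom_open.
have sub e : smooth_in (X a) setT e -> smooth_in (X a) (dom (X b)) e.
  exact: smooth_in_sub.
have [[[sg tg] gu] [sJ _] _ _ _] := hgJ; have [[sA _] _ _ _] := hA.
have Up : U p by [].
have [S] := smooth_ring_exists bopen Up.
have [L] := kaehler_lift_exists hgJ hA bopen (fun i j => sub _ (@sg a i j))
  (fun i j => sub _ (@sJ a i j)) (fun i j => sub _ (@sA a i j)) S.
have [tF [tE dt]] := sr_cst bopen S t.
have [s sE] := sr_lift S (sub _ sf).
(* The coordinates of [b] as ring elements. Their derivatives form [P], so that [dPsym] is the
   commutation of derivations. *)
pose y k := sval (cid (sr_lift S (@atlas_smooth _ _ _ X a b k))).
have yE k q (Uq : U q) : sr_ev S Uq (y k) = chart_fun (X b) q 0 k.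
  exact: (svalP (cid (sr_lift S (@atlas_smooth _ _ _ X a b k))) q Uq).
pose P : 'M[S]_m := \matrix_(k, i) sr_frame S i (y k).
have PE q (Uq : U q) : map_mx (sr_ev S Uq) P = transition_jac a b q.
  apply/matrixP => k i; rewrite !mxE.
  exact: (sr_der_lift bopen i Uq (yE k)).
have [|Q QP _] := @sr_mx_inv _ _ _ _ _ bopen S _ P.
  move=> q Uq; rewrite PE.
  by case: (mulmx1_unit (transition_jacK (proj2 Uq) (proj1 Uq))).
have PQ := mulmx1C QP.
have QE q (Uq : U q) : map_mx (sr_ev S Uq) Q = transition_jac b a q.
  have [Pu _] := mulmx1_unit (transition_jacK (proj2 Uq) (proj1 Uq)).
  rewrite (map_mx_invmx Uq QP) PE -[RHS](mulKmx Pu).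
  by rewrite (transition_jacK (proj2 Uq) (proj1 Uq)) mulmx1.
have dPsym i l k : sr_frame S i (P k l) = sr_frame S l (P k i).
  by rewrite !mxE derC.
have derE j z e q (Uq : U q) : (forall r (Ur : U r), sr_ev S Ur z = e r) ->
    sr_ev S Uq (\sum_i Q i j * sr_frame S i z) = pd (X b) j e q.
  move=> ze; have aq := proj2 Uq; have bq := proj1 Uq.
  rewrite -(pd_ext aopen (f := sr_fun z)); first last.
  - by split.
  - by move=> r [ar br]; rewrite -(ze r (conj br ar)) sr_evE.
  rewrite (pd_chain j (conj aq bq)); last exact: (@sr_smooth _ _ _ _ _ S z [::] q bq aq).
  rewrite rmorph_sum; apply: eq_bigr => i _.
  by rewrite rmorphM /= sr_der -(QE q Uq) mxE.
have gT := local_metric_sym hgJ (kl_gE L).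
have ggi : kl_g L *m kl_gi L = 1%:M by apply: mulmx1C; exact: kl_gig.
have hh := local_half (kl_halfE L).
pose gb := moved_metric (kl_g L) Q.
have gbE q (Uq : U q) : map_mx (sr_ev S Uq) gb = g b q.
  have aq := proj2 Uq; have bq := proj1 Uq.
  rewrite !map_mxM -map_trmx QE kl_gE (tg a b q aq bq) !mulmxA.
  rewrite -trmx_mul (transition_jacK aq bq) trmx1 mul1mx -mulmxA.
  by rewrite (transition_jacK aq bq) mulmx1.
have gbiE q (Uq : U q) :
    map_mx (sr_ev S Uq) (moved_metric_inv (kl_gi L) P) = invmx (g b q).
  by rewrite (map_mx_invmx Uq (mulmx1C (moved_metricK ggi PQ))) gbE.
pose Gb := koszul (kl_half L) (moved_metric_inv (kl_gi L) P)
  (fun j => moved_der (sr_frame S) Q j gb).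
have dgbE j r l q (Uq : U q) : sr_ev S Uq (moved_der (sr_frame S) Q j gb r l) =
    pd (X b) j (fun q => g b q r l) q.
  rewrite -(derE j (gb r l)) => [|q' Uq']; last exact: ev_entry.
  by rewrite summxE; congr (sr_ev S Uq _); apply: eq_bigr => i _; rewrite !mxE.
have GbE k i j q (Uq : U q) :
    sr_ev S Uq (Gb k i j) = christoffel g b q i k j.
  rewrite /Gb /koszul /christoffel mxE rmorph_sum mulr_sumr.
  apply: eq_bigr => l _; rewrite rmorphM /= (ev_entry i l gbiE).
  by rewrite mxE rmorphM /= (kl_halfE L) rmorphB rmorphD /= !dgbE mulrCA.
pose x := lift_K L tF *m grd_of (sr_frame S) (kl_gi L) s.
have fluxE q (Uq : U q) j : sr_ev S Uq ((P *m x) j 0) =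
    \sum_(k < m) K_tensor g A t b q j k * pd (X b) k f q.
  rewrite (flux_change t j (proj2 Uq) (proj1 Uq) sf) mxE rmorph_sum.
  apply: eq_bigr => i _; rewrite rmorphM /= (ev_entry j i PE); congr (_ * _).
  exact: (ev_lift_flux hgJ hA bopen L i (tE q Uq) sE).
apply: (etrans (esym (ev_lift_op hgJ hA bopen L Up tE sE))).
rewrite rmorphN dv_coord; congr (- _).
apply: (etrans (congr1 (sr_ev S Up) (esym (divergence_change hh gT ggi PQ dPsym x)))).
rewrite rmorph_sum; apply: eq_bigr => j _.
rewrite rmorphD rmorph_sum /=; congr (_ + _).
  rewrite -(derE j ((P *m x) j 0)) => [|q Uq]; last exact: fluxE.
  by rewrite summxE; congr (sr_ev S Up _); apply: eq_bigr => i _; rewrite !mxE.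
apply: eq_bigr => l _; rewrite rmorphM /= fluxE; congr (_ * _); exact: GbE.
Qed.

End ChartIndependence.

Lemma Ihat_in_ext (R : realType) m (M : topologicalType) (X : manifold R m M)
    (g A : components X) t a (f f' : M -> R) p :
  (forall q, dom (X a) q -> f q = f' q) -> dom (X a) p ->
  Ihat_in g A t a f p = Ihat_in g A t a f' p.
Proof.
move=> ff ap.
have E j q : dom (X a) q -> \sum_(k < m) K_tensor g A t a q j k * pd (X a) k f q =
    \sum_(k < m) K_tensor g A t a q j k * pd (X a) k f' q.
  move=> aq; apply: eq_bigr => k _; congr (_ * _).
  by apply: (pd_ext openT) => // r [_ ar]; exact: ff.
apply: (congr1 -%R); apply: eq_bigr => j _; apply: (congr2 +%R).
  by apply: (pd_ext openT) => // r [_ ar]; exact: E.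
by apply: eq_bigr => l _; rewrite E.
Qed.

Lemma dom_chart_at (R : realType) m (M : topologicalType) (X : manifold R m M) p :
  dom (X (chart_at X p)) p.
Proof. exact: (svalP (cid (atlas_cover X p))). Qed.

Theorem theorem3 (R : realType) (n : nat) (M : topologicalType)
  (X : manifold R (2 * n) M) (g J A : components X)
  (hgJ : kahler g J) (hA : c_compatible g J A)
  (v w : R) (f : M -> R) (hf : smooth X f) (p : M) :
  Ihat g A v (Ihat g A w f) p - Ihat g A w (Ihat g A v f) p = 0.
Proof.
have ap := dom_chart_at X p; set a := chart_at X p in ap.
(* The inner operator uses a chart varying with [q]. On the domain of [a] it agrees with the
   computation in [a], and the outer operator sees only this domain. *)
have E t q : dom (X a) q -> Ihat g A t f q = Ihat_in g A t a f q.
  move=> aq; have bq := dom_chart_at X q.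
  exact: (Ihat_in_change hgJ hA t bq aq (hf _)).
rewrite /Ihat -/(Ihat g A v f) -/(Ihat g A w f) -/a.
rewrite (Ihat_in_ext g A v (E w) ap) (Ihat_in_ext g A w (E v) ap).
by rewrite (Ihat_in_comm hgJ hA v w (hf a) ap) subrr.
Qed.
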